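(* Let $(M,J,\langle\cdot,\cdot\rangle)$ be an almost Hermitian manifold of dimension $2n$, $n\ge2$, with intrinsic torsion $\xi=\xi_{(1)}+\dots+\xi_{(4)}$, Lee form $\theta$, minimal connection $\nabla^{U(n)}$ and $\ast$-Ricci tensor $\mathrm{Ric}^*$. The following hold for all vector fields $X,Y$. (i) If $\xi\in\mathcal W_1\oplus\mathcal W_2\oplus\mathcal W_4$, then $$\mathrm{Ric}^*_{[[\lambda^{2,0}]]}(X,Y)=-\langle(\nabla^{U(n)}_{e_i}\xi_{(2)})_{e_i}X,Y\rangle+\tfrac{n+1}6(d\theta)_{[[\lambda^{2,0}]]}(X,Y)+\tfrac n2\langle\xi_{(2)\theta^\sharp}X,Y\rangle.$$ In particular: (a) if $\xi\in\mathcal W_1\oplus\mathcal W_4$, then $\mathrm{Ric}^*_{[[\lambda^{2,0}]]}=\tfrac{n+1}6\,d\theta$; moreover, if $n=3$, then $\mathrm{Ric}^*_{[[\lambda^{2,0}]]}=d\theta=0$; (b) if $\xi\in\mathcal W_2\oplus\mathcal W_4$ and $n>2$, then $\mathrm{Ric}^*_{[[\lambda^{2,0}]]}(X,Y)=-\langle(\nabla^{U(n)}_{e_i}\xi_{(2)})_{e_i}X,Y\rangle+\tfrac n2\langle\xi_{(2)\theta^\sharp}X,Y\rangle$; if $n=2$, then $\mathrm{Ric}^*_{[[\lambda^{2,0}]]}(X,Y)=-\langle(\nabla^{U(n)}_{e_i}\xi_{(2)})_{e_i}X,Y\rangle+\tfrac12(d\theta)_{[[\lambda^{2,0}]]}(X,Y)+\langle\xi_{(2)\theta^\sharp}X,Y\rangle$.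 (ii) If the structure is Hermitian ($\xi\in\mathcal W_3\oplus\mathcal W_4$), then: (a) $\mathrm{Ric}^*_{[[\lambda^{2,0}]]}=\tfrac{n-1}2(d\theta)_{[[\lambda^{2,0}]]}$; moreover, if $n>2$, we also have $$\mathrm{Ric}^*_{[[\lambda^{2,0}]]}(X,Y)=\tfrac{n-1}{n-2}\Big(\langle(\nabla^{U(n)}_{e_i}\xi_{(3)})_{e_i}X,Y\rangle-\tfrac{n-1}2\langle\xi_{(3)\theta^\sharp}X,Y\rangle\Big);$$ (b) if $n=2$, then $(\mathrm{Ric}-\mathrm{Ric}^* )_{[\lambda^{1,1}_0]}=0$.
   Context: An almost Hermitian manifold is a smooth $2n$-manifold with an almost complex structure $J$ ($J^2=-I$) and a Riemannian metric with $\langle JX,JY\rangle=\langle X,Y\rangle$. Kähler form: $\omega(X,Y)=\langle X,JY\rangle$. $\nabla$ is the Levi-Civita connection. The intrinsic torsion is the $(1,2)$-tensor $\xi_XY=-\tfrac12J(\nabla_XJ)Y$; each $\xi_X$ is skew-symmetric and anticommutes with $J$. The minimal connection is $\nabla^{U(n)}=\nabla+\xi$. Let $\mathcal W$ be the space (bundle) of $(1,2)$-tensors $\xi$ with each $\xi_X$ skew-symmetric and $J\xi_X+\xi_XJ=0$. It decomposes orthogonally as $\mathcal W_1\oplus\mathcal W_2\oplus\mathcal W_3\oplus\mathcal W_4$ (Gray–Hervella), where: $\mathcal W_1$: $\xi_XX=0$ for all $X$; $\mathcal W_2$: the cyclic sum over $X,Y,Z$ of $\langle\xi_XY,JZ\rangle$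 vanishes; $\mathcal W_3$: $\xi_{JX}JY=\xi_XY$ and $\sum_i\xi_{e_i}e_i=0$; $\mathcal W_4$: tensors of the form $4\xi_XY=\langle X,Y\rangle\theta^\sharp-\theta(Y)X-\langle JX,Y\rangle J\theta^\sharp+(J\theta)(Y)JX$ for a one-form $\theta$, where $(J\theta)(X)=-\theta(JX)$ and $\theta^\sharp$ is the metric dual. For $n=2$, $\mathcal W_1=\mathcal W_3=0$. $\xi_{(a)}$ is the component of $\xi$ in $\mathcal W_a$; $\xi\in\mathcal W_a\oplus\mathcal W_b\oplus\cdots$ means all other components vanish everywhere. Lee form: $\theta=-\tfrac1{n-1}Jd^*\omega$ with $d^*$ the codifferential and $(Ja)(X)=-a(JX)$ for one-forms $a$; equivalently $\sum_i\xi_{e_i}e_i=\tfrac{n-1}2\theta^\sharp$. $\{e_1,\dots,e_{2n}\}$ is a local orthonormal frame; a repeated index $i$ means summation from $1$ to $2n$. Curvature: $R_{X,Y}=\nabla_{[X,Y]}-[\nabla_X,\nabla_Y]$. $\mathrm{Ric}(X,Y)=\langle R_{X,e_i}Y,e_i\rangle$ is the usual Ricci tensor and $\mathrm{Ric}^*(X,Y)=\langle R_{X,e_i}JY,Je_i\rangle$. Since $\mathrm{Ric}^*(JX,JY)=\mathrm{Ric}^*(Y,X)$, the symmetric part of $\mathrm{Ric}^*$ is $J$-invariant and its skew part is $J$-anti-invariant; $\mathrm{Ric}^*_{[[\lambda^{2,0}]]}$ denotes the skew part, a two-form. For a two-form $\alpha$, $\alpha_{[[\lambda^{2,0}]]}(X,Y)=\tfrac12(\alpha(X,Y)-\alpha(JX,JY))$;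 $d\theta(X,Y)=(\nabla_X\theta)(Y)-(\nabla_Y\theta)(X)$. For $b=\mathrm{Ric}-\mathrm{Ric}^*$, $b_{[\lambda^{1,1}_0]}$ denotes the trace-free part of the $J$-invariant symmetric tensor $\tfrac12(b_s(X,Y)+b_s(JX,JY))$, where $b_s$ is the symmetric part of $b$.
   Formalization: In (i)(a) for n=2 the formula is stated with the projection of dθ to [[λ^{2,0}]] in place of dθ, because dθ can then have a non-zero J-invariant part and the literal formula fails; for n>2 it is as stated. *)

(* Defs.v *)
From HB Require Import structures.
From mathcomp Require Import all_boot all_order all_algebra.
From mathcomp Require Import ring.
From mathcomp Require Import all_classical all_reals all_analysis.

Set Implicit Arguments.
Unset Strict Implicit.
Unset Printing Implicit Defensive.

Import Order.TTheory GRing.Theory Num.Theory.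
Import numFieldNormedType.Exports.

Local Open Scope classical_set_scope.
Local Open Scope ring_scope.

Notation basis_vec i := (delta_mx 0 i).

Definition iter_partial (R : realType) (m : nat) (V : normedModType R)
    (s : seq 'I_m) (f : 'rV[R]_m -> V) : 'rV[R]_m -> V :=
  foldr (fun i h x => 'D_(basis_vec i) h x) f s.

Definition smooth_on (R : realType) (m : nat) (V : normedModType R)
    (U : set 'rV[R]_m) (f : 'rV[R]_m -> V) : Prop :=
  forall (s : seq 'I_m) x, U x ->
    {for x, continuous (iter_partial s f)} /\
    forall i, derivable (iter_partial s f) x (basis_vec i).

(* A smooth manifold with a chosen smooth atlas. The homeomorphism attached to
   the chart [c] is [coord c] from [dom c] onto its image, with inverse
   [param c]; outside of these sets the values are irrelevant. *)
Record manifold (R : realType) (m : nat) := Manifold {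
  points :> topologicalType;
  points_hausdorff : hausdorff_space points;
  points_second_countable : @second_countable points;
  chart : Type;
  dom : chart -> set points;
  coord : chart -> points -> 'rV[R]_m;
  param : chart -> 'rV[R]_m -> points;
  dom_open : forall c, open (dom c);
  dom_cover : forall p, exists c, dom c p;
  range_open : forall c, open (coord c @` dom c);
  coordK : forall c p, dom c p -> param c (coord c p) = p;
  coord_continuous : forall c p, dom c p -> {for p, continuous (coord c)};
  param_continuous : forall c x, (coord c @` dom c) x ->
    {for x, continuous (param c)};
  transition_smooth : forall c d,
    smooth_on (coord c @` (dom c `&` dom d)) (coord d \o param c)
}.

Definition crange (R : realType) (m : nat) (M : manifold R m) (c : chart M) :
  set 'rV[R]_m := coord c @` dom c.

(* Components of a metric and of an endomorphism field in a chart. Tangent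
   vectors are row vectors: <u, v> = u G v^T and J u = u *m J. *)
Record local_structure (R : realType) (m : nat) := LocalStructure {
  met : 'rV[R]_m -> 'M[R]_m;
  acs : 'rV[R]_m -> 'M[R]_m
}.

Definition dot (R : realType) (m : nat) (S : local_structure R m)
    (x u v : 'rV[R]_m) : R := (u *m met S x *m v^T) 0 0.

Definition Jv (R : realType) (m : nat) (S : local_structure R m)
    (x u : 'rV[R]_m) : 'rV[R]_m := u *m acs S x.

Record almost_hermitian (R : realType) (n : nat) (M : manifold R (2 * n)) :=
    AlmostHermitian {
  str :> chart M -> local_structure R (2 * n);
  met_smooth : forall c i j,
    smooth_on (crange c) (fun x => met (str c) x i j);
  acs_smooth : forall c i j,
    smooth_on (crange c) (fun x => acs (str c) x i j);
  met_sym : forall c x u v, crange c x -> dot (str c) x u v = dot (str c) x v u;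
  met_pos : forall c x u, crange c x -> u != 0 -> 0 < dot (str c) x u u;
  acs_sq : forall c x u, crange c x -> Jv (str c) x (Jv (str c) x u) = - u;
  met_acs : forall c x u v, crange c x ->
    dot (str c) x (Jv (str c) x u) (Jv (str c) x v) = dot (str c) x u v;
  (* Tensoriality under the transition map [coord d \o param c], whose
     differential at x maps the tangent vector u to 'D_u (coord d \o param c) x. *)
  met_tensor : forall c d p, dom c p -> dom d p -> forall u v,
    let x := coord c p in let tau := coord d \o param c in
    dot (str d) (tau x) ('D_u tau x) ('D_v tau x) = dot (str c) x u v;
  acs_tensor : forall c d p, dom c p -> dom d p -> forall u,
    let x := coord c p in let tau := coord d \o param c in
    Jv (str d) (tau x) ('D_u tau x) = 'D_(Jv (str c) x u) tau x
}.

Section MetricAlgebra.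
Context {R : realType} {m : nat} (S : local_structure R m).
Local Notation E := ('rV[R]_m).

(* Metric contraction g^{ij} B(d_i, d_j); it is the sum of B(e_i, e_i) over any
   orthonormal basis, see [mtraceE]. *)
Definition mtrace (V : lmodType R) (x : E) (B : E -> E -> V) : V :=
  \sum_i \sum_j invmx (met S x) i j *: B (basis_vec i) (basis_vec j).

Definition sharp (x : E) (a : E -> R) : E :=
  (\row_j a (basis_vec j)) *m invmx (met S x).

End MetricAlgebra.

Section Connection.
Context {R : realType} {m : nat} (S : local_structure R m).
Local Notation E := ('rV[R]_m).
Local Notation field := (E -> E).

Definition dmet (x : E) (k i j : 'I_m) : R :=
  'D_(basis_vec k) (fun y => met S y i j) x.

Definition christoffel (x : E) (i j : 'I_m) : E :=
  (\row_l (2^-1 * (dmet x i j l + dmet x j i l - dmet x l i j)))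
    *m invmx (met S x).

(* Levi-Civita connection; see [christoffelC] and [christoffel_metric]. *)
Definition nabla (X Y : field) : field := fun x =>
  'D_(X x) Y x + \sum_i \sum_j (X x 0 i * Y x 0 j) *: christoffel x i j.

Definition bracket (X Y : field) : field := fun x =>
  'D_(X x) Y x - 'D_(Y x) X x.

Definition curv (X Y Z : field) : field := fun x =>
  nabla (bracket X Y) Z x - (nabla X (nabla Y Z) x - nabla Y (nabla X Z) x).

(* Tensors are evaluated on tangent vectors at x through the extensions of these
   vectors to fields with constant components. *)
Definition curvature (x u v w : E) : E := curv (cst u) (cst v) (cst w) x.

Definition nablaJ (X Y : field) : field := fun x =>
  nabla X (fun y => Jv S y (Y y)) x - Jv S x (nabla X Y x).

Definition torsion (x u v : E) : E :=
  - (2^-1 *: Jv S x (nablaJ (cst u) (cst v) x)).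

Definition nablaU (X Y : field) : field := fun x =>
  nabla X Y x + torsion x (X x) (Y x).

(* (nablaU_u eta)_v w *)
Definition nablaU_tensor (eta : E -> E -> E -> E) (x u v w : E) : E :=
  nablaU (cst u) (fun y => eta y v w) x
  - eta x (nablaU (cst u) (cst v) x) w
  - eta x v (nablaU (cst u) (cst w) x).

(* <(nablaU_{e_i} eta)_{e_i} u, v> *)
Definition div_tensor (eta : E -> E -> E -> E) (x u v : E) : R :=
  dot S x (mtrace S x (fun a b => nablaU_tensor eta x a b u)) v.

Definition nabla_form1 (a : E -> E -> R) (x u v : E) : R :=
  'D_u (fun y => a y v) x - a x (nabla (cst u) (cst v) x).

Definition nabla_form2 (a : E -> E -> E -> R) (x u v w : E) : R :=
  'D_u (fun y => a y v w) x
  - a x (nabla (cst u) (cst v) x) w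
  - a x v (nabla (cst u) (cst w) x).

Definition dform1 (a : E -> E -> R) (x u v : E) : R :=
  nabla_form1 a x u v - nabla_form1 a x v u.

Definition codiff (a : E -> E -> E -> R) (x v : E) : R :=
  - mtrace S x (fun e f => nabla_form2 a x e f v).

Definition Jform1 (a : E -> E -> R) (x v : E) : R := - a x (Jv S x v).

Definition kahler (x u v : E) : R := dot S x u (Jv S x v).

Definition proj20 (a : E -> E -> E -> R) (x u v : E) : R :=
  2^-1 * (a x u v - a x (Jv S x u) (Jv S x v)).

Definition ric (x u v : E) : R :=
  mtrace S x (fun e f => dot S x (curvature x u e v) f).

Definition ric_star (x u v : E) : R :=
  mtrace S x (fun e f => dot S x (curvature x u e (Jv S x v)) (Jv S x f)).

Definition ric_star20 (x u v : E) : R :=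
  2^-1 * (ric_star x u v - ric_star x v u).

End Connection.

Section Dimension2n.
Context {R : realType} {n : nat} (S : local_structure R (2 * n)).
Local Notation E := ('rV[R]_(2 * n)).

Definition lee (x v : E) : R :=
  - ((n%:R - 1)^-1 * Jform1 S (codiff S (kahler S)) x v).

Definition dlee : E -> E -> E -> R := dform1 S lee.

Definition lee_sharp (x : E) : E := sharp S x (lee x).

Definition sym_part (b : E -> E -> E -> R) (x u v : E) : R :=
  2^-1 * (b x u v + b x v u).

Definition Jinv_part (b : E -> E -> E -> R) (x u v : E) : R :=
  2^-1 * (b x u v + b x (Jv S x u) (Jv S x v)).

Definition tracefree_part (b : E -> E -> E -> R) (x u v : E) : R :=
  b x u v - (2 * n)%:R^-1 * mtrace S x (b x) * dot S x u v.

Definition proj11_0 (b : E -> E -> E -> R) : E -> E -> E -> R :=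
  tracefree_part (Jinv_part (sym_part b)).

(* The fibre at x of the bundle W and of its four Gray-Hervella subbundles. *)
Definition in_W (x : E) (t : E -> E -> E) : Prop :=
  [/\ (forall u, linear (t u)), (forall v, linear (t^~ v)),
      (forall u v w, dot S x (t u v) w = - dot S x v (t u w))
    & (forall u v, Jv S x (t u v) + t u (Jv S x v) = 0)].

Definition in_W1 (x : E) (t : E -> E -> E) : Prop :=
  in_W x t /\ forall u, t u u = 0.

Definition in_W2 (x : E) (t : E -> E -> E) : Prop :=
  in_W x t /\ forall u v w,
    dot S x (t u v) (Jv S x w) + dot S x (t v w) (Jv S x u)
    + dot S x (t w u) (Jv S x v) = 0.

Definition in_W3 (x : E) (t : E -> E -> E) : Prop :=
  [/\ in_W x t, (forall u v, t (Jv S x u) (Jv S x v) = t u v)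
    & mtrace S x t = 0].

Definition in_W4 (x : E) (t : E -> E -> E) : Prop :=
  in_W x t /\ exists a : E -> R, scalar a /\ forall u v,
    4 *: t u v = dot S x u v *: sharp S x a - a v *: u
                 - dot S x (Jv S x u) v *: Jv S x (sharp S x a)
                 - a (Jv S x v) *: Jv S x u.

End Dimension2n.

(* A field of (1,2)-tensors, by its expression in every chart. *)
Definition tensor12 (R : realType) (m : nat) (M : manifold R m) :=
  chart M -> 'rV[R]_m -> 'rV[R]_m -> 'rV[R]_m -> 'rV[R]_m.

Definition vanishes (R : realType) (m : nat) (M : manifold R m)
    (t : tensor12 M) : Prop :=
  forall c x u v, crange c x -> t c x u v = 0.

(* W being the direct sum of the four fibres, the components are determined by
   this property on the range of every chart; in particular they are smooth and
   compatible with changes of charts. *)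
Definition torsion_components (R : realType) (n : nat) (M : manifold R (2 * n))
    (H : almost_hermitian M) (xi1 xi2 xi3 xi4 : tensor12 M) : Prop :=
  forall c x, crange c x ->
    [/\ in_W1 (H c) x (xi1 c x), in_W2 (H c) x (xi2 c x),
        in_W3 (H c) x (xi3 c x), in_W4 (H c) x (xi4 c x)
      & forall u v, torsion (H c) x u v =
          xi1 c x u v + xi2 c x u v + xi3 c x u v + xi4 c x u v].

Lemma dot_basisl (R : realType) (m : nat) (S : local_structure R m)
    (x : 'rV[R]_m) (w : 'rV[R]_m) (l : 'I_m) :
  dot S x w (basis_vec l) = (w *m met S x) 0 l.
Proof. by rewrite /dot trmx_delta -colE mxE. Qed.

Lemma mtraceE (R : realType) (m : nat) (S : local_structure R m)
    (V : lmodType R) (x : 'rV[R]_m) (B : 'rV[R]_m -> 'rV[R]_m -> V)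
    (e : 'I_m -> 'rV[R]_m) :
  (forall u, linear (B u)) -> (forall v, linear (B^~ v)) ->
  (forall i j, dot S x (e i) (e j) = (i == j)%:R) ->
  mtrace S x B = \sum_i B (e i) (e i).
Proof.
move=> Br Bl on.
pose A := \matrix_i e i.
have AGA : A *m (met S x *m A^T) = 1%:M.
  apply/matrixP => i j; rewrite [RHS]mxE -on /dot mulmxA -[e i in RHS](rowK e).
  by rewrite -row_mul !mxE; apply: eq_bigr => k _; rewrite !mxE.
have GAA : met S x *m (A^T *m A) = 1%:M by rewrite mulmxA; exact: mulmx1C.
have iG : invmx (met S x) = A^T *m A.
  have uG : met S x \in unitmx by case/mulmx1_unit: GAA.
  by rewrite -[RHS](mulKmx uG) GAA mulmx1.
have B0r u : B u 0 = 0.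
  by have := Br u (-1) 0 0; rewrite scaler0 addr0 scaleN1r addNr.
have B0l v : B 0 v = 0.
  by have := Bl v (-1) 0 0; rewrite scaler0 addr0 scaleN1r addNr.
have Bsr u (c : 'I_m -> R) :
    B u (\sum_j c j *: basis_vec j) = \sum_j c j *: B u (basis_vec j).
  elim/big_rec2: _ => // j y1 y2 _ <-; exact: Br.
have Bsl v (c : 'I_m -> R) :
    B (\sum_j c j *: basis_vec j) v = \sum_j c j *: B (basis_vec j) v.
  elim/big_rec2: _ => // j y1 y2 _ <-; exact: Bl.
transitivity (\sum_k \sum_i \sum_j (A k i * A k j) *: B (basis_vec i) (basis_vec j)).
  rewrite /mtrace [RHS]exchange_big /=.
  apply: eq_bigr => i _; rewrite [RHS]exchange_big /=; apply: eq_bigr => j _.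
  rewrite iG !mxE scaler_suml; apply: eq_bigr => k _.
  by rewrite !mxE.
apply: eq_bigr => k _.
rewrite [e k in RHS]row_sum_delta Bsl; apply: eq_bigr => i _.
rewrite Bsr scaler_sumr; apply: eq_bigr => j _.
by rewrite scalerA !mxE.
Qed.

Lemma sharpE (R : realType) (m : nat) (S : local_structure R m)
    (x : 'rV[R]_m) (a : 'rV[R]_m -> R) (l : 'I_m) :
  met S x \in unitmx -> dot S x (sharp S x a) (basis_vec l) = a (basis_vec l).
Proof. by move=> uG; rewrite dot_basisl /sharp mulmxKV // mxE. Qed.

Lemma dmet_sym (R : realType) (m : nat) (S : local_structure R m)
    (x : 'rV[R]_m) (k i j : 'I_m) :
  (\forall y \near x, (met S y)^T = met S y) -> dmet S x k i j = dmet S x k j i.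
Proof.
move=> sG; apply: near_eq_derive; near=> y.
have sGy : (met S y)^T = met S y by near: y.
by rewrite -{1}sGy mxE.
Unshelve. all: by end_near. Qed.

Lemma christoffelC (R : realType) (m : nat) (S : local_structure R m)
    (x : 'rV[R]_m) (i j : 'I_m) :
  (\forall y \near x, (met S y)^T = met S y) ->
  christoffel S x i j = christoffel S x j i.
Proof.
move=> sG; rewrite /christoffel; congr (_ *m _); apply/rowP => l; rewrite !mxE.
by rewrite (addrC (dmet S x i j l)) (dmet_sym _ i j sG).
Qed.

Lemma christoffel_metric (R : realType) (m : nat) (S : local_structure R m)
    (x : 'rV[R]_m) (k i j : 'I_m) :
  (\forall y \near x, (met S y)^T = met S y) -> met S x \in unitmx ->
  dmet S x k i j = dot S x (christoffel S x k i) (basis_vec j)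
                   + dot S x (basis_vec i) (christoffel S x k j).
Proof.
move=> sG uG; have sGx := nbhs_singleton sG.
have dC a b : dot S x a b = dot S x b a.
  rewrite /dot; transitivity ((b *m met S x *m a^T)^T 0 0); last by rewrite mxE.
  by rewrite !trmx_mul trmxK sGx mulmxA.
rewrite [X in _ + X]dC !dot_basisl /christoffel !mulmxKV // !mxE -mulrDr.
rewrite (dmet_sym k j i sG) (dmet_sym i k j sG) (dmet_sym j k i sG).
by field.
Qed.

(* Main.v *)
(* The curvature satisfies [R(X,Y), J] = -2 J A(X,Y), where A(X,Y) is the skew
   part of the derivative of xi for the minimal connection plus a term quadratic
   in xi. Contracting A in two ways, once against the symmetry of Ric and once
   through the first Bianchi identity, gives two formulas for the skew part of
   Ric*. In each of W1+W2+W4 and W3+W4 the quadratic terms can be computed, and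
   linear combinations of the two formulas give (i) and (ii)(a). In W1+W4 the
   J-invariant part of the first formula says that (n-2) dtheta_11 is a multiple
   of omega, and its trace shows that this multiple is 0. For n = 2 a frame
   (u, Ju, v, Jv) shows W3 = 0, and then the symmetric J-invariant part of
   Ric - Ric* is a multiple of the metric.

   For n = 3 and xi = eta + xi4 in W1+W4, the Weyl connection with Lee form theta
   has minimal torsion eta. A fibre of W1 is a complex line, so the derivative of
   eta is alpha eta + beta J eta, and the Bianchi identity of the Weyl connection
   forces beta = - alpha o J where eta <> 0. There eta has constant type,
   |eta_X Y|^2 = mu |X|^2 |Y|^2 for Y orthogonal to X and JX, and the 3-form
   phi = <eta_X Y, Z> / mu satisfies
   d phi = 2 theta /\ phi + 4 omega /\ omega. Now d^2 = 0 yields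
   dtheta /\ phi = 0, hence dtheta = 0. On the interior of the zero set of eta,
   dtheta is a multiple of the divergence of eta, hence 0 as well. *)
From Pilot Require Import Defs.
From HB Require Import structures.
From mathcomp Require Import all_boot all_order all_algebra.
From mathcomp Require Import ring lra.
From mathcomp Require Import all_classical all_reals all_analysis.

Set Implicit Arguments.
Unset Strict Implicit.
Unset Printing Implicit Defensive.

Import Order.TTheory GRing.Theory Num.Theory.
Import numFieldNormedType.Exports.

Local Open Scope classical_set_scope.
Local Open Scope ring_scope.

(** * Symmetry of second derivatives *)

Section Directional.
Context {R : realType} {V : normedModType R}.
Implicit Types (f : V -> R) (x y z e : V).

(** Two features of the setting shape the proof. Smoothness is known only through iterated partial
    derivatives in charts, so the linearity of the derivative in its direction and the symmetry of
    second derivatives are obtained from the mean value theorem. And the components of the torsion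
    are given point by point: their smoothness must be recovered before they can be differentiated.
    This succeeds because the trace of the torsion determines the W4 part, alternation then isolates
    the W1 part, and the remaining class is a difference.

    Both formulas for the skew part of the star-Ricci tensor are needed in W1+W2+W4 because each
    contains the divergence of the W1 part, with different coefficients; eliminating it produces
    (i).

    For n = 3, d^2 phi = 0 reduces to dtheta /\ phi = 0 because d omega equals theta /\ omega plus a
    form of type (3,0)+(0,3): the former makes the terms in theta /\ omega /\ omega cancel, and the
    product of the latter with omega is 0 in complex dimension 3. *)

Lemma is_derive_line f z e (t : R) :
  derivable f (t *: e + z) e ->
  is_derive t 1 (fun s : R => f (s *: e + z)) ('D_e f (t *: e + z)).
Proof.
move=> df.
have E : (fun h : R => h^-1 *:
      (((fun s : R => f (s *: e + z)) \o shift t) (h *: 1) - f (t *: e + z)))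
  = (fun h => h^-1 *: ((f \o shift (t *: e + z)) (h *: e) - f (t *: e + z))).
  by apply/funext => h /=; rewrite [_ *: 1]mulr1 scalerDl addrA.
by split; rewrite /derivable /derive E.
Qed.

(** Only derivability along [e] is at hand, so the mean value theorem is applied to one real
    variable. The parameter runs over [0, 1] and [h] scales it, which avoids a case distinction on
    the sign of [h]. *)
Lemma mean_value_line f z e (h : R) :
  (forall t : R, 0 <= t <= 1 -> derivable f ((t * h) *: e + z) e) ->
  exists2 c, 0 <= c <= 1 & f (h *: e + z) - f z = h * 'D_e f ((c * h) *: e + z).
Proof.
move=> df.
pose F := fun t : R => f ((t * h) *: e + z).
have dF (t : R) : 0 <= t <= 1 -> is_derive t (1 : R) F (h * 'D_e f ((t * h) *: e + z)).
  move=> t01; have := is_derive_line (df t t01).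
  rewrite -[X in is_derive X]/(t * h) => dl.
  have dm : is_derive t (1 : R) (fun s : R => s * h) h.
    apply: (is_derive_eq (is_deriveM (is_derive_id _ _) (is_derive_cst _ _ _))).
    by rewrite /cst /= scaler0 add0r [_ *: _]mulr1.
  have := @is_derive1_comp _ (fun s => f (s *: e + z)) (fun s => s * h) t _ _ dl dm.
  by rewrite mulrC.
have cF : {within `[0, 1], continuous F}.
  apply: derivable_within_continuous => t; rewrite in_itv /= => t01.
  by have [] := dF t t01.
have itv01 (t : R) : t \in `]0, 1[%R -> 0 <= t <= 1.
  by rewrite in_itv /= => /andP[t0 t1]; rewrite !ltW.
have [c c01] := @MVT_segment _ F (fun t => h * 'D_e f ((t * h) *: e + z)) 0 1 ler01
    (fun t t01 => dF t (itv01 t t01)) cF.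
rewrite subr0 mulr1 /F mul1r mul0r scale0r add0r => E.
by exists c => //; move: c01; rewrite in_itv.
Qed.

(** Uniformity in both coefficients: for small [h] the whole parallelogram on [h e] and [h a] stays
    in the neighbourhood, and with it the unknown intermediate points of the mean value theorem. *)
Lemma nbhs_segment (P : set V) x :
  nbhs x P -> forall e a, \forall h \near (0 : R),
    forall c d : R, 0 <= c <= 1 -> 0 <= d <= 1 -> P ((c * h) *: e + ((d * h) *: a + x)).
Proof.
move=> /nbhs_ballP[r /= r0 rP] e a.
near=> h => c d /andP[c0 c1] /andP[d0 d1]; apply: rP.
rewrite -ball_normE /ball_ /= addrA opprD [- _ - x]addrC addrA subrr add0r normrN.
apply: (@le_lt_trans _ _ (`|h| * (`|e| + `|a|))).
  have N k (v : V) : 0 <= k -> k <= 1 -> `|(k * h) *: v| <= `|h| * `|v|.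
    move=> k0 k1; rewrite -scalerA normrZ (ger0_norm k0) normrZ.
    by rewrite ler_piMl ?mulr_ge0.
  by apply: (le_trans (ler_normD _ _)); rewrite mulrDr lerD ?N.
have p : 0 < `|e| + `|a| + 1 by rewrite ltr_wpDl ?addr_ge0.
apply: (@le_lt_trans _ _ (`|h| * (`|e| + `|a| + 1))).
  by rewrite ler_wpM2l // lerDl.
rewrite -ltr_pdivlMr //.
near: h; apply: (@nbhs0_lt _ R^o); exact: divr_gt0.
Unshelve. all: by end_near. Qed.

(** The increment along [h (a + c e)] is split at [h a + x]. The first piece is the derivative along
    [a]; the second starts from a moving point and is controlled by the mean value theorem and the
    continuity of ['D_e f]. *)
Lemma is_derive_add_dir f x a e (c : R) :
  derivable f x a -> (\forall y \near x, derivable f y e) ->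
  {for x, continuous (fun y => 'D_e f y)} ->
  is_derive x (a + c *: e) f ('D_a f x + c * 'D_e f x).
Proof.
move=> da de ce.
have lim1 : (fun h : R => h^-1 *: ((f \o shift x) (h *: a) - f x)) @ 0^' --> 'D_a f x by exact: da.
have lim2 : (fun h : R => h^-1 *: (f (h *: (c *: e) + (h *: a + x)) - f (h *: a + x)))
   @ 0^' --> c * 'D_e f x.
  apply/cvgrPdist_le => /= eps eps0.
  have c1 : 0 < `|c| + 1 by rewrite ltr_wpDl.
  move/cvgrPdist_le: ce => /(_ (eps / (`|c| + 1)) (divr_gt0 eps0 c1)) ce.
  pose P := (fun y => derivable f y e) `&` (fun t => `|'D_e f x - 'D_e f t| <= eps / (`|c| + 1)).
  have fx : nbhs x P by exact: filterI.
  have S := nbhs_segment fx (c *: e) a.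
  near=> h.
  have Sh : forall c0 d : R, 0 <= c0 <= 1 -> 0 <= d <= 1 ->
      P ((c0 * h) *: (c *: e) + ((d * h) *: a + x)).
    by near: h; apply: nbhs_dnbhs.
  have h0 : h != 0 by near: h; exact: nbhs_dnbhs_neq.
  have u01 : 0 <= (1 : R) <= 1 by rewrite ler01 lexx.
  have [|d d01] := @mean_value_line f (h *: a + x) e (h * c).
    move=> t t01; have [+ _] := Sh t 1 t01 u01.
    by rewrite mul1r scalerA mulrA.
  rewrite scalerA => ->.
  rewrite [_ *: _]mulrA mulrA mulVf // mul1r -mulrBr normrM.
  have [_] := Sh d 1 d01 u01.
  rewrite mul1r scalerA -mulrA => H.
  apply: (@le_trans _ _ (`|c| * (eps / (`|c| + 1)))); first by rewrite ler_wpM2l.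
  by rewrite mulrA ler_pdivrMr // mulrDr mulr1 [eps * _]mulrC lerDl ltW.
have E : (fun h : R => h^-1 *: ((f \o shift x) (h *: (a + c *: e)) - f x)) =
  (fun h : R => h^-1 *: ((f \o shift x) (h *: a) - f x)) \+
  (fun h : R => h^-1 *: (f (h *: (c *: e) + (h *: a + x)) - f (h *: a + x))).
  apply/funext => h /=; rewrite -[RHS]scalerDr; congr (_ *: _).
  have -> : h *: (a + c *: e) + x = h *: (c *: e) + (h *: a + x).
    by rewrite addrA -scalerDr [c *: e + a]addrC.
  by ring.
have L := cvgD lim1 lim2.
split; rewrite /derivable /derive E; first by apply/cvg_ex; eexists; exact: L.
by apply: cvg_lim; [exact: norm_hausdorff|exact: L].
Unshelve. all: by end_near. Qed.

(** The second difference quotient [F] is symmetric in its two directions, and two applications of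
    the mean value theorem show that it tends to either iterated derivative. *)
Lemma derive_symmetric f x e a :
  (\forall y \near x, derivable f y e) -> (\forall y \near x, derivable f y a) ->
  (\forall y \near x, derivable (fun z => 'D_e f z) y a) ->
  (\forall y \near x, derivable (fun z => 'D_a f z) y e) ->
  {for x, continuous (fun y => 'D_a (fun z => 'D_e f z) y)} ->
  {for x, continuous (fun y => 'D_e (fun z => 'D_a f z) y)} ->
  'D_a (fun z => 'D_e f z) x = 'D_e (fun z => 'D_a f z) x.
Proof.
pose F u v := fun h : R =>
  (h^-1) ^+ 2 * (f (h *: u + (h *: v + x)) - f (h *: u + x) - f (h *: v + x) + f x).
suff main u v : (\forall y \near x, derivable f y u) ->
  (\forall y \near x, derivable (fun z => 'D_u f z) y v) ->
  {for x, continuous (fun y => 'D_v (fun z => 'D_u f z) y)} ->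
  F u v @ 0^' --> 'D_v (fun z => 'D_u f z) x.
  move=> d1 d2 d3 d4 c1 c2.
  have L1 := main _ _ d1 d3 c1; have L2 := main _ _ d2 d4 c2.
  suff FE : F e a = F a e.
    by rewrite -(cvg_lim (@norm_hausdorff _ _) L1) FE; exact: (cvg_lim (@norm_hausdorff _ _) L2).
  apply/funext => h; rewrite /F.
  by rewrite [h *: a + (h *: e + x)]addrCA; congr (_ * _); ring.
move=> d1 d2 c1.
apply/cvgrPdist_le => /= eps eps0.
move/cvgrPdist_le: c1 => /(_ eps eps0) c1; rewrite /F.
pose P := (fun y => derivable f y u) `&` ((fun y => derivable (fun z => 'D_u f z) y v) `&`
  (fun t => `|'D_v (fun z => 'D_u f z) x - 'D_v (fun z => 'D_u f z) t| <= eps)).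
have fx : nbhs x P by do 2! [apply: filterI => //].
have S := nbhs_segment fx u v.
near=> h.
have h0 : h != 0 by near: h; exact: nbhs_dnbhs_neq.
have Sh : forall c d : R, 0 <= c <= 1 -> 0 <= d <= 1 -> P ((c * h) *: u + ((d * h) *: v + x)).
  by near: h; apply: nbhs_dnbhs.
have u01 : 0 <= (1 : R) <= 1 by rewrite ler01 lexx.
have z01 : 0 <= (0 : R) <= 1 by rewrite lexx ler01.
(* The second difference is the increment of [G] along [u], and the derivative of [G] along [u] is
   in turn an increment of ['D_u f] along [v]. *)
pose G := (fun y => f (h *: v + y)) \- f.
have dfv y : derivable f (h *: v + y) u ->
  is_derive y u (fun y => f (h *: v + y)) ('D_u f (h *: v + y)).
  move=> df.
  have E : (fun k : R => k^-1 *: (((fun y => f (h *: v + y)) \o shift y) (k *: u) - f (h *: v + y)))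
    = (fun k => k^-1 *: ((f \o shift (h *: v + y)) (k *: u) - f (h *: v + y))).
    by apply/funext => k /=; rewrite addrCA.
  by split; rewrite /derivable /derive E.
have dG y : derivable f (h *: v + y) u -> derivable f y u ->
  is_derive y u G ('D_u f (h *: v + y) - 'D_u f y).
  by move=> /dfv ? /derivableP ?; apply: is_deriveB.
have [t t01|c c01 E1] := @mean_value_line G x u h.
  apply: ex_derive; apply: dG.
    by have [+ _] := Sh t 1 t01 u01; rewrite mul1r addrCA.
  by have [+ _] := Sh t 0 t01 z01; rewrite mul0r scale0r add0r.
have [t t01|d d01 E2] := @mean_value_line (fun z => 'D_u f z) ((c * h) *: u + x) v h.
  by have [_ [+ _]] := Sh c t c01 t01; rewrite addrCA.
have DG : 'D_u G ((c * h) *: u + x) =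
    h * 'D_v (fun z => 'D_u f z) ((d * h) *: v + ((c * h) *: u + x)).
  rewrite -E2; apply: derive_val; apply: dG.
    by have [+ _] := Sh c 1 c01 u01; rewrite mul1r addrCA.
  by have [+ _] := Sh c 0 c01 z01; rewrite mul0r scale0r add0r.
have -> : f (h *: u + (h *: v + x)) - f (h *: u + x) - f (h *: v + x) + f x =
   G (h *: u + x) - G x by rewrite /G /= [h *: v + (h *: u + x)]addrCA; ring.
rewrite E1 DG mulrA -expr2 mulrA -exprMn mulVf // expr1n mul1r.
by have [_ [_ +]] := Sh c d c01 d01; rewrite addrCA.
Unshelve. all: by end_near. Qed.

End Directional.

Local Opaque derive.

(** * Smooth functions on an open set *)

Section SmoothFunctions.
Context {R : realType} {m : nat} (U : set 'rV[R]_m).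
Hypothesis oU : open U.
Local Notation E := 'rV[R]_m.
Implicit Types (f g : E -> R) (x u v : E).

(** Recursion on the order, instead of the words of partial derivatives in [smooth_on], lets closure
    under products and inverses follow by induction from the first-order Leibniz rule. *)
Fixpoint Ck (k : nat) f : Prop :=
  (forall x, U x -> {for x, continuous f}) /\
  (if k is k'.+1 then
     forall i, (forall x, U x -> derivable f x (basis_vec i)) /\ Ck k' ('D_(basis_vec i) f)
   else True).

Definition smooth f := forall k, Ck k f.

Lemma open_near x : U x -> \forall y \near x, U y.
Proof. by move=> Ux; apply: open_nbhs_nbhs; split. Qed.

Lemma near_on (P : set E) x : U x -> (forall y, U y -> P y) -> \forall y \near x, P y.
Proof. by move=> Ux UP; apply: filterS (open_near Ux). Qed.

Lemma derive_eq_on (V : normedModType R) (f g : E -> V) x v :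
  (forall y, U y -> f y = g y) -> U x -> 'D_v f x = 'D_v g x.
Proof. by move=> fg Ux; apply: near_eq_derive; apply: near_on Ux _. Qed.

Lemma derivable_eq_on (V : normedModType R) (f g : E -> V) x v :
  (forall y, U y -> f y = g y) -> U x -> derivable f x v -> derivable g x v.
Proof. by move=> fg Ux; apply: near_eq_derivable; apply: near_on Ux _. Qed.

Lemma continuous_eq_on f g x : (forall y, U y -> f y = g y) -> U x ->
  {for x, continuous f} -> {for x, continuous g}.
Proof.
move=> fg Ux cf; rewrite /prop_for /continuous_at -(fg x Ux).
have e : \forall y \near x, f y = g y by exact: near_on.
by apply: cvg_trans cf; exact: (near_eq_cvg e).
Qed.

Lemma Ck_continuous k f x : Ck k f -> U x -> {for x, continuous f}.
Proof. by case: k => [|k] [cf _] Ux; exact: cf. Qed.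

Lemma CkS k f : Ck k.+1 f -> Ck k f.
Proof.
elim: k f => [|k IH] f [cf df]; first by split.
by split => // i; have [d1 d2] := df i; split => //; exact: IH.
Qed.

Lemma Ck_eq k f g : (forall y, U y -> f y = g y) -> Ck k f -> Ck k g.
Proof.
elim: k f g => [|k IH] f g fg [cf df].
  by split => // x Ux; exact: continuous_eq_on (cf x Ux).
split => [x Ux|i]; first exact: continuous_eq_on (cf x Ux).
have [d1 d2] := df i; split => [x Ux|]; first exact: derivable_eq_on (d1 x Ux).
by apply: IH d2 => y Uy; exact: derive_eq_on.
Qed.

Lemma Ck_cst k (c : R) : Ck k (cst c).
Proof.
elim: k c => [|k IH] c; (split => [x Ux|]; first exact: cst_continuous) => // i.
split => [x _|]; first exact: derivable_cst.
by apply: Ck_eq (IH 0) => y _; rewrite derive_cst.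
Qed.

Lemma CkD k f g : Ck k f -> Ck k g -> Ck k (fun y => f y + g y).
Proof.
elim: k f g => [|k IH] f g [cf df] [cg dg].
  by split => // x Ux; apply: continuousD; [exact: cf|exact: cg].
split => [x Ux|i]; first by apply: continuousD; [exact: cf|exact: cg].
have [df1 df2] := df i; have [dg1 dg2] := dg i; split => [x Ux|].
  by apply: derivableD; [exact: df1|exact: dg1].
apply: Ck_eq (IH _ _ df2 dg2) => y Uy.
by rewrite [RHS]deriveD //; [exact: df1|exact: dg1].
Qed.

Lemma CkM k f g : Ck k f -> Ck k g -> Ck k (fun y => f y * g y).
Proof.
elim: k f g => [|k IH] f g Cf Cg; have [cf df] := Cf; have [cg dg] := Cg.
  by split => // x Ux; apply: continuousM; [exact: cf|exact: cg].
split => [x Ux|i]; first by apply: continuousM; [exact: cf|exact: cg].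
have [df1 df2] := df i; have [dg1 dg2] := dg i; split => [x Ux|].
  by apply: derivableM; [exact: df1|exact: dg1].
apply: Ck_eq (CkD (IH _ _ (CkS Cf) dg2) (IH _ _ (CkS Cg) df2)) => y Uy.
by rewrite [RHS]deriveM //; [exact: df1|exact: dg1].
Qed.

Lemma CkV k f : (forall x, U x -> f x != 0) -> Ck k f -> Ck k (fun y => (f y)^-1).
Proof.
move=> f0; elim: k => [|k IH] Cf; have [cf df] := Cf.
  by split => // x Ux; apply: continuousV; [exact: f0|exact: cf].
split => [x Ux|i]; first by apply: continuousV; [exact: f0|exact: cf].
have [df1 df2] := df i; split => [x Ux|].
  by apply: derivableV; [exact: f0|exact: df1].
have CV := IH (CkS Cf).
apply: Ck_eq (CkM (Ck_cst k (-1)) (CkM (CkM CV CV) df2)) => y Uy.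
rewrite [RHS]deriveV; [|exact: f0|exact: df1].
by rewrite /cst scaleNr mulN1r -expr2 exprVn.
Qed.

Lemma smooth_eq f g : (forall y, U y -> f y = g y) -> smooth f -> smooth g.
Proof. by move=> fg Sf k; exact: Ck_eq (Sf k). Qed.

Lemma smooth_cst (c : R) : smooth (fun=> c).
Proof. by move=> k; exact: Ck_cst. Qed.

Lemma smoothD f g : smooth f -> smooth g -> smooth (fun y => f y + g y).
Proof. by move=> Sf Sg k; exact: CkD. Qed.

Lemma smoothM f g : smooth f -> smooth g -> smooth (fun y => f y * g y).
Proof. by move=> Sf Sg k; exact: CkM. Qed.

Lemma smoothV f : (forall x, U x -> f x != 0) -> smooth f -> smooth (fun y => (f y)^-1).
Proof. by move=> f0 Sf k; exact: CkV. Qed.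

Lemma smoothZ (c : R) f : smooth f -> smooth (fun y => c * f y).
Proof. by move=> Sf; apply: smoothM => //; exact: smooth_cst. Qed.

Lemma smoothN f : smooth f -> smooth (fun y => - f y).
Proof. by move=> Sf; apply: smooth_eq (smoothZ (-1) Sf) => y _; rewrite mulN1r. Qed.

Lemma smoothB f g : smooth f -> smooth g -> smooth (fun y => f y - g y).
Proof. by move=> Sf Sg; apply: smoothD => //; exact: smoothN. Qed.

Lemma smooth_sum (I : Type) (r : seq I) (P : pred I) (F : I -> E -> R) :
  (forall i, smooth (F i)) -> smooth (fun y => \sum_(i <- r | P i) F i y).
Proof.
move=> SF; elim: r => [|i r IH].
  by apply: smooth_eq (smooth_cst 0) => y _; rewrite big_nil.
case Pi: (P i).
  by apply: smooth_eq (smoothD (SF i) IH) => y _; rewrite big_cons Pi.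
by apply: smooth_eq IH => y _; rewrite big_cons Pi.
Qed.

Lemma smooth_prod (I : Type) (r : seq I) (P : pred I) (F : I -> E -> R) :
  (forall i, smooth (F i)) -> smooth (fun y => \prod_(i <- r | P i) F i y).
Proof.
move=> SF; elim: r => [|i r IH].
  by apply: smooth_eq (smooth_cst 1) => y _; rewrite big_nil.
case Pi: (P i).
  by apply: smooth_eq (smoothM (SF i) IH) => y _; rewrite big_cons Pi.
by apply: smooth_eq IH => y _; rewrite big_cons Pi.
Qed.

Lemma smooth_det (p : nat) (A : E -> 'M[R]_p) :
  (forall i j, smooth (fun y => A y i j)) -> smooth (fun y => \det (A y)).
Proof.
move=> SA; apply: smooth_sum => s; apply: smoothZ; apply: smooth_prod => i; exact: SA.
Qed.

Lemma smooth_invmx (p : nat) (A : E -> 'M[R]_p) (i j : 'I_p) :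
  (forall y, U y -> A y \in unitmx) ->
  (forall i j, smooth (fun y => A y i j)) -> smooth (fun y => invmx (A y) i j).
Proof.
move=> uA SA.
apply: (@smooth_eq (fun y => (\det (A y))^-1 * ((-1) ^+ (j + i) * \det (row' j (col' i (A y)))))).
  by move=> y Uy; rewrite /invmx uA // !mxE.
apply: smoothM; last by apply: smoothZ; apply: smooth_det => k l;
  apply: smooth_eq (SA (lift j k) (lift i l)) => y _; rewrite !mxE.
apply: smoothV; last exact: smooth_det.
by move=> y /uA; rewrite unitmxE unitfE.
Qed.

Lemma smooth_on_smooth f : smooth_on U f -> smooth f.
Proof.
move=> Sf k; elim: k f Sf => [|k IH] f Sf.
  by split => // x Ux; have [] := Sf [::] x Ux.
split => [x Ux|i]; first by have [] := Sf [::] x Ux.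
split => [x Ux|]; first by have [_] := Sf [::] x Ux; exact.
apply: IH => s x Ux; have := Sf (rcons s i) x Ux.
by rewrite /iter_partial foldr_rcons.
Qed.

(** Coordinates are added one at a time with [is_derive_add_dir]; continuity of the partial
    derivatives is what makes the derivative linear in the direction. *)
Lemma Ck_is_derive k f x v : Ck k.+1 f -> U x ->
  is_derive x v f (\sum_i v 0 i * 'D_(basis_vec i) f x).
Proof.
move=> [_ Cf] Ux; rewrite {1}[v]row_sum_delta.
have : forall s : seq 'I_m, is_derive x (\sum_(i <- s) v 0 i *: basis_vec i) f
    (\sum_(i <- s) v 0 i * 'D_(basis_vec i) f x).
  elim=> [|i s IH]; first by rewrite !big_nil; exact: is_derive0.
  rewrite !big_cons addrC [X in is_derive _ _ _ X]addrC.
  have [d1 d2] := Cf i; rewrite -(@derive_val _ _ _ _ _ _ _ IH).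
  apply: is_derive_add_dir; first exact: ex_derive.
    exact: near_on Ux d1.
  exact: Ck_continuous d2 Ux.
exact.
Qed.

Lemma smooth_is_derive f x v : smooth f -> U x -> is_derive x v f ('D_v f x).
Proof.
by move=> Sf Ux; apply/derivableP; have [] := Ck_is_derive v (Sf 1) Ux.
Qed.

Lemma smooth_derivable f x v : smooth f -> U x -> derivable f x v.
Proof. by move=> Sf Ux; have [] := smooth_is_derive v Sf Ux. Qed.

Lemma smooth_deriveE f x v : smooth f -> U x ->
  'D_v f x = \sum_i v 0 i * 'D_(basis_vec i) f x.
Proof. by move=> Sf Ux; have [_] := Ck_is_derive v (Sf 1) Ux. Qed.

Lemma smooth_derive f v : smooth f -> smooth ('D_v f).
Proof.
move=> Sf; apply: (@smooth_eq (fun y => \sum_i v 0 i * 'D_(basis_vec i) f y)).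
  by move=> y Uy; rewrite smooth_deriveE.
apply: smooth_sum => i; apply: smoothZ => k.
by have [_] := Sf k.+1 => /(_ i) [].
Qed.

Lemma derive_linear_dir f x : smooth f -> U x -> scalar (fun v => 'D_v f x).
Proof.
move=> Sf Ux a u v; rewrite !smooth_deriveE // mulr_sumr -big_split /=.
by apply: eq_bigr => i _; rewrite !mxE mulrDl mulrA.
Qed.

Lemma smooth_deriveC f x u v : smooth f -> U x ->
  'D_u ('D_v f) x = 'D_v ('D_u f) x.
Proof.
move=> Sf Ux; apply: derive_symmetric; try apply: (near_on Ux) => y Uy.
- exact: smooth_derivable.
- exact: smooth_derivable.
- exact: smooth_derivable (smooth_derive _ _) _.
- exact: smooth_derivable (smooth_derive _ _) _.
- exact: Ck_continuous (smooth_derive u (smooth_derive v Sf) 0) Ux.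
- exact: Ck_continuous (smooth_derive v (smooth_derive u Sf) 0) Ux.
Qed.

Lemma smooth_continuous f x : smooth f -> U x -> {for x, continuous f}.
Proof. by move=> Sf; exact: Ck_continuous (Sf 0). Qed.

Lemma sderiveD f g x v : smooth f -> smooth g -> U x ->
  'D_v (fun y => f y + g y) x = 'D_v f x + 'D_v g x.
Proof. by move=> Sf Sg Ux; apply: deriveD; exact: smooth_derivable. Qed.

Lemma sderiveB f g x v : smooth f -> smooth g -> U x ->
  'D_v (fun y => f y - g y) x = 'D_v f x - 'D_v g x.
Proof. by move=> Sf Sg Ux; apply: deriveB; exact: smooth_derivable. Qed.

Lemma sderiveN f x v : smooth f -> U x -> 'D_v (fun y => - f y) x = - 'D_v f x.
Proof. by move=> Sf Ux; apply: deriveN; exact: smooth_derivable. Qed.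

Lemma sderiveM f g x v : smooth f -> smooth g -> U x ->
  'D_v (fun y => f y * g y) x = 'D_v f x * g x + f x * 'D_v g x.
Proof.
move=> Sf Sg Ux; rewrite [LHS]deriveM; try exact: smooth_derivable.
by rewrite addrC [g x *: _]mulrC.
Qed.

Lemma sderiveZ (c : R) f x v : smooth f -> U x ->
  'D_v (fun y => c * f y) x = c * 'D_v f x.
Proof. by move=> Sf Ux; apply: deriveZ; exact: smooth_derivable. Qed.

Lemma sderive_sum (n : nat) (F : 'I_n -> E -> R) x v :
  (forall i, smooth (F i)) -> U x ->
  'D_v (fun y => \sum_i F i y) x = \sum_i 'D_v (F i) x.
Proof.
move=> SF Ux; have -> : (fun y => \sum_i F i y) = \sum_i F i.
  by apply/funext => y; rewrite fct_sumE.
by apply: derive_sum => i; exact: smooth_derivable.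
Qed.

Definition smooth_field (Y : E -> E) := forall j, smooth (fun y => Y y 0 j).

Lemma field_derivable Y x v : smooth_field Y -> U x -> derivable Y x v.
Proof.
by move=> SY Ux; apply/derivable_mxP => i j; rewrite (ord1 i); exact: smooth_derivable.
Qed.

Lemma field_deriveE Y x v j : smooth_field Y -> U x ->
  'D_v Y x 0 j = 'D_v (fun y => Y y 0 j) x.
Proof. by move=> SY Ux; rewrite derive_mx ?mxE //; exact: field_derivable. Qed.

Lemma field_cst (w : E) : smooth_field (cst w).
Proof. by move=> j; exact: smooth_cst. Qed.

Lemma fieldD Y Z : smooth_field Y -> smooth_field Z -> smooth_field (fun y => Y y + Z y).
Proof.
by move=> SY SZ j; apply: smooth_eq (smoothD (SY j) (SZ j)) => y _; rewrite mxE.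
Qed.

Lemma fieldN Y : smooth_field Y -> smooth_field (fun y => - Y y).
Proof. by move=> SY j; apply: smooth_eq (smoothN (SY j)) => y _; rewrite mxE. Qed.

Lemma fieldB Y Z : smooth_field Y -> smooth_field Z -> smooth_field (fun y => Y y - Z y).
Proof. by move=> SY SZ; apply: fieldD => //; exact: fieldN. Qed.

Lemma fieldZ f Y : smooth f -> smooth_field Y -> smooth_field (fun y => f y *: Y y).
Proof.
by move=> Sf SY j; apply: smooth_eq (smoothM Sf (SY j)) => y _; rewrite mxE.
Qed.

Lemma field_eq Y Z : (forall y, U y -> Y y = Z y) -> smooth_field Y -> smooth_field Z.
Proof. by move=> YZ SY j; apply: smooth_eq (SY j) => y Uy; rewrite YZ. Qed.

Lemma field_derive Y v : smooth_field Y -> smooth_field ('D_v Y).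
Proof.
move=> SY j; apply: smooth_eq (smooth_derive v (SY j)) => y Uy.
by rewrite field_deriveE.
Qed.

Lemma field_derive_linear Y x : smooth_field Y -> U x -> linear (fun v => 'D_v Y x).
Proof.
move=> SY Ux a u v; apply/rowP => j.
transitivity (a * 'D_u Y x 0 j + 'D_v Y x 0 j); last by rewrite !mxE.
have D w : 'D_w Y x 0 j = 'D_w (fun y => Y y 0 j) x := field_deriveE w j SY Ux.
apply: etrans (D _) _; apply: etrans (derive_linear_dir (SY j) Ux _ _ _) _.
by congr (_ * _ + _); apply/esym; exact: D.
Qed.

Lemma field_deriveC Y x u v : smooth_field Y -> U x ->
  'D_u ('D_v Y) x = 'D_v ('D_u Y) x.
Proof.
move=> SY Ux; apply/rowP => j.
have D w z : ('D_w ('D_z Y) x) 0 j = 'D_w ('D_z (fun y => Y y 0 j)) x.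
  apply: etrans (field_deriveE w j (field_derive z SY) Ux) _.
  by apply: derive_eq_on Ux => y Uy; exact: field_deriveE.
apply: etrans (D _ _) _; apply: etrans (esym (D _ _)).
exact: smooth_deriveC.
Qed.

Lemma slot_smooth (T : E -> E -> R) (Y : E -> E) :
  (forall y, U y -> scalar (T y)) -> (forall v, smooth (T^~ v)) -> smooth_field Y ->
  smooth (fun y => T y (Y y)).
Proof.
move=> lT ST SY.
apply: (@smooth_eq (fun y => \sum_j Y y 0 j * T y (basis_vec j))); last first.
  by apply: smooth_sum => j; exact: smoothM.
move=> y Uy; rewrite {2}[Y y]row_sum_delta.
have T0 : T y 0 = 0 by have := lT y Uy (-1) 0 0; rewrite scaler0 addr0 mulN1r addNr.
elim/big_rec2: _ => [|j a b _ ->]; first by rewrite T0.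
by rewrite lT.
Qed.

(** Leibniz rule for a tensor with a moving argument: expanding [Y] in the basis separates the
    derivative of the tensor, with its argument frozen at [Y x], from that of the argument. *)
Lemma slot_derive (T : E -> E -> R) (Y : E -> E) x u :
  (forall y, U y -> scalar (T y)) -> (forall v, smooth (T^~ v)) -> smooth_field Y ->
  U x ->
  'D_u (fun y => T y (Y y)) x = 'D_u (T^~ (Y x)) x + T x ('D_u Y x).
Proof.
move=> lT ST SY Ux.
have TE y v : U y -> T y v = \sum_j v 0 j * T y (basis_vec j).
  move=> Uy; rewrite {1}[v]row_sum_delta.
  have T0 : T y 0 = 0 by have := lT y Uy (-1) 0 0; rewrite scaler0 addr0 mulN1r addNr.
  elim/big_rec2: _ => [|j a b _ <-]; first by rewrite T0.
  by rewrite lT.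
rewrite (derive_eq_on u (fun y => TE y (Y y)) Ux) (derive_eq_on u (fun y => TE y (Y x)) Ux).
rewrite !sderive_sum //; try by move=> j; apply: smoothM.
  rewrite TE // -big_split /=; apply: eq_bigr => j _.
  rewrite sderiveM // sderiveZ // field_deriveE //.
  by rewrite addrC.
by move=> j; apply: smoothZ.
Qed.

Lemma slot_field_smooth (T : E -> E -> E) (Y : E -> E) :
  (forall y, U y -> linear (T y)) -> (forall v, smooth_field (T^~ v)) -> smooth_field Y ->
  smooth_field (fun y => T y (Y y)).
Proof.
move=> lT ST SY j; apply: (@slot_smooth (fun y v => T y v 0 j)) => //.
  by move=> y Uy a v w; rewrite lT // !mxE.
by move=> v; exact: ST.
Qed.

Lemma slot_field_derive (T : E -> E -> E) (Y : E -> E) x u :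
  (forall y, U y -> linear (T y)) -> (forall v, smooth_field (T^~ v)) -> smooth_field Y ->
  U x ->
  'D_u (fun y => T y (Y y)) x = 'D_u (T^~ (Y x)) x + T x ('D_u Y x).
Proof.
move=> lT ST SY Ux; apply/rowP => j; rewrite mxE !field_deriveE //; last first.
  exact: slot_field_smooth.
apply: (@slot_derive (fun y v => T y v 0 j)) => //.
  by move=> y Uy a v w; rewrite lT // !mxE.
by move=> v; exact: ST.
Qed.

End SmoothFunctions.

(** * Connections and minimal torsion *)

Ltac row_ring := apply/rowP => ?; rewrite !mxE; ring.

Section LinearProp.
Context {R : realType} {V W : lmodType R}.

Section Vec.
Variable f : V -> W.
Hypothesis lf : linear f.
Lemma lin0 : f 0 = 0.
Proof. by have := lf (-1) 0 0; rewrite scaler0 addr0 scaleN1r addNr. Qed.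
Lemma linD u v : f (u + v) = f u + f v.
Proof. by rewrite -[u in LHS]scale1r lf scale1r. Qed.
Lemma linZ a u : f (a *: u) = a *: f u.
Proof. by rewrite -[a *: u]addr0 lf lin0 addr0. Qed.
Lemma linN u : f (- u) = - f u.
Proof. by rewrite -scaleN1r linZ scaleN1r. Qed.
Lemma linB u v : f (u - v) = f u - f v.
Proof. by rewrite linD linN. Qed.
Lemma lin_sum (I : Type) (r : seq I) (P : pred I) (F : I -> V) :
  f (\sum_(i <- r | P i) F i) = \sum_(i <- r | P i) f (F i).
Proof. by elim/big_rec2: _ => [|i y1 y2 _ <-]; [exact: lin0|exact: linD]. Qed.
End Vec.

Section Sca.
Variable f : V -> R.
Hypothesis lf : scalar f.
Lemma sca0 : f 0 = 0.
Proof. by have := lf (-1) 0 0; rewrite scaler0 addr0 mulN1r addNr. Qed.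
Lemma scaD u v : f (u + v) = f u + f v.
Proof. by rewrite -[u in LHS]scale1r lf mul1r. Qed.
Lemma scaZ a u : f (a *: u) = a * f u.
Proof. by rewrite -[a *: u]addr0 lf sca0 addr0. Qed.
Lemma scaN u : f (- u) = - f u.
Proof. by rewrite -scaleN1r scaZ mulN1r. Qed.
Lemma scaB u v : f (u - v) = f u - f v.
Proof. by rewrite scaD scaN. Qed.
Lemma sca_sum (I : Type) (r : seq I) (P : pred I) (F : I -> V) :
  f (\sum_(i <- r | P i) F i) = \sum_(i <- r | P i) f (F i).
Proof. by elim/big_rec2: _ => [|i y1 y2 _ <-]; [exact: sca0|exact: scaD]. Qed.
End Sca.
End LinearProp.

Section FieldDerivatives.
Context {R : realType} {m : nat} (U : set 'rV[R]_m).
Hypothesis oU : open U.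
Local Notation E := 'rV[R]_m.
Implicit Types (Y Z : E -> E) (x u v : E).

Lemma fderiveD Y Z x u : smooth_field U Y -> smooth_field U Z -> U x ->
  'D_u (fun y => Y y + Z y) x = 'D_u Y x + 'D_u Z x.
Proof. by move=> SY SZ Ux; apply: deriveD; exact: field_derivable Ux. Qed.

Lemma fderiveN Y x u : smooth_field U Y -> U x ->
  'D_u (fun y => - Y y) x = - 'D_u Y x.
Proof. by move=> SY Ux; apply: deriveN; exact: field_derivable Ux. Qed.

Lemma fderiveB Y Z x u : smooth_field U Y -> smooth_field U Z -> U x ->
  'D_u (fun y => Y y - Z y) x = 'D_u Y x - 'D_u Z x.
Proof. by move=> SY SZ Ux; apply: deriveB; exact: field_derivable Ux. Qed.

Lemma fderiveZ (c : R) Y x u : smooth_field U Y -> U x ->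
  'D_u (fun y => c *: Y y) x = c *: 'D_u Y x.
Proof. by move=> SY Ux; apply: deriveZ; exact: field_derivable Ux. Qed.

Lemma fieldZc (c : R) Y : smooth_field U Y -> smooth_field U (fun y => c *: Y y).
Proof. by apply: fieldZ => //; exact: smooth_cst. Qed.

(** Smoothness is asked on constant arguments only; [slot_field_smooth] extends it to moving ones,
    which makes these conditions stable under composition. *)
Definition linear_field (T : E -> E -> E) :=
  (forall y, U y -> linear (T y)) /\ (forall v, smooth_field U (T^~ v)).

Definition bilinear_field (T : E -> E -> E -> E) :=
  [/\ forall y u, U y -> linear (T y u), forall y v, U y -> linear (T y ^~ v)
    & forall u v, smooth_field U (fun y => T y u v)].

Lemma linear_field_derive (T : E -> E -> E) : linear_field T ->
  bilinear_field (fun y u v => 'D_u (T^~ v) y).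
Proof.
move=> [lT ST]; split => [y u Uy a v w|y v Uy|u v].
- transitivity ('D_u (fun z => a *: T z v + T z w) y).
    by apply: derive_eq_on Uy => // z Uz; exact: lT.
  rewrite fderiveD ?fderiveZ //; exact: fieldZc.
- exact: field_derive_linear (ST v) Uy.
- exact: field_derive.
Qed.

Lemma bilinear_field_derivel T v : bilinear_field T ->
  bilinear_field (fun y u w => 'D_u (fun z => T z v w) y).
Proof.
move=> [Tr _ Ts]; apply: (linear_field_derive (T := fun y w => T y v w)).
by split => [y Uy|w]; [exact: Tr|exact: Ts].
Qed.

Lemma bilinear_field_deriver T w : bilinear_field T ->
  bilinear_field (fun y u v => 'D_u (fun z => T z v w) y).
Proof.
move=> [_ Tl Ts]; apply: (linear_field_derive (T := fun y v => T y v w)).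
by split => [y Uy|v]; [exact: Tl|exact: Ts].
Qed.

Lemma bilinear_fieldD T T' : bilinear_field T -> bilinear_field T' ->
  bilinear_field (fun y u v => T y u v + T' y u v).
Proof.
move=> [a b c] [a' b' c']; split => [y u Uy|y v Uy|u v]; last exact: fieldD.
  by move=> k v w; rewrite a // a' // scalerDr addrACA.
by move=> k u w; rewrite b // b' // scalerDr addrACA.
Qed.

Lemma bilinear_fieldZ (c : R) T : bilinear_field T ->
  bilinear_field (fun y u v => c *: T y u v).
Proof.
move=> [lr ll sm]; split => [y u Uy|y v Uy|u v]; last exact: fieldZc.
  by move=> k v w; rewrite lr // scalerDr !scalerA [c * k]mulrC.
by move=> k u w; rewrite ll // scalerDr !scalerA [c * k]mulrC.
Qed.

Lemma bilinear_fieldN T : bilinear_field T -> bilinear_field (fun y u v => - T y u v).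
Proof.
move=> /(bilinear_fieldZ (-1)) [lr ll sm]; split => [y u Uy k v w|y v Uy k u w|u v].
- by have := lr y u Uy k v w; rewrite !scaleN1r.
- by have := ll y v Uy k u w; rewrite !scaleN1r.
- by apply: field_eq (sm u v) => // y _; rewrite scaleN1r.
Qed.

Lemma bilinear_fieldB T T' : bilinear_field T -> bilinear_field T' ->
  bilinear_field (fun y u v => T y u v - T' y u v).
Proof. by move=> HT HT'; apply: bilinear_fieldD => //; exact: bilinear_fieldN. Qed.

Lemma bilinear_field_compl (L : E -> E -> E) T : linear_field L -> bilinear_field T ->
  bilinear_field (fun y u v => L y (T y u v)).
Proof.
move=> [lL SL] [lr ll sm]; split => [y u Uy|y v Uy|u v].
- by move=> k a b; rewrite lr // lL.
- by move=> k a b; rewrite ll // lL.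
- exact: slot_field_smooth.
Qed.

Lemma bilinear_field_compr (L : E -> E -> E) T : linear_field L -> bilinear_field T ->
  bilinear_field (fun y u v => T y u (L y v)).
Proof.
move=> [lL SL] [lr ll sm]; split => [y u Uy|y v Uy|u v].
- by move=> k v w; rewrite lL // lr.
- exact: ll.
- by apply: (@slot_field_smooth _ _ _ oU (fun y => T y u)) => // y Uy; exact: lr.
Qed.

Lemma bilinear_field_eq T T' : (forall y u v, U y -> T y u v = T' y u v) ->
  bilinear_field T -> bilinear_field T'.
Proof.
move=> e [lr ll sm]; split => [y u Uy k v w|y v Uy k u w|u v].
- by rewrite -!e // lr.
- by rewrite -!e // ll.
- by apply: (field_eq oU _ (sm u v)) => y Uy; exact: e.
Qed.

Lemma bilinear_field_slotr T (v : E) x u Y : bilinear_field T -> smooth_field U Y -> U x ->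
  'D_u (fun y => T y v (Y y)) x = 'D_u (fun y => T y v (Y x)) x + T x v ('D_u Y x).
Proof.
move=> [lr ll sm] SY Ux.
by rewrite (@slot_field_derive _ _ _ oU (fun y w => T y v w)) // => y Uy; exact: lr.
Qed.

Lemma linear_field_slot L x u Y : linear_field L -> smooth_field U Y -> U x ->
  'D_u (fun y => L y (Y y)) x = 'D_u (fun y => L y (Y x)) x + L x ('D_u Y x).
Proof. by move=> [lL SL] SY Ux; rewrite (slot_field_derive oU u lL SL SY Ux). Qed.

End FieldDerivatives.

Ltac abstract_derive := repeat match goal with
  | |- context [@derive ?K ?V ?W ?f ?x ?v] =>
    let a := fresh "a" in set a := (@derive K V W f x v); clearbody a
  end.

(* The constants below are locked so that rewriting does not unfold them. *)
HB.lock Definition riem (R : realType) (m : nat)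
    (G : 'rV[R]_m -> 'rV[R]_m -> 'rV[R]_m -> 'rV[R]_m) (x u v w : 'rV[R]_m) : 'rV[R]_m :=
  - (('D_u (fun y => G y v w) x + G x u (G x v w))
     - ('D_v (fun y => G y u w) x + G x v (G x u w))).

(** A connection is represented by its values [G x u v] on constant fields, whose brackets vanish;
    the parenthesis is then [(nabla_u J) v]. Leaving [J] and [G] arbitrary serves both the
    Levi-Civita connection and the Weyl connection. *)
HB.lock Definition minimal_torsion (R : realType) (m : nat)
    (J : 'rV[R]_m -> 'rV[R]_m -> 'rV[R]_m)
    (G : 'rV[R]_m -> 'rV[R]_m -> 'rV[R]_m -> 'rV[R]_m) (x u v : 'rV[R]_m) : 'rV[R]_m :=
  - (2^-1 *: J x ('D_u (fun y => J y v) x + G x u (J x v) - J x (G x u v))).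

HB.lock Definition minimal_con (R : realType) (m : nat)
    (J : 'rV[R]_m -> 'rV[R]_m -> 'rV[R]_m)
    (G : 'rV[R]_m -> 'rV[R]_m -> 'rV[R]_m -> 'rV[R]_m) (x u v : 'rV[R]_m) : 'rV[R]_m :=
  G x u v + minimal_torsion J G x u v.

HB.lock Definition cov_tensor (R : realType) (m : nat)
    (G T : 'rV[R]_m -> 'rV[R]_m -> 'rV[R]_m -> 'rV[R]_m) (x u v w : 'rV[R]_m) : 'rV[R]_m :=
  'D_u (fun y => T y v w) x + G x u (T x v w) - T x (G x u v) w - T x v (G x u w).

(* The defect A of the curvature: [R(u,v), J] = -2 J A(u,v), see [ricci_identity_J]. *)
HB.lock Definition riem_defect (R : realType) (m : nat)
    (J : 'rV[R]_m -> 'rV[R]_m -> 'rV[R]_m)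
    (G : 'rV[R]_m -> 'rV[R]_m -> 'rV[R]_m -> 'rV[R]_m) (x u v w : 'rV[R]_m) : 'rV[R]_m :=
  let xi := minimal_torsion J G in let C := minimal_con J G in
  cov_tensor C xi x u v w - cov_tensor C xi x v u w + xi x (xi x u v - xi x v u) w.

Section Connection.
Context {R : realType} {m : nat} (U : set 'rV[R]_m).
Hypothesis oU : open U.
Local Notation E := 'rV[R]_m.
Implicit Types (x u v w : E) (J : E -> E -> E) (G T : E -> E -> E -> E).

Lemma riemE G x u v w : riem G x u v w =
  - (('D_u (fun y => G y v w) x + G x u (G x v w))
     - ('D_v (fun y => G y u w) x + G x v (G x u w))).
Proof. by rewrite riem.unlock. Qed.

Lemma minimal_torsionE J G x u v : minimal_torsion J G x u v =
  - (2^-1 *: J x ('D_u (fun y => J y v) x + G x u (J x v) - J x (G x u v))).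
Proof. by rewrite minimal_torsion.unlock. Qed.

Lemma minimal_conE J G x u v : minimal_con J G x u v = G x u v + minimal_torsion J G x u v.
Proof. by rewrite minimal_con.unlock. Qed.

Lemma cov_tensorE G T x u v w : cov_tensor G T x u v w =
  'D_u (fun y => T y v w) x + G x u (T x v w) - T x (G x u v) w - T x v (G x u w).
Proof. by rewrite cov_tensor.unlock. Qed.

Lemma riem_defectE J G x u v w :
  let xi := minimal_torsion J G in let C := minimal_con J G in
  riem_defect J G x u v w =
  cov_tensor C xi x u v w - cov_tensor C xi x v u w + xi x (xi x u v - xi x v u) w.
Proof. by rewrite riem_defect.unlock. Qed.

Lemma riem_skew G x u v w : riem G x u v w = - riem G x v u w.
Proof. by rewrite !riemE opprK opprB. Qed.

Lemma riem_bianchi G x u v w : (forall y a b, U y -> G y a b = G y b a) -> U x ->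
  riem G x u v w + riem G x v w u + riem G x w u v = 0.
Proof.
move=> symG Ux.
have DG a b c : 'D_a (fun y => G y b c) x = 'D_a (fun y => G y c b) x.
  by apply: derive_eq_on Ux => // y Uy; exact: symG.
rewrite !riemE (DG u w v) (DG v u w) (DG w v u).
rewrite (symG x w v) // (symG x u w) // (symG x v u) //.
by abstract_derive; row_ring.
Qed.

Lemma cov_tensor_linear G T x : bilinear_field U G -> bilinear_field U T -> U x ->
  [/\ forall u v, linear (cov_tensor G T x u v),
      forall u w, linear (fun v => cov_tensor G T x u v w)
    & forall v w, linear (fun u => cov_tensor G T x u v w)].
Proof.
move=> [Cr Cl _] bT Ux; have [Tr Tl Ts] := bT.
have DrT v := bilinear_field_derivel oU v bT; have DlT w := bilinear_field_deriver oU w bT.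
split => [u v a w1 w2|u w a v1 v2|v w a u1 u2]; rewrite !cov_tensorE.
- have [Dr _ _] := DrT v.
  rewrite (Dr x u Ux) !(Tr x _ Ux) !(Cr x _ Ux) !(Tr x _ Ux); abstract_derive.
  by row_ring.
- have [Dr _ _] := DlT w.
  rewrite (Dr x u Ux) !(Tl x _ Ux) !(Cr x _ Ux) !(Tl x _ Ux); abstract_derive.
  by row_ring.
- have [_ Dl _] := DlT w.
  rewrite (Dl x v Ux) !(Cl x _ Ux) !(Tl x _ Ux) !(Tr x _ Ux); abstract_derive.
  by row_ring.
Qed.

Section AlmostComplex.
Variables (J : E -> E -> E) (G : E -> E -> E -> E).
Hypothesis lJ : linear_field U J.
Hypothesis JJ : forall x v, U x -> J x (J x v) = - v.
Hypothesis lG : bilinear_field U G.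
Hypothesis symG : forall x u v, U x -> G x u v = G x v u.

Local Notation xi := (minimal_torsion J G).
Local Notation C := (minimal_con J G).

Lemma minimal_torsion_bilinear : bilinear_field U xi.
Proof.
apply: (bilinear_field_eq oU (fun y u v _ => esym (minimal_torsionE J G y u v))).
apply: bilinear_fieldN => //; apply: bilinear_fieldZ => //.
apply: bilinear_field_compl => //; apply: bilinear_fieldB => //.
  apply: bilinear_fieldD => //; first exact: linear_field_derive.
  exact: bilinear_field_compr.
exact: bilinear_field_compl.
Qed.

Lemma minimal_con_bilinear : bilinear_field U C.
Proof.
apply: (bilinear_field_eq oU (fun y u v _ => esym (minimal_conE J G y u v))).
by apply: bilinear_fieldD => //; exact: minimal_torsion_bilinear.
Qed.

Lemma derive_J_J x u v : U x ->
  'D_u (fun y => J y (J x v)) x + J x ('D_u (fun y => J y v) x) = 0.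
Proof.
move=> Ux; have [_ SJ] := lJ.
rewrite -(@linear_field_slot _ _ _ oU J x u (J^~ v)) //.
rewrite (@derive_eq_on _ _ _ oU _ _ (fun=> - v)) //; first exact: derive_cst.
by move=> y Uy; exact: JJ.
Qed.

(** Differentiating [J J = -1] shows that [nabla_u J] anticommutes with [J], and hence so does
    [J nabla_u J]. *)
Lemma minimal_torsion_anti x u v : U x -> xi x u (J x v) = - J x (xi x u v).
Proof.
move=> Ux; have [LJ SJ] := lJ; have lJx := LJ x Ux.
have [lr _ _] := lG; have lGx := lr x u Ux.
have /eqP := derive_J_J u v Ux; rewrite addr_eq0 => /eqP DJ.
rewrite !minimal_torsionE DJ !JJ // (linN lGx) (linN lJx) (linZ lJx) JJ //.
rewrite -!scalerN; congr (_ *: _).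
rewrite 2!(linB lJx) (linN lJx) !JJ //.
by abstract_derive; row_ring.
Qed.

(** In other words [J] is parallel for [C]: since [nabla_u J = 2 J xi_u] and [xi_u] anticommutes
    with [J], adding [xi] to the connection cancels the derivative of [J]. *)
Lemma derive_J_con x u v : U x ->
  'D_u (fun y => J y v) x = J x (C x u v) - C x u (J x v).
Proof.
move=> Ux; have [LJ SJ] := lJ; have lJx := LJ x Ux.
rewrite !minimal_conE minimal_torsion_anti // (linD lJx).
rewrite minimal_torsionE (linN lJx) (linZ lJx) JJ //.
by abstract_derive; apply/rowP => i; rewrite !mxE; field.
Qed.

(** The curvature of a connection with [J] parallel commutes with [J]; here this is the symmetry of
    the second derivatives of [J w], rewritten by [derive_J_con]. *)
Lemma riem_minimal_con_J x u v w : U x ->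
  riem C x u v (J x w) = J x (riem C x u v w).
Proof.
move=> Ux; have [LJ SJ] := lJ; have lJx := LJ x Ux.
have bC := minimal_con_bilinear; have [lr ll sm] := bC.
have lC a := lr x a Ux.
have D a b : 'D_a ('D_b (fun y => J y w)) x =
   'D_a (fun y => J y (C x b w)) x + J x ('D_a (fun y => C y b w) x)
   - ('D_a (fun y => C y b (J x w)) x + C x b ('D_a (fun y => J y w) x)).
  transitivity ('D_a (fun y => J y (C y b w) - C y b (J y w)) x).
    by apply: derive_eq_on Ux => // y Uy; exact: derive_J_con.
  rewrite (@fderiveB _ _ U) //.
  - by rewrite (linear_field_slot oU a lJ (sm b w) Ux) (bilinear_field_slotr oU b a bC (SJ w) Ux).
  - exact: slot_field_smooth.
  - by apply: (@slot_field_smooth _ _ _ oU (fun y => C y b)) => // y Uy; exact: lr.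
have := field_deriveC oU u v (SJ w) Ux; rewrite !D !derive_J_con //.
rewrite !riemE (linN lJx) 1!(linB lJx) 2!(linD lJx) !(linB (lC _)).
abstract_derive => E0.
by apply/rowP => i; move/rowP: E0 => /(_ i); rewrite !mxE => E0; lra.
Qed.

(** The structure equation for [G = C - xi]. As [G] is torsion free, [C] has torsion
    [xi_u v - xi_v u], which accounts for the term of [riem_defect] without derivatives. *)
Lemma riem_minimal_con x u v w : U x ->
  riem G x u v w = riem C x u v w + riem_defect J G x u v w
    - (xi x u (xi x v w) - xi x v (xi x u w)).
Proof.
move=> Ux; have [lr ll sm] := lG; have [xr xl xs] := minimal_torsion_bilinear.
have lGx a := lr x a Ux; have lxr a := xr x a Ux; have lxl a := xl x a Ux.
rewrite riem_defectE !riemE !cov_tensorE.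
have D a b : 'D_a (fun y => C y b w) x = 'D_a (fun y => G y b w) x + 'D_a (fun y => xi y b w) x.
  transitivity ('D_a (fun y => G y b w + xi y b w) x).
    by apply: derive_eq_on Ux => // y Uy; exact: minimal_conE.
  by rewrite (@fderiveD _ _ U).
rewrite !D !minimal_conE 2!(linD (lGx _)) 2!(linD (lxr _)) 2!(linD (lxl _)) (linB (lxl _)).
rewrite (symG v u Ux).
by abstract_derive; row_ring.
Qed.

Lemma cov_tensor_anti x u v w : U x ->
  cov_tensor C xi x u v (J x w) = - J x (cov_tensor C xi x u v w).
Proof.
move=> Ux; have [LJ SJ] := lJ; have lJx := LJ x Ux.
have bxi := minimal_torsion_bilinear; have [xr xl xs] := bxi.
have lxr a := xr x a Ux; have lxl a := xl x a Ux.
have [Cr _ _] := minimal_con_bilinear; have lC a := Cr x a Ux.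
have : 'D_u (fun y => xi y v (J y w)) x = 'D_u (fun y => - J y (xi y v w)) x.
  by apply: derive_eq_on Ux => // y Uy; exact: minimal_torsion_anti.
rewrite (@fderiveN _ _ U) //; last exact: slot_field_smooth.
rewrite (@linear_field_slot _ _ _ oU J x u) // (@bilinear_field_slotr _ _ _ oU xi) //.
rewrite !derive_J_con // (linB (lxr v)) !cov_tensorE !minimal_torsion_anti //.
rewrite 2!(linB lJx) (linD lJx) (linN (lC u)).
abstract_derive => E0.
by apply/rowP => i; move/rowP: E0 => /(_ i); rewrite !mxE => E0; lra.
Qed.

Lemma riem_defect_anti x u v w : U x ->
  riem_defect J G x u v (J x w) = - J x (riem_defect J G x u v w).
Proof.
move=> Ux; have [LJ SJ] := lJ; have lJx := LJ x Ux.
rewrite !riem_defectE !cov_tensor_anti // minimal_torsion_anti // (linD lJx) (linB lJx).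
by row_ring.
Qed.

(** In the splitting of [riem_minimal_con] the curvature of [C] and the commutator of [xi] commute
    with [J], while [riem_defect] anticommutes with it; the commutator with [J] therefore sees only
    the defect. *)
Lemma ricci_identity_J x u v w : U x ->
  riem G x u v (J x w) - J x (riem G x u v w) = - (2 *: J x (riem_defect J G x u v w)).
Proof.
move=> Ux; have [LJ SJ] := lJ; have lJx := LJ x Ux.
have [xr _ _] := minimal_torsion_bilinear; have lxr a := xr x a Ux.
rewrite !riem_minimal_con // riem_defect_anti // riem_minimal_con_J //.
rewrite !minimal_torsion_anti // !(linN (lxr _)) !minimal_torsion_anti //.
rewrite 2!(linB lJx) (linD lJx).
by row_ring.
Qed.

End AlmostComplex.
End Connection.

(** The open set is arbitrary rather than the range of a chart: in dimension six it is shrunk to the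
    locus where a value of the W1 part, or of the differential of the Lee form, does not vanish. *)
Record local_hermitian (R : realType) (m : nat) (S : local_structure R m)
    (U : set 'rV[R]_m) : Prop := LocalHermitian {
  lh_open : open U;
  lh_met : forall i j, smooth U (fun x => met S x i j);
  lh_acs : forall i j, smooth U (fun x => acs S x i j);
  lh_sym : forall x u v, U x -> dot S x u v = dot S x v u;
  lh_pos : forall x u, U x -> u != 0 -> 0 < dot S x u u;
  lh_sq : forall x u, U x -> Jv S x (Jv S x u) = - u;
  lh_herm : forall x u v, U x -> dot S x (Jv S x u) (Jv S x v) = dot S x u v
}.

HB.lock Definition levi_civita (R : realType) (m : nat) (S : local_structure R m)
    (x u v : 'rV[R]_m) : 'rV[R]_m :=
  \sum_i \sum_j (u 0 i * v 0 j) *: christoffel S x i j.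

Section Pointwise.
Context {R : realType} {m : nat} (S : local_structure R m).
Local Notation E := 'rV[R]_m.
Implicit Types (x u v w : E).

Lemma dot_linearr x u : scalar (dot S x u).
Proof. by move=> a v w; rewrite /dot linearP /= mulmxDr -scalemxAr !mxE. Qed.

Lemma dot_linearl x v : scalar (dot S x ^~ v).
Proof. by move=> a u w; rewrite /dot !mulmxDl -!scalemxAl !mxE. Qed.

Lemma Jv_linear x : linear (Jv S x).
Proof. by move=> a u v; rewrite /Jv mulmxDl -scalemxAl. Qed.

Lemma dotE x u v : dot S x u v = \sum_i \sum_j (u 0 i * v 0 j) * met S x i j.
Proof.
rewrite /dot mxE exchange_big /=; apply: eq_bigr => j _.
rewrite !mxE mulr_suml; apply: eq_bigr => i _; ring.
Qed.

Lemma levi_civitaE x u v :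
  levi_civita S x u v = \sum_i \sum_j (u 0 i * v 0 j) *: christoffel S x i j.
Proof. by rewrite levi_civita.unlock. Qed.

Lemma dotDl x u v w : dot S x (u + v) w = dot S x u w + dot S x v w.
Proof. exact: (scaD (dot_linearl x w)). Qed.
Lemma dotDr x u v w : dot S x w (u + v) = dot S x w u + dot S x w v.
Proof. exact: (scaD (dot_linearr x w)). Qed.
Lemma dotNl x u w : dot S x (- u) w = - dot S x u w.
Proof. exact: (scaN (dot_linearl x w)). Qed.
Lemma dotNr x u w : dot S x w (- u) = - dot S x w u.
Proof. exact: (scaN (dot_linearr x w)). Qed.
Lemma dotBl x u v w : dot S x (u - v) w = dot S x u w - dot S x v w.
Proof. by rewrite dotDl dotNl. Qed.
Lemma dotBr x u v w : dot S x w (u - v) = dot S x w u - dot S x w v.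
Proof. by rewrite dotDr dotNr. Qed.
Lemma dotZl x a u w : dot S x (a *: u) w = a * dot S x u w.
Proof. exact: (scaZ (dot_linearl x w)). Qed.
Lemma dotZr x a u w : dot S x w (a *: u) = a * dot S x w u.
Proof. exact: (scaZ (dot_linearr x w)). Qed.
Lemma dot0l x w : dot S x 0 w = 0.
Proof. exact: (sca0 (dot_linearl x w)). Qed.
Lemma dot0r x w : dot S x w 0 = 0.
Proof. exact: (sca0 (dot_linearr x w)). Qed.

End Pointwise.

(** * The Levi-Civita connection in a chart and its minimal torsion *)

Section LocalGeometry.
Context {R : realType} {m : nat} (S : local_structure R m) (U : set 'rV[R]_m).
Hypothesis H : local_hermitian S U.
Local Notation E := 'rV[R]_m.
Local Notation g := (dot S).
Local Notation J := (Jv S).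
Local Notation G := (levi_civita S).
Implicit Types (x u v w : E).
Let oU := lh_open H.

Lemma met_trmx x : U x -> (met S x)^T = met S x.
Proof.
move=> Ux; apply/matrixP => i j; rewrite mxE.
have B k l : met S x k l = g x (basis_vec k) (basis_vec l).
  by rewrite dot_basisl -rowE mxE.
by rewrite !B (lh_sym H).
Qed.

Lemma met_unit x : U x -> met S x \in unitmx.
Proof.
move=> Ux; rewrite -row_free_unit -kermx_eq0; apply/eqP/row_matrixP => i.
rewrite row0; apply/eqP/negPn/negP => ni.
have := lh_pos H Ux ni; rewrite /dot -row_mul mulmx_ker row0 mul0mx mxE.
by rewrite ltxx.
Qed.

Lemma dot_ndeg x u : U x -> (forall v, g x u v = 0) -> u = 0.
Proof.
move=> Ux u0; apply/eqP/negPn/negP => nu.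
by have := lh_pos H Ux nu; rewrite u0 ltxx.
Qed.

Lemma dot_eq x u v : U x -> (forall w, g x u w = g x v w) -> u = v.
Proof.
by move=> Ux e; apply/eqP; rewrite -subr_eq0; apply/eqP; apply: (dot_ndeg Ux) => w;
  rewrite dotBl e subrr.
Qed.

Lemma dot_sharp x (a : E -> R) v : U x -> scalar a -> g x (sharp S x a) v = a v.
Proof.
move=> Ux la; rewrite {1}[v]row_sum_delta [v in RHS]row_sum_delta.
rewrite (sca_sum (dot_linearr S x _)) (sca_sum la); apply: eq_bigr => j _.
by rewrite (scaZ (dot_linearr S x _)) (scaZ la) sharpE // met_unit.
Qed.

Lemma J_linear_field : linear_field U J.
Proof.
split => [y Uy|v j]; first exact: Jv_linear.
apply: (@smooth_eq _ _ _ oU (fun y => \sum_i v 0 i * acs S y i j)).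
  by move=> y Uy; rewrite /Jv mxE.
apply: smooth_sum => // i; apply: smoothZ => //; exact: lh_acs.
Qed.

Lemma smooth_dot_cst u v : smooth U (fun y => g y u v).
Proof.
apply: (smooth_eq oU (fun y _ => esym (dotE S y u v))).
apply: smooth_sum => // i; apply: smooth_sum => // j; apply: smoothZ => //; exact: lh_met.
Qed.

Lemma smooth_dot Y Z : smooth_field U Y -> smooth_field U Z ->
  smooth U (fun y => g y (Y y) (Z y)).
Proof.
move=> SY SZ; apply: (@slot_smooth _ _ _ oU (fun y v => g y (Y y) v)) => //.
  by move=> y _; exact: dot_linearr.
move=> v; apply: (@slot_smooth _ _ _ oU (fun y w => g y w v)) => //.
  by move=> y _; exact: dot_linearl.
by move=> w; exact: smooth_dot_cst.
Qed.

Lemma derive_dot Y Z x u : smooth_field U Y -> smooth_field U Z -> U x ->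
  'D_u (fun y => g y (Y y) (Z y)) x =
  'D_u (fun y => g y (Y x) (Z x)) x + g x ('D_u Y x) (Z x) + g x (Y x) ('D_u Z x).
Proof.
move=> SY SZ Ux.
rewrite (@slot_derive _ _ _ oU (fun y v => g y (Y y) v)) //.
- rewrite (@slot_derive _ _ _ oU (fun y w => g y w (Z x))) //.
    by move=> y _; exact: dot_linearl.
  by move=> w; exact: smooth_dot_cst.
- by move=> y _; exact: dot_linearr.
- by move=> v; apply: smooth_dot => //; exact: field_cst.
Qed.

(** Smoothness can be tested on lowered components because the inverse metric is smooth. This serves
    for fields that are known only through their scalar products. *)
Lemma smooth_field_dot Y : (forall v, smooth U (fun y => g y (Y y) v)) -> smooth_field U Y.
Proof.
move=> SY.
have YE y : U y -> Y y = (\row_j g y (Y y) (basis_vec j)) *m invmx (met S y).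
  move=> Uy; have -> : \row_j g y (Y y) (basis_vec j) = Y y *m met S y.
    by apply/rowP => j; rewrite mxE dot_basisl.
  by rewrite mulmxK // met_unit.
move=> j; apply: (@smooth_eq _ _ _ oU
  (fun y => \sum_i g y (Y y) (basis_vec i) * invmx (met S y) i j)).
  by move=> y Uy; rewrite [in RHS]YE // mxE; apply: eq_bigr => i _; rewrite mxE.
apply: smooth_sum => // i; apply: smoothM => //.
by apply: smooth_invmx => //; [exact: met_unit|exact: lh_met].
Qed.

Lemma smooth_christoffel i j : smooth_field U (fun y => christoffel S y i j).
Proof.
move=> l; apply: (@smooth_eq _ _ _ oU
  (fun y => \sum_k (2^-1 * (dmet S y i j k + dmet S y j i k - dmet S y k i j))
     * invmx (met S y) k l)).
  by move=> y Uy; rewrite /christoffel mxE; apply: eq_bigr => k _; rewrite mxE.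
have Sd a b c : smooth U (fun y => dmet S y a b c).
  by apply: smooth_derive => //; exact: lh_met.
apply: smooth_sum => // k; apply: smoothM => //.
  by apply: smoothZ => //; apply: smoothB => //; apply: smoothD.
by apply: smooth_invmx => //; [exact: met_unit|exact: lh_met].
Qed.

Lemma levi_civita_bilinear : bilinear_field U G.
Proof.
apply: (bilinear_field_eq oU (fun y u v _ => esym (levi_civitaE S y u v))).
split => [y u Uy a v w|y v Uy a u w|u v].
- rewrite scaler_sumr -big_split /=; apply: eq_bigr => i _.
  rewrite scaler_sumr -big_split /=; apply: eq_bigr => j _.
  by rewrite !mxE scalerA -scalerDl; congr (_ *: _); ring.
- rewrite scaler_sumr -big_split /=; apply: eq_bigr => i _.
  rewrite scaler_sumr -big_split /=; apply: eq_bigr => j _.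
  by rewrite !mxE scalerA -scalerDl; congr (_ *: _); ring.
- move=> l; apply: (@smooth_eq _ _ _ oU
    (fun y => \sum_i \sum_j (u 0 i * v 0 j) * christoffel S y i j 0 l)).
    move=> y _; rewrite summxE; apply: eq_bigr => i _; rewrite summxE.
    by apply: eq_bigr => j _; rewrite [RHS]mxE.
  apply: smooth_sum => // i; apply: smooth_sum => // j; apply: smoothZ => //.
  exact: smooth_christoffel.
Qed.

Lemma near_met_trmx x : U x -> \forall y \near x, (met S y)^T = met S y.
Proof. by move=> Ux; apply: (near_on oU Ux) => y; exact: met_trmx. Qed.

Lemma levi_civitaC x u v : U x -> G x u v = G x v u.
Proof.
move=> Ux; rewrite !levi_civitaE exchange_big /=; apply: eq_bigr => i _.
apply: eq_bigr => j _; rewrite mulrC christoffelC //; exact: near_met_trmx.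
Qed.

Definition metric_con (T : E -> E -> E -> E) := forall x u v w, U x ->
  'D_u (fun y => g y v w) x = g x (T x u v) w + g x v (T x u w).

Lemma levi_civita_metric : metric_con G.
Proof.
move=> x u v w Ux.
transitivity (\sum_k \sum_i \sum_j (u 0 k * v 0 i * w 0 j) * dmet S x k i j).
  rewrite (smooth_deriveE oU u (smooth_dot_cst v w) Ux); apply: eq_bigr => k _.
  rewrite (derive_eq_on oU _ (fun y _ => dotE S y v w) Ux).
  rewrite (sderive_sum oU) //; last first.
    by move=> i; apply: smooth_sum => // j; apply: smoothZ => //; exact: lh_met.
  rewrite mulr_sumr; apply: eq_bigr => i _; rewrite (sderive_sum oU) //; last first.
    by move=> j; apply: smoothZ => //; exact: lh_met.
  rewrite mulr_sumr; apply: eq_bigr => j _; rewrite (sderiveZ oU) //; last exact: lh_met.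
  by rewrite !mulrA.
have gs (a b c : E) : g x (G x a b) c =
    \sum_k \sum_i \sum_j (a 0 k * b 0 i * c 0 j) * g x (christoffel S x k i) (basis_vec j).
  rewrite levi_civitaE (sca_sum (dot_linearl S x c)); apply: eq_bigr => k _.
  rewrite (sca_sum (dot_linearl S x c)); apply: eq_bigr => i _.
  rewrite dotZl {1}[c]row_sum_delta (sca_sum (dot_linearr S x _)) mulr_sumr.
  by apply: eq_bigr => j _; rewrite dotZr mulrA.
rewrite (lh_sym H v (G x u w) Ux) !gs -big_split /=; apply: eq_bigr => k _.
rewrite [X in _ + X]exchange_big -big_split /=; apply: eq_bigr => i _.
rewrite -big_split /=; apply: eq_bigr => j _.
rewrite christoffel_metric ?met_unit //; last exact: near_met_trmx.
by rewrite (lh_sym H (basis_vec i) _ Ux); ring.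
Qed.

(** The two orders of second derivative of [g w z] agree. Expanded by the metric property, the terms
    with one connection coefficient on each side cancel and the curvature terms remain. *)
Lemma riem_metric T x u v w z : bilinear_field U T -> metric_con T -> U x ->
  g x (riem T x u v w) z = - g x w (riem T x u v z).
Proof.
move=> bT mT Ux; have [lr ll sm] := bT.
have D a b : 'D_a ('D_b (fun y => g y w z)) x =
   (g x (T x a (T x b w)) z + g x (T x b w) (T x a z)) + g x ('D_a (fun y => T y b w) x) z
   + ((g x (T x a w) (T x b z) + g x w (T x a (T x b z))) + g x w ('D_a (fun y => T y b z) x)).
  transitivity ('D_a (fun y => g y (T y b w) z + g y w (T y b z)) x).
    by apply: (derive_eq_on oU) Ux => y Uy; exact: mT.
  rewrite (sderiveD oU) //; try by apply: smooth_dot => //; exact: field_cst.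
  rewrite (@derive_dot (fun y => T y b w) (fun=> z)) //; last exact: field_cst.
  rewrite (@derive_dot (fun=> w) (fun y => T y b z)) //; last exact: field_cst.
  by rewrite !derive_cst dot0l dot0r !mT //; ring.
have := smooth_deriveC oU u v (smooth_dot_cst w z) Ux; rewrite !D.
rewrite !riemE; abstract_derive.
by rewrite !dotNl !dotNr !dotBl !dotBr !dotDl !dotDr => E0; lra.
Qed.

Lemma dot_J_skew x u v : U x -> g x (J x u) v = - g x u (J x v).
Proof. by move=> Ux; rewrite -(lh_herm H _ _ Ux) (lh_sq H) // dotNl. Qed.

Local Notation xi := (minimal_torsion J G).
Local Notation C := (minimal_con J G).

Lemma xi_bilinear : bilinear_field U xi.
Proof. exact: minimal_torsion_bilinear J_linear_field levi_civita_bilinear. Qed.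

Lemma C_bilinear : bilinear_field U C.
Proof. exact: minimal_con_bilinear J_linear_field levi_civita_bilinear. Qed.

Lemma xi_anti x u v : U x -> xi x u (J x v) = - J x (xi x u v).
Proof.
move=> Ux; apply: (minimal_torsion_anti oU J_linear_field _ levi_civita_bilinear) => //.
exact: lh_sq H.
Qed.

Lemma derive_J x u v : U x -> 'D_u (fun y => J y v) x = J x (C x u v) - C x u (J x v).
Proof.
by move=> Ux; apply: (derive_J_con oU J_linear_field _ levi_civita_bilinear) => //; exact: lh_sq H.
Qed.

(** [nabla_u J] is skew because [J] is skew and the connection is metric; it anticommutes with [J],
    and the product of two anticommuting skew maps is skew. *)
Lemma xi_skew x u v w : U x -> g x (xi x u v) w = - g x v (xi x u w).
Proof.
move=> Ux; have [_ SJ] := J_linear_field; have lJx := Jv_linear S x.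
have D a b : 'D_u (fun y => g y (J y a) b) x =
    g x (G x u (J x a)) b + g x (J x a) (G x u b) + g x ('D_u (fun y => J y a) x) b.
  rewrite (@derive_dot (J^~ a) (fun=> b)) //; last exact: field_cst.
  by rewrite derive_cst dot0r addr0 levi_civita_metric.
have K a b : g x ('D_u (J^~ a) x + G x u (J x a) - J x (G x u a)) b =
    - g x a ('D_u (J^~ b) x + G x u (J x b) - J x (G x u b)).
  have E0 : 'D_u (fun y => g y (J y a) b) x = - 'D_u (fun y => g y (J y b) a) x.
    rewrite -(sderiveN oU) //; last by apply: smooth_dot => //; exact: field_cst.
    by apply: (derive_eq_on oU) Ux => y Uy; rewrite dot_J_skew // (lh_sym H).
  move: E0; rewrite !D !dotBl !dotBr !dotDl !dotDr !(dot_J_skew (G x u _)) //.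
  rewrite !(dot_J_skew b) // !(dot_J_skew a) //.
  rewrite (lh_sym H a ('D_u _ x) Ux) (lh_sym H (G x u (J x b)) a Ux).
  rewrite (lh_sym H b _ Ux) => E0.
  have e1 : g x a (J x (G x u b)) = - g x (G x u b) (J x a).
    by rewrite (lh_sym H a _ Ux) dot_J_skew.
  have e2 : g x (J x (G x u a)) b = - g x (G x u a) (J x b) by rewrite dot_J_skew.
  move: E0; rewrite e1 e2; abstract_derive => E0; lra.
have anti b : 'D_u (J^~ (J x b)) x + G x u (J x (J x b)) - J x (G x u (J x b)) =
   - J x ('D_u (J^~ b) x + G x u (J x b) - J x (G x u b)).
  have := xi_anti u b Ux; rewrite !minimal_torsionE (linN lJx) (linZ lJx) opprK => E0.
  have := congr1 (fun t => J x (2 *: t)) E0.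
  rewrite scalerN !scalerA divff ?pnatr_eq0 // !scale1r (linN lJx) !(lh_sq H) // opprK.
  by move=> ->.
rewrite !minimal_torsionE dotNl dotNr dotZl dotZr dot_J_skew // K anti dotNr.
by ring.
Qed.

Lemma C_metric : metric_con C.
Proof.
move=> x u v w Ux; rewrite levi_civita_metric // !minimal_conE dotDl dotDr xi_skew //.
ring.
Qed.

End LocalGeometry.

(** * Covariant derivatives of forms and traces *)

Section Tensors.
Context {R : realType} {m : nat} (S : local_structure R m) (U : set 'rV[R]_m).
Hypothesis H : local_hermitian S U.
Local Notation E := 'rV[R]_m.
Local Notation g := (dot S).
Local Notation J := (Jv S).
Local Notation G := (levi_civita S).
Local Notation xi := (minimal_torsion J G).
Local Notation C := (minimal_con J G).
Implicit Types (x u v w z : E).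
Let oU := lh_open H.

Lemma nablaE (X Y : E -> E) x : nabla S X Y x = 'D_(X x) Y x + G x (X x) (Y x).
Proof. by rewrite levi_civitaE. Qed.

Lemma nabla_cstE u v : nabla S (cst u) (cst v) = fun x => G x u v.
Proof. by apply/funext => x; rewrite nablaE derive_cst add0r. Qed.

Lemma torsionE x u v : torsion S x u v = xi x u v.
Proof. by rewrite /torsion /nablaJ nabla_cstE nablaE minimal_torsionE. Qed.

Lemma curvatureE x u v w : U x -> curvature S x u v w = riem G x u v w.
Proof.
move=> Ux; rewrite /curvature /curv !nabla_cstE !nablaE riemE.
have [_ ll _] := levi_civita_bilinear H.
by rewrite derive_cst /bracket !derive_cst subrr (lin0 (ll x _ Ux)) !add0r.
Qed.

Lemma nablaU_tensorE (T : E -> E -> E -> E) x u v w :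
  nablaU_tensor S T x u v w = cov_tensor C T x u v w.
Proof.
rewrite /nablaU_tensor /nablaU !nabla_cstE nablaE !torsionE cov_tensorE !minimal_conE.
by rewrite addrA.
Qed.

Definition trilinear_form (F : E -> E -> E -> E -> R) :=
  [/\ forall y v w, U y -> scalar (F y v w),
      forall y v z, U y -> scalar (fun w => F y v w z),
      forall y w z, U y -> scalar (fun v => F y v w z)
    & forall v w z, smooth U (fun y => F y v w z)].

(** Since [C] preserves the metric and [J], this derivative commutes with lowering an index,
    inserting [J] and permuting slots. Linear identities built from these operations thus pass from
    a tensor to its covariant derivative. *)
Definition cov_form (F : E -> E -> E -> E -> R) x u v w z : R :=
  'D_u (fun y => F y v w z) x - F x (C x u v) w z - F x v (C x u w) z - F x v w (C x u z).

Lemma trilinear_form_dot T : bilinear_field U T ->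
  trilinear_form (fun y v w z => g y (T y v w) z).
Proof.
move=> [Tr Tl Ts]; split => [y v w Uy|y v z Uy a w1 w2|y w z Uy a v1 v2|v w z].
- exact: dot_linearr.
- by rewrite Tr // dot_linearl.
- by rewrite Tl // dot_linearl.
- by apply: (smooth_dot H) => //; exact: field_cst.
Qed.

Lemma cov_form_dot T x u v w z : bilinear_field U T -> U x ->
  cov_form (fun y v w z => g y (T y v w) z) x u v w z = g x (cov_tensor C T x u v w) z.
Proof.
move=> [Tr Tl Ts] Ux; rewrite /cov_form cov_tensorE.
rewrite (derive_dot H (Y := fun y => T y v w) (Z := fun=> z)) //; last exact: field_cst.
rewrite derive_cst dot0r (C_metric H) //; abstract_derive.
by rewrite !(dotBl, dotDl); ring.
Qed.

Lemma eq_cov_form F F' x u v w z :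
  (forall y a b c, U y -> F y a b c = F' y a b c) -> U x ->
  cov_form F x u v w z = cov_form F' x u v w z.
Proof.
move=> e Ux; rewrite /cov_form (e x (C x u v) w z Ux) (e x v (C x u w) z Ux).
by rewrite (e x v w (C x u z) Ux) (derive_eq_on oU u (fun y => e y v w z) Ux).
Qed.

Lemma trilinear_formD F F' : trilinear_form F -> trilinear_form F' ->
  trilinear_form (fun y a b c => F y a b c + F' y a b c).
Proof.
move=> [F3 F2 F1 SF] [F3' F2' F1' SF'].
split => [y v w Uy k a b|y v z Uy k a b|y w z Uy k a b|v w z]; last exact: smoothD.
- by rewrite (F3 y) // (F3' y) // mulrDr addrACA.
- by rewrite (F2 y v z Uy) (F2' y v z Uy) mulrDr addrACA.
- by rewrite (F1 y w z Uy) (F1' y w z Uy) mulrDr addrACA.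
Qed.

Lemma cov_formD F F' x u v w z : trilinear_form F -> trilinear_form F' -> U x ->
  cov_form (fun y a b c => F y a b c + F' y a b c) x u v w z =
  cov_form F x u v w z + cov_form F' x u v w z.
Proof.
move=> [_ _ _ SF] [_ _ _ SF'] Ux; rewrite /cov_form (sderiveD oU) //; ring.
Qed.

Lemma trilinear_formZ (k : R) F : trilinear_form F -> trilinear_form (fun y a b c => k * F y a b c).
Proof.
by move=> [f3 f2 f1 fs]; split => [y a b Uy l p q|y a b Uy l p q|y a b Uy l p q|a b c];
  [rewrite (f3 y)//|rewrite (f2 y a b Uy)|rewrite (f1 y a b Uy)|exact: smoothZ]; ring.
Qed.

Lemma cov_formZ (k : R) F x u v w z : trilinear_form F -> U x ->
  cov_form (fun y a b c => k * F y a b c) x u v w z = k * cov_form F x u v w z.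
Proof.
move=> [_ _ _ SF] Ux; rewrite /cov_form (sderiveZ oU) //; ring.
Qed.

Lemma cov_form0 x u v w z : cov_form (fun _ _ _ _ => 0) x u v w z = 0.
Proof. by rewrite /cov_form derive_cst; ring. Qed.

Lemma cov_form_J1 F x u v w z : trilinear_form F -> U x ->
  cov_form (fun y a b c => F y (J y a) b c) x u v w z = cov_form F x u (J x v) w z.
Proof.
move=> [F3 F2 F1 SF] Ux; have [_ SJ] := J_linear_field H.
rewrite /cov_form (@slot_derive _ _ _ oU (fun y a => F y a w z) (J^~ v)) //.
  by rewrite (derive_J H) // (scaB (F1 x w z Ux)); ring.
by move=> y Uy; exact: F1.
Qed.

Lemma cov_form_J2 F x u v w z : trilinear_form F -> U x ->
  cov_form (fun y a b c => F y a (J y b) c) x u v w z = cov_form F x u v (J x w) z.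
Proof.
move=> [F3 F2 F1 SF] Ux; have [_ SJ] := J_linear_field H.
rewrite /cov_form (@slot_derive _ _ _ oU (fun y b => F y v b z) (J^~ w)) //.
  by rewrite (derive_J H) // (scaB (F2 x v z Ux)); ring.
by move=> y Uy; exact: F2.
Qed.

Lemma cov_form_J3 F x u v w z : trilinear_form F -> U x ->
  cov_form (fun y a b c => F y a b (J y c)) x u v w z = cov_form F x u v w (J x z).
Proof.
move=> [F3 F2 F1 SF] Ux; have [_ SJ] := J_linear_field H.
rewrite /cov_form (@slot_derive _ _ _ oU (fun y c => F y v w c) (J^~ z)) //.
  by rewrite (derive_J H) // (scaB (F3 x v w Ux)); ring.
by move=> y Uy; exact: F3.
Qed.

Lemma trilinear_form_J1 F : trilinear_form F -> trilinear_form (fun y a b c => F y (J y a) b c).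
Proof.
move=> [F3 F2 F1 SF]; have [lJ SJ] := J_linear_field H.
split => [y v w Uy|y v z Uy|y w z Uy a v1 v2|v w z].
- exact: F3.
- exact: F2.
- by rewrite lJ // F1.
- by apply: (@slot_smooth _ _ _ oU (fun y a => F y a w z)) => // y Uy; exact: F1.
Qed.

Lemma trilinear_form_J3 F : trilinear_form F -> trilinear_form (fun y a b c => F y a b (J y c)).
Proof.
move=> [F3 F2 F1 SF]; have [lJ SJ] := J_linear_field H.
split => [y v w Uy a z1 z2|y v z Uy|y w z Uy|v w z].
- by rewrite lJ // F3.
- exact: F2.
- exact: F1.
- by apply: (@slot_smooth _ _ _ oU (fun y c => F y v w c)) => // y Uy; exact: F3.
Qed.

Lemma trilinear_form_cycle F : trilinear_form F -> trilinear_form (fun y a b c => F y b c a).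
Proof. by move=> [F3 F2 F1 SF]; split=> *; [exact: F2|exact: F1|exact: F3|exact: SF]. Qed.

Lemma trilinear_form_swap23 F : trilinear_form F -> trilinear_form (fun y a b c => F y a c b).
Proof. by move=> [F3 F2 F1 SF]; split=> *; [exact: F2|exact: F3|exact: F1|exact: SF]. Qed.

Lemma cov_form_cycle F x u v w z :
  cov_form (fun y a b c => F y b c a) x u v w z = cov_form F x u w z v.
Proof. by rewrite /cov_form; ring. Qed.

Lemma cov_form_swap23 F x u v w z :
  cov_form (fun y a b c => F y a c b) x u v w z = cov_form F x u v z w.
Proof. by rewrite /cov_form; ring. Qed.

Lemma mtraceRE x (B : E -> E -> R) :
  mtrace S x B = \sum_i \sum_j invmx (met S x) i j * B (basis_vec i) (basis_vec j).
Proof. by []. Qed.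

Lemma dot_mtrace x (B : E -> E -> E) v :
  g x (mtrace S x B) v = mtrace S x (fun a b => g x (B a b) v).
Proof.
rewrite mtraceRE /mtrace (sca_sum (dot_linearl S x v)); apply: eq_bigr => i _.
by rewrite (sca_sum (dot_linearl S x v)); apply: eq_bigr => j _; rewrite dotZl.
Qed.

Lemma smooth_mtrace (B : E -> E -> E -> R) : (forall a b, smooth U (fun y => B y a b)) ->
  smooth U (fun y => mtrace S y (B y)).
Proof.
move=> SB; apply: smooth_sum => // i; apply: smooth_sum => // j; apply: smoothM => //.
by apply: smooth_invmx => //; [exact: met_unit H|exact: lh_met H].
Qed.

(** Contraction commutes with the derivative of a metric connection. The trace is written with the
    moving frame [e j] dual to the coordinate basis, so that no derivative of the inverse metric has
    to be computed. *)
Lemma derive_mtrace (B : E -> E -> E -> R) x u :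
  (forall y a, U y -> scalar (B y a)) -> (forall y b, U y -> scalar (B y ^~ b)) ->
  (forall a b, smooth U (fun y => B y a b)) -> U x ->
  'D_u (fun y => mtrace S y (B y)) x =
  mtrace S x (fun a b => 'D_u (fun y => B y a b) x - B x (C x u a) b - B x a (C x u b)).
Proof.
move=> Br Bl SB Ux; have [Cr _ _] := C_bilinear H; have lC := Cr x u Ux.
(* The metric dual of the coordinate basis. *)
pose e j y : E := \row_i invmx (met S y) i j.
have Se j : smooth_field U (e j).
  move=> i; apply: (@smooth_eq _ _ _ oU (fun y => invmx (met S y) i j)) => [y _|].
    by rewrite mxE.
  by apply: smooth_invmx => //; [exact: met_unit H|exact: lh_met H].
have ge y v j : U y -> g y v (e j y) = v 0 j.
  move=> Uy; rewrite -[v in RHS](mulmxK (met_unit H Uy)) /dot !mxE; apply: eq_bigr => k _.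
  by rewrite !mxE.
have eE (f : E -> R) j y : scalar f -> f (e j y) = \sum_i invmx (met S y) i j * f (basis_vec i).
  move=> lf; rewrite [e j y]row_sum_delta (sca_sum lf); apply: eq_bigr => i _.
  by rewrite (scaZ lf) mxE.
have trE y (b : E -> E -> R) : (forall c, scalar (b ^~ c)) ->
    mtrace S y b = \sum_j b (e j y) (basis_vec j).
  by move=> lb; rewrite mtraceRE exchange_big; apply: eq_bigr => j _; rewrite (eE (b ^~ _)).
pose F j := 'D_u (e j) x + C x u (e j x).
have FE j : F j = \sum_i - C x u (basis_vec i) 0 j *: e i x.
  apply: (dot_eq H Ux) => v; rewrite (lh_sym H _ v Ux) [RHS](lh_sym H _ v Ux).
  have : 'D_u (fun y => g y v (e j y)) x = 0.
    by rewrite (derive_eq_on oU (g := fun=> v 0 j)) ?derive_cst // => y Uy; exact: ge.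
  rewrite (derive_dot H (Y := fun=> v)) //; last exact: field_cst.
  rewrite derive_cst dot0l addr0 (C_metric H) // (ge x (C x u v)) // -addrA -dotDr addrC.
  rewrite [C x u _ + _]addrC => /eqP; rewrite addr_eq0 => /eqP ->.
  rewrite {1}[v]row_sum_delta (lin_sum lC) summxE -sumrN (sca_sum (dot_linearr S x v)).
  by apply: eq_bigr => i _; rewrite (linZ lC) mxE dotZr ge // mulNr mulrC.
rewrite (derive_eq_on oU u (fun y Uy => trE y (B y) (fun c => Bl y c Uy)) Ux).
have SBe j : smooth U (fun y => B y (e j y) (basis_vec j)).
  by apply: (@slot_smooth _ _ _ oU (fun y a => B y a (basis_vec j))) => // y Uy; exact: Bl.
rewrite (sderive_sum oU) // trE => [|c k a a']; last first.
  rewrite (lC k a a') (Bl x c Ux) (Bl x _ Ux).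
  rewrite (derive_eq_on oU (g := fun y => k * B y a c + B y a' c)) //.
    by rewrite (sderiveD oU) ?(sderiveZ oU) //; [abstract_derive; ring|exact: smoothZ].
  by move=> y Uy; exact: Bl.
have swap : \sum_j B x (F j) (basis_vec j) = - \sum_j B x (e j x) (C x u (basis_vec j)).
  rewrite -sumrN; under [RHS]eq_bigr => i _.
    rewrite [C x u _]row_sum_delta (sca_sum (Br x _ Ux)) -sumrN.
    under eq_bigr => j _ do rewrite (scaZ (Br x _ Ux)) -mulNr; over.
  rewrite [RHS]exchange_big; apply: eq_bigr => j _; rewrite FE (sca_sum (Bl x _ Ux)).
  by apply: eq_bigr => i _; rewrite (scaZ (Bl x _ Ux)).
have z : \sum_j (B x (F j) (basis_vec j) + B x (e j x) (C x u (basis_vec j))) = 0.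
  by rewrite big_split /= swap addNr.
apply/eqP; rewrite -subr_eq0 -sumrB -[X in _ == X]z; apply/eqP; apply: eq_bigr => j _.
rewrite /F (scaD (Bl x _ Ux)).
rewrite (@slot_derive _ _ _ oU (fun y a => B y a (basis_vec j))) //; last by move=> y Uy; exact: Bl.
by abstract_derive; ring.
Qed.

(** As [nabla J = 2 J xi], the derivative of [kahler] along [e] at [(f, v)] is [2 g (f, J xi_e v)];
    skewness and anticommutation turn it into [2 g (xi_e f, J v)], and the codifferential adds the
    sign. *)
Lemma codiff_kahler x v : U x ->
  codiff S (kahler S) x v = - 2 * g x (mtrace S x (xi x)) (J x v).
Proof.
move=> Ux; have [_ SJ] := J_linear_field H.
rewrite /codiff mulNr dot_mtrace !mtraceRE mulr_sumr; congr (- _).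
apply: eq_bigr => i _; rewrite mulr_sumr; apply: eq_bigr => j _.
rewrite mulrCA; congr (_ * _); set e := basis_vec i; set f := basis_vec j.
rewrite /nabla_form2 /kahler !nabla_cstE.
rewrite (derive_dot H (Y := fun=> f) (Z := J^~ v)) //; last exact: field_cst.
rewrite derive_cst dot0l addr0 (levi_civita_metric H) //.
rewrite (derive_J H) // !minimal_conE (linD (Jv_linear S x)) (xi_anti H) //.
rewrite !(dotBr, dotDr, dotNr).
have -> : g x f (J x (xi x e v)) = g x (xi x e f) (J x v).
  rewrite -[LHS]opprK -(dot_J_skew H) // (lh_sym H) // (xi_skew H) // opprK.
  by rewrite (xi_anti H) // dotNr (lh_sym H) // (dot_J_skew H) // opprK.
by ring.
Qed.

End Tensors.

(** * The Gray-Hervella classes under covariant differentiation *)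

Section Classes.
Context {R : realType} {n : nat} (S : local_structure R (2 * n)) (U : set 'rV[R]_(2 * n)).
Hypothesis H : local_hermitian S U.
Local Notation E := 'rV[R]_(2 * n).
Local Notation g := (dot S).
Local Notation J := (Jv S).
Local Notation C := (minimal_con J (levi_civita S)).
Local Notation cov_form := (cov_form S).
Implicit Types (x u v w z : E).
Let oU := lh_open H.

Section ConformalConnection.
Variables (K : E -> E -> E -> E) (th : E -> E -> R).
Hypothesis bK : bilinear_field U K.
Hypothesis mK : forall x u v w, U x ->
  'D_u (fun y => g y v w) x = g x (K x u v) w + g x v (K x u w) + th x u * g x v w.
Hypothesis JK : forall x u v, U x -> 'D_u (fun y => J y v) x = J x (K x u v) - K x u (J x v).

Lemma derive_dot_con Y Z x u : smooth_field U Y -> smooth_field U Z -> U x ->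
  'D_u (fun y => g y (Y y) (Z y)) x =
  g x ('D_u Y x + K x u (Y x)) (Z x) + g x (Y x) ('D_u Z x + K x u (Z x))
  + th x u * g x (Y x) (Z x).
Proof. by move=> SY SZ Ux; rewrite (derive_dot H) // mK // dotDl dotDr; ring. Qed.

Variable T : E -> E -> E -> E.
Hypothesis bT : bilinear_field U T.

Lemma derive_cov_tensor x u v w : 'D_u (fun y => T y v w) x =
  cov_tensor K T x u v w - K x u (T x v w) + T x (K x u v) w + T x v (K x u w).
Proof. by rewrite cov_tensorE; row_ring. Qed.

(** The conditions defining W are homogeneous in the metric, so a connection that preserves [J] and
    only rescales the metric, by [th], differentiates W into itself. With [th = 0] this covers the
    minimal connection, and with the Lee form that of the Weyl connection. *)
Lemma in_W_cov x u : (forall y, U y -> in_W S y (T y)) -> U x -> in_W S x (cov_tensor K T x u).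
Proof.
move=> WT Ux; have [Cr Cl _] := cov_tensor_linear oU bK bT Ux.
have [Tr Tl sk an] := WT x Ux; have [Kr _ _] := bK; have [_ _ ST] := bT.
have lJ := Jv_linear S x; have [_ SJ] := J_linear_field H.
have TJ y a b : U y -> T y a (J y b) = - J y (T y a b).
  by move=> /WT [_ _ _ an']; apply/eqP; rewrite -addr_eq0 addrC an'.
split => // [v w z|v w].
- have : 'D_u (fun y => g y (T y v w) z) x = - 'D_u (fun y => g y w (T y v z)) x.
    rewrite -(sderiveN oU) //; last by apply: (smooth_dot H) => //; exact: field_cst.
    by apply: (derive_eq_on oU) Ux => y Uy; have [_ _ sk' _] := WT y Uy.
  rewrite (derive_dot_con u (ST v w) (field_cst oU z)) //.
  rewrite (derive_dot_con u (field_cst oU w) (ST v z)) // !derive_cst !add0r !derive_cov_tensor.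
  rewrite !(dotDl, dotDr, dotNl, dotNr) /cst !sk; abstract_derive => h; lra.
- have : 'D_u (fun y => T y v (J y w)) x = 'D_u (fun y => - J y (T y v w)) x.
    by apply: (derive_eq_on oU) Ux => y; exact: TJ.
  rewrite (fderiveN oU) //; last by apply: (slot_field_smooth oU) => // y _; exact: Jv_linear.
  rewrite (linear_field_slot oU _ (J_linear_field H)) // (bilinear_field_slotr oU _ _ bT) //.
  rewrite !JK // (linB (Tr v)) !cov_tensorE !TJ // !(linB lJ, linD lJ) (linN (Kr x u Ux)).
  abstract_derive => h; apply/rowP => i; move/rowP: h => /(_ i); rewrite !mxE => h; lra.
Qed.

Lemma in_W1_cov x u : (forall y, U y -> in_W1 S y (T y)) -> U x -> in_W1 S x (cov_tensor K T x u).
Proof.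
move=> WT Ux; split; first by apply: in_W_cov => // y /WT [].
have [[Tr Tl _ _] alt] := WT x Ux; have [Kr _ _] := bK.
have sw a b : T x a b + T x b a = 0.
  by have := alt (a + b); rewrite (linD (Tr _)) !(linD (Tl _)) !alt add0r addr0 addrC.
move=> v; rewrite cov_tensorE alt (lin0 (Kr x u Ux)) addr0.
rewrite (derive_eq_on oU (g := fun=> 0)) //; last by move=> y /WT [_]; exact.
by rewrite derive_cst add0r -opprD sw oppr0.
Qed.

End ConformalConnection.

Let metricC x u v w : U x -> 'D_u (fun y => g y v w) x =
  g x (C x u v) w + g x v (C x u w) + (fun _ _ => 0) x u * g x v w.
Proof. by move=> Ux; rewrite mul0r addr0; exact: (C_metric H). Qed.

Section Closure.
Variable T : E -> E -> E -> E.
Hypothesis bT : bilinear_field U T.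
Local Notation F := (fun y v w z => g y (T y v w) z).
Let tF := trilinear_form_dot H bT.

Lemma in_W_cov_tensor x u : (forall y, U y -> in_W S y (T y)) -> U x ->
  in_W S x (cov_tensor C T x u).
Proof. exact: in_W_cov (C_bilinear H) metricC (derive_J H) T bT x u. Qed.

Lemma in_W1_cov_tensor x u : (forall y, U y -> in_W1 S y (T y)) -> U x ->
  in_W1 S x (cov_tensor C T x u).
Proof. exact: in_W1_cov (C_bilinear H) metricC (derive_J H) T bT x u. Qed.

(** The cyclic sum is a sum of three rotations of the form [F'] that vanishes on [U], so its
    covariant derivative vanishes, and [cov_form] commutes with the rotations and with the [J] in
    [F']. *)
Lemma in_W2_cov_tensor x u : (forall y, U y -> in_W2 S y (T y)) -> U x ->
  in_W2 S x (cov_tensor C T x u).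
Proof.
move=> WT Ux; split; first by apply: in_W_cov_tensor => // y /WT [].
move=> a b c; rewrite -!(cov_form_dot H) //.
pose F' := fun y a b c => F y a b (J y c).
have tF' : trilinear_form U F' by exact: (trilinear_form_J3 H).
have FE a' b' c' : cov_form F x u a' b' (J x c') = cov_form F' x u a' b' c'.
  by rewrite (cov_form_J3 H).
rewrite !FE -(cov_form_cycle S F' x u a b c).
rewrite -[X in _ + X](cov_form_cycle S F' x u b c a).
rewrite -(cov_form_cycle S (fun y a b c => F' y b c a) x u a b c).
have t1 := trilinear_form_cycle tF'; have t2 := trilinear_form_cycle t1.
rewrite -(cov_formD H u a b c tF' t1 Ux).
rewrite -(cov_formD H u a b c (trilinear_formD H tF' t1) t2 Ux).
rewrite -[RHS](cov_form0 S x u a b c); apply: (eq_cov_form H) => // y a' b' c' Uy.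
by have [_ cyc] := WT y Uy; exact: cyc.
Qed.

End Closure.

Lemma in_W3_cov_tensor T x u : bilinear_field U T ->
  (forall y, U y -> in_W3 S y (T y)) -> U x -> in_W3 S x (cov_tensor C T x u).
Proof.
move=> bT WT Ux; have tF := trilinear_form_dot H bT; have [Tr Tl Ts] := bT; split.
- by apply: in_W_cov_tensor => // y /WT [].
- move=> v w; apply: (dot_eq H Ux) => z; rewrite -!(cov_form_dot H) //.
  rewrite -(cov_form_J1 H u v (J x w) z tF Ux) -(cov_form_J2 H u v w z (trilinear_form_J1 H tF) Ux).
  by apply: (eq_cov_form H) => // y a b c Uy; have [_ inv _] := WT y Uy; rewrite inv.
- apply: (dot_eq H Ux) => z; rewrite dot0l dot_mtrace.
  (* Differentiating the vanishing trace by [derive_mtrace] gives the trace of the derivative, up to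
     a term where [C] acts on [z]; that term is again a trace of [T x] and vanishes. *)
  have T0 y c : U y -> mtrace S y (fun a b => g y (T y a b) c) = 0.
    by move=> Uy; have [_ _ tr] := WT y Uy; rewrite -dot_mtrace tr dot0l.
  have := derive_mtrace H (B := fun y a b => g y (T y a b) z) (x := x) u.
  rewrite (derive_eq_on oU (g := fun=> 0)) //; last by move=> y Uy; exact: T0.
  rewrite derive_cst => /(_ _ _ _ Ux) e.
  transitivity (mtrace S x (fun a b => 'D_u (fun y => g y (T y a b) z) x
      - g x (T x (C x u a) b) z - g x (T x a (C x u b)) z)
    - mtrace S x (fun a b => g x (T x a b) (C x u z))).
    rewrite !mtraceRE -sumrB; apply: eq_bigr => i _; rewrite -sumrB; apply: eq_bigr => j _.
    by rewrite -(cov_form_dot H) // /cov_form; ring.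
  rewrite T0 // subr0 -e //.
  + by move=> y a Uy k b c; rewrite Tr // dot_linearl.
  + by move=> y b Uy k a c; rewrite Tl // dot_linearl.
  + by move=> a b; apply: (smooth_dot H) => //; exact: field_cst.
Qed.

End Classes.

(** * Contractions of the curvature *)

Section PointTraces.
Context {R : realType} {m : nat} (S : local_structure R m) (U : set 'rV[R]_m).
Hypothesis H : local_hermitian S U.
Variable x : 'rV[R]_m.
Hypothesis Ux : U x.
Local Notation E := 'rV[R]_m.
Local Notation g := (dot S x).
Local Notation J := (Jv S x).
Local Notation tr := (mtrace S x).
Implicit Types (u v w z a b : E) (f : E -> R) (B : E -> E -> R).

Definition bilinear_map B := (forall a, scalar (B a)) /\ (forall b, scalar (B ^~ b)).

Lemma tr_eq B B' : (forall a b, B a b = B' a b) -> tr B = tr B'.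
Proof. by move=> e; rewrite !mtraceRE; apply: eq_bigr => i _; apply: eq_bigr => j _; rewrite e. Qed.

Lemma trD B B' : tr (fun a b => B a b + B' a b) = tr B + tr B'.
Proof.
rewrite !mtraceRE -big_split /=; apply: eq_bigr => i _; rewrite -big_split /=.
by apply: eq_bigr => j _; rewrite mulrDr.
Qed.

Lemma trZ k B : tr (fun a b => k * B a b) = k * tr B.
Proof.
rewrite !mtraceRE mulr_sumr; apply: eq_bigr => i _; rewrite mulr_sumr.
by apply: eq_bigr => j _; rewrite mulrCA.
Qed.

Lemma trN B : tr (fun a b => - B a b) = - tr B.
Proof. by rewrite -mulN1r -trZ; apply: tr_eq => a b; rewrite mulN1r. Qed.

Lemma trB B B' : tr (fun a b => B a b - B' a b) = tr B - tr B'.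
Proof. by rewrite trD trN. Qed.

Lemma tr_exchange (B : E -> E -> E -> E -> R) :
  tr (fun a b => tr (fun c d => B a b c d)) = tr (fun c d => tr (fun a b => B a b c d)).
Proof.
pose h := invmx (met S x); pose b i : E := basis_vec i.
transitivity (\sum_i \sum_j \sum_k \sum_l h i j * h k l * B (b i) (b j) (b k) (b l)).
  rewrite mtraceRE; apply: eq_bigr => i _; apply: eq_bigr => j _; rewrite mtraceRE mulr_sumr.
  by apply: eq_bigr => k _; rewrite mulr_sumr; apply: eq_bigr => l _; rewrite mulrA.
transitivity (\sum_k \sum_l \sum_i \sum_j h i j * h k l * B (b i) (b j) (b k) (b l)).
  transitivity (\sum_i \sum_k \sum_l \sum_j h i j * h k l * B (b i) (b j) (b k) (b l)).
    apply: eq_bigr => i _; rewrite exchange_big /=; apply: eq_bigr => k _; exact: exchange_big.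
  by rewrite exchange_big /=; apply: eq_bigr => k _; exact: exchange_big.
rewrite mtraceRE; apply: eq_bigr => k _; apply: eq_bigr => l _; rewrite mtraceRE mulr_sumr.
by apply: eq_bigr => i _; rewrite mulr_sumr; apply: eq_bigr => j _; rewrite mulrA [h k l * _]mulrC.
Qed.

Lemma tr_sym B : tr (fun a b => B b a) = tr B.
Proof.
rewrite !mtraceRE exchange_big /=; apply: eq_bigr => i _; apply: eq_bigr => j _.
by congr (_ * _); rewrite -[in LHS](met_trmx H Ux) -trmx_inv mxE.
Qed.

Lemma tr_contract f v : scalar f -> tr (fun a b => g a v * f b) = f v.
Proof.
move=> lf; rewrite mtraceRE [v in RHS]row_sum_delta (sca_sum lf) exchange_big /=.
apply: eq_bigr => j _; rewrite (scaZ lf).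
transitivity ((\sum_i g (basis_vec i) v * invmx (met S x) i j) * f (basis_vec j)).
  by rewrite mulr_suml; apply: eq_bigr => i _; ring.
congr (_ * _); rewrite -[v in RHS](mulmxK (met_unit H Ux)) mxE; apply: eq_bigr => i _.
by rewrite (lh_sym H) // dot_basisl.
Qed.

Lemma tr_contractr f v : scalar f -> tr (fun a b => f a * g b v) = f v.
Proof.
by move=> lf; rewrite -(tr_contract v lf) -tr_sym; apply: tr_eq => a b; rewrite mulrC.
Qed.

Lemma tr_contract_swap f v : scalar f -> tr (fun a b => g b v * f a) = f v.
Proof. by move=> lf; rewrite -(tr_contractr v lf); apply: tr_eq => a b; rewrite mulrC. Qed.

(** This replaces an orthonormal frame [e_i] by [J e_i] without choosing one: an argument is
    expanded by a second contraction, the traces are exchanged, and [J] is moved across the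
    metric. *)
Lemma tr_J B : bilinear_map B -> tr (fun a b => B (J a) (J b)) = tr B.
Proof.
move=> [Br Bl].
transitivity (tr (fun a b => tr (fun c d => g c (J a) * B d (J b)))).
  by apply: tr_eq => a b; rewrite tr_contract.
rewrite tr_exchange -[RHS]tr_sym; apply: tr_eq => c d.
transitivity (tr (fun a b => g a (J c) * - B d (J b))).
  apply: tr_eq => a b; rewrite (lh_sym H c) // (dot_J_skew H) //; ring.
rewrite tr_contract; last first.
  by move=> k a b; rewrite (Jv_linear S x) (Br d); ring.
by rewrite (lh_sq H) // (scaN (Br d)) opprK.
Qed.

Lemma tr_JN B : bilinear_map B -> (forall a b, B (J a) (J b) = - B a b) -> tr B = 0.
Proof.
move=> lB e; have : tr B = - tr B by rewrite -{1}(tr_J lB) -trN; exact: tr_eq.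
by move=> E0; lra.
Qed.

Lemma tr_vec0 (T : E -> E -> E) : (forall w, tr (fun a b => g (T a b) w) = 0) -> tr T = 0.
Proof. by move=> e; apply: (dot_ndeg H Ux) => w; rewrite dot_mtrace. Qed.

Lemma tr_g : tr g = m%:R.
Proof.
rewrite mtraceRE exchange_big /=.
transitivity (\sum_(j < m) (1 : R)); last by rewrite sumr_const card_ord.
apply: eq_bigr => j _.
have mE p q : met S x p q = g (basis_vec p) (basis_vec q) by rewrite dot_basisl -rowE mxE.
transitivity ((met S x *m invmx (met S x)) j j).
  rewrite mxE; apply: eq_bigr => i _; rewrite -mE mulrC.
  by rewrite -{1}(met_trmx H Ux) mxE.
by rewrite mulmxV ?(met_unit H) // mxE eqxx.
Qed.

End PointTraces.

Section CurvatureSymmetries.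
Context {R : realType} {m : nat} (S : local_structure R m) (U : set 'rV[R]_m).
Hypothesis H : local_hermitian S U.
Variable x : 'rV[R]_m.
Hypothesis Ux : U x.
Local Notation E := 'rV[R]_m.
Local Notation g := (dot S x).
Local Notation J := (Jv S x).
Local Notation tr := (mtrace S x).
Local Notation G := (levi_civita S).
Local Notation Rm := (riem G x).
Local Notation A := (riem_defect (Jv S) G x).
Implicit Types (u v w z a b : E).

Lemma riem_linear : [/\ forall u v, linear (Rm u v), forall u w, linear (fun v => Rm u v w)
  & forall v w, linear (fun u => Rm u v w)].
Proof.
have bG := levi_civita_bilinear H; have [Gr Gl Gs] := bG; have oU := lh_open H.
have Dr v := bilinear_field_derivel oU v bG; have Dl w := bilinear_field_deriver oU w bG.
have l2 u w : linear (fun v => Rm u v w).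
  move=> k v1 v2; rewrite !riemE; have [D1 _ _] := Dl w.
  rewrite (D1 x u Ux) (field_derive_linear oU (Gs u w) Ux) !(Gl x _ Ux) (Gr x u Ux).
  by abstract_derive; row_ring.
split => [u v k w1 w2|u w|v w k u1 u2]; last 2 first.
- exact: l2.
- by rewrite [LHS]riem_skew l2 [in RHS]riem_skew [X in _ = _ + X]riem_skew scalerN opprD.
- rewrite !riemE; have [D1 _ _] := Dr v; have [D2 _ _] := Dr u.
  rewrite (D1 x u Ux) (D2 x v Ux) !(Gr x _ Ux).
  by abstract_derive; row_ring.
Qed.

Let sk34 u v w z : g (Rm u v w) z = - g (Rm u v z) w.
Proof.
rewrite (riem_metric H) //; [by rewrite (lh_sym H)|exact: levi_civita_bilinear|].
exact: levi_civita_metric.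
Qed.

Let bi u v w z : g (Rm u v w) z + g (Rm v w u) z + g (Rm w u v) z = 0.
Proof.
by rewrite -!dotDl (riem_bianchi (lh_open H)) ?dot0l // => y p q Uy; exact: (levi_civitaC H).
Qed.

(** The classical argument: four Bianchi identities, each keeping one of the vectors fixed, are
    combined by means of the two skew symmetries. *)
Lemma riem_pair u v w z : g (Rm u v w) z = g (Rm w z u) v.
Proof.
have sk12 a b c d : g (Rm a b c) d = - g (Rm b a c) d by rewrite riem_skew dotNl.
move: (bi u v w z) (bi v w z u) (bi w z u v) (bi z u v w).
rewrite (sk34 u v z w) (sk34 v w z u) (sk34 w z v u) (sk34 z u v w).
rewrite (sk12 u w z v) (sk34 w u z v) (sk12 v z u w) (sk34 z v u w).
lra.
Qed.

(** Moving [J] out of the curvature in [ric_star] costs [-2 J A] by [ricci_identity_J], and the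
    remaining pair of [J] is absorbed by the metric. *)
Lemma ric_star_ric u v :
  ric_star S x u v = ric S x u v - 2 * tr (fun a b => g (A u a v) b).
Proof.
rewrite /ric_star /ric -trZ -trB; apply: tr_eq => a b.
rewrite (curvatureE H u a (J v) Ux) (curvatureE H u a v Ux).
have := ricci_identity_J (lh_open H) (J_linear_field H) (lh_sq H) (levi_civita_bilinear H)
  (levi_civitaC H) u a v Ux.
move/eqP; rewrite subr_eq => /eqP ->.
by rewrite dotDl dotNl dotZl !(lh_herm H) //; ring.
Qed.

Lemma ric_sym u v : ric S x u v = ric S x v u.
Proof.
rewrite /ric -[RHS](tr_sym H Ux); apply: tr_eq => a b.
by rewrite (curvatureE H u a v Ux) (curvatureE H v b u Ux); exact: riem_pair.
Qed.

Lemma ric_star20_defect u v :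
  ric_star20 S x u v = tr (fun a b => g (A v a u) b) - tr (fun a b => g (A u a v) b).
Proof. by rewrite /ric_star20 !ric_star_ric (ric_sym v u); field. Qed.

(** Replacing the contracted pair by its image under [J] gives a second expression of [ric_star];
    the Bianchi identity for [u], [a], [J v] adds the two, whence the factor 2. *)
Lemma ric_star_curvature u v :
  2 * ric_star S x u v = tr (fun a b => g (Rm a (J b) u) (J v)).
Proof.
have [Rr Rc Rl] := riem_linear; have lJ := Jv_linear S x.
have E1 : ric_star S x u v = tr (fun a b => g (Rm u a (J v)) (J b)).
  by apply: tr_eq => a b; rewrite (curvatureE H u a (J v) Ux).
have E2 : tr (fun a b => g (Rm a (J v) u) (J b)) = ric_star S x u v.
  rewrite -(tr_J H Ux); last first.
    split => [a k b c|b k a c]; first by rewrite (lJ k b c) dot_linearr.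
    by rewrite (Rl (J v) u) dot_linearl.
  rewrite E1 -[RHS](tr_sym H Ux); apply: tr_eq => a b.
  by rewrite (lh_sq H) // dotNr [X in - X]riem_pair sk34 opprK.
have -> : tr (fun a b => g (Rm a (J b) u) (J v)) = tr (fun a b => - g (Rm (J v) u a) (J b)).
  by apply: tr_eq => a b; rewrite riem_pair riem_skew dotNl.
rewrite mulrDl mul1r {1}E1 -E2 -trD; apply: tr_eq => a b.
by have := bi u a (J v) (J b); lra.
Qed.

(** By [ric_star_curvature] both orders of [u], [v] are traces of the same operator [R (a, J b)].
    Its skewness turns their difference into a commutator with [J], that is, into [A]. *)
Lemma ric_star20_defect_J u v :
  ric_star20 S x u v = 2^-1 * tr (fun a b => g (A a (J b) u) (J v)).
Proof.
have E1 : ric_star S x u v - ric_star S x v u = tr (fun a b => g (A a (J b) u) (J v)).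
  suff : 2 * ric_star S x u v - 2 * ric_star S x v u =
      2 * tr (fun a b => g (A a (J b) u) (J v)).
    by move: (ric_star S x u v) (ric_star S x v u) (tr _) => p q t e; lra.
  transitivity (tr (fun a b => g (Rm a (J b) u) (J v)) - tr (fun a b => g (Rm a (J b) v) (J u))).
    by congr (_ - _); exact: ric_star_curvature.
  rewrite -trB -trZ; apply: tr_eq => a b.
  have := ricci_identity_J (lh_open H) (J_linear_field H) (lh_sq H) (levi_civita_bilinear H)
    (levi_civitaC H) a (J b) u Ux.
  move/eqP; rewrite subr_eq => /eqP e; rewrite (sk34 _ _ v) e dotDl dotNl dotZl !(dot_J_skew H) //.
  by ring.
by rewrite /ric_star20 E1.
Qed.

End CurvatureSymmetries.

(** * Pointwise algebra of the four classes *)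

Section ClassAlgebra.
Context {R : realType} {n : nat} (S : local_structure R (2 * n)) (U : set 'rV[R]_(2 * n)).
Hypothesis H : local_hermitian S U.
Variable x : 'rV[R]_(2 * n).
Hypothesis Ux : U x.
Local Notation E := 'rV[R]_(2 * n).
Local Notation g := (dot S x).
Local Notation J := (Jv S x).
Local Notation tr := (mtrace S x).
Implicit Types (u v w z a b : E) (t s : E -> E -> E) (al : E -> R).

Let lJ := Jv_linear S x.
Let JJ u : J (J u) = - u := lh_sq H u Ux.
Let gC u v : g u v = g v u := lh_sym H u v Ux.
Let gJ u v : g (J u) v = - g u (J v) := dot_J_skew H u v Ux.

Lemma in_W_J t v w : in_W S x t -> t v (J w) = - J (t v w).
Proof. by move=> [_ _ _ an]; apply/eqP; rewrite -addr_eq0 addrC an. Qed.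

Lemma in_W_skew t u v w : in_W S x t -> g (t u v) w = - g (t u w) v.
Proof. by move=> [_ _ sk _]; rewrite sk gC. Qed.

(** Behaviour under [J] in the first slot separates W1+W2, antilinear, from W3+W4, linear; in the
    second slot all of W is antilinear. Most vanishing and doubling of contractions below comes from
    this. *)
Definition j_antilinear t := forall v w, t (J v) w = - J (t v w).
Definition j_linear t := forall v w, t (J v) w = J (t v w).

Lemma in_W1_alt t u v : in_W1 S x t -> t u v = - t v u.
Proof.
move=> [[tr tl _ _] alt]; apply/eqP; rewrite -addr_eq0; apply/eqP.
by have := alt (u + v); rewrite (linD (tr _)) !(linD (tl _)) !alt add0r addr0 addrC.
Qed.

Lemma in_W1_j_antilinear t : in_W1 S x t -> j_antilinear t.
Proof.
move=> W1 v w; have [W _] := W1.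
by rewrite (in_W1_alt _ _ W1) (in_W_J _ _ W) (in_W1_alt w v W1) (linN lJ) opprK.
Qed.

Lemma in_W2_j_antilinear t : in_W2 S x t -> j_antilinear t.
Proof.
move=> [W cyc] u v; have [Tr Tl _ _] := W.
pose F u v w := g (t u v) (J w).
have F0 a b c : F a b c + F b c a + F c a b = 0 by exact: cyc.
have FJJ a b c : F a (J b) (J c) = - F a b c.
  by rewrite /F (in_W_J _ _ W) dotNl JJ dotNr opprK gJ.
have Fsk a b c : F a b c = - F a c b.
  by rewrite /F (in_W_skew _ _ _ W) (in_W_J _ _ W) dotNl opprK gJ.
have FJ1 a b c : F a (J b) c = F a b (J c).
  by rewrite /F (in_W_J _ _ W) dotNl gJ opprK.
suff E0 w : F (J u) (J v) w = - F u v w.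
  apply: (dot_eq H Ux) => z; have := E0 z.
  by rewrite /F (in_W_J _ _ W) dotNl (lh_herm H) // dotNl gJ => e; lra.
(* The cyclic identity is used on [(u, v, w)] and on the triples with two of these vectors replaced
   by their images under [J]; with the symmetries of [F] a linear combination isolates
   [F (J u) (J v) w]. *)
have h1 := F0 u v w; have h2 := F0 u (J v) (J w); have h3 := F0 v (J w) (J u).
have h4 := F0 w (J u) (J v).
have := FJJ u v w; have := FJJ v w u; have := FJJ w u v.
have := FJ1 (J u) v w; have := FJ1 (J v) w u; have := FJ1 (J w) u v.
lra.
Qed.

Lemma in_W3_j_linear t : in_W3 S x t -> j_linear t.
Proof.
move=> [W inv _] v w; have [Tr _ _ _] := W.
have := inv v (J w); rewrite JJ (linN (Tr _)) (in_W_J _ _ W) => /eqP.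
by rewrite eqr_opp => /eqP.
Qed.

Definition w4_eq al t := forall u v, 4 *: t u v =
  g u v *: sharp S x al - al v *: u - g (J u) v *: J (sharp S x al) - al (J v) *: J u.

Lemma w4_dot al t v w z : scalar al -> w4_eq al t ->
  4 * g (t v w) z = g v w * al z - al w * g v z + g (J v) w * al (J z)
    - al (J w) * g (J v) z.
Proof.
move=> lal e; rewrite -dotZl e !(dotBl, dotZl) (gJ (sharp S x al)) !(dot_sharp H) //; ring.
Qed.

Lemma w4_j_linear al t : scalar al -> w4_eq al t -> j_linear t.
Proof.
move=> lal e v w; apply: (dot_eq H Ux) => z.
have h1 := w4_dot (J v) w z lal e; have h2 := w4_dot v w (J z) lal e.
rewrite !JJ !(dotNl, dotNr, scaN lal) in h1 h2; rewrite gJ.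
rewrite (lh_herm H) // in h2; rewrite !gJ in h1 h2; lra.
Qed.

(** With the dual vector in the first slot the four terms of [w4_dot] cancel in pairs; for this
    reason the W4 part contributes no term at the dual of the Lee form to the final formulas. *)
Lemma w4_zero_trace_J al t u v : scalar al -> w4_eq al t ->
  g (t (sharp S x al) u) v = 0.
Proof.
move=> lal e; have := w4_dot (sharp S x al) u v lal e.
rewrite gJ (dot_sharp H) // gJ !(dot_sharp H) // => h; lra.
Qed.

Lemma tr_gJ : tr (fun a b => g (J a) b) = 0.
Proof.
have : tr (fun a b => g (J a) b) = - tr (fun a b => g (J a) b).
  rewrite -{1}(tr_sym H Ux) -trN; apply: tr_eq => a b; by rewrite gJ gC.
by move=> h; lra.
Qed.

(** For [4 t] the metric term contributes [2 n], the two terms contracting [al] contribute [-1]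
    each, and the trace of [g (J a) b] is 0. The resulting [(n - 1) / 2] is the normalisation of the
    Lee form. *)
Lemma w4_trace al t z : scalar al -> w4_eq al t ->
  g (tr t) z = (n%:R - 1) / 2 * al z.
Proof.
move=> lal e; rewrite dot_mtrace.
suff : 4 * tr (fun a b => g (t a b) z) = 2 * (n%:R - 1) * al z by move=> h; lra.
rewrite -trZ.
transitivity (tr (fun a b => al z * g a b - al b * g a z + al (J z) * g (J a) b
    - al (J b) * g (J a) z)).
  by apply: tr_eq => a b; rewrite (w4_dot _ _ _ lal e); ring.
rewrite !(trB, trD) !trZ (tr_g H Ux) tr_gJ (tr_J H Ux (B := fun a b => al b * g a z)); last first.
  split => [a k b c|b k a c]; first by rewrite lal; ring.
  by rewrite dot_linearl; ring.
have -> : tr (fun a b => al b * g a z) = al z.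
  by rewrite -(tr_sym H Ux) (tr_contractr H Ux).
by rewrite natrM; ring.
Qed.

Lemma in_W_form_bilinear t z : in_W S x t -> bilinear_map (fun a b => g (t a b) z).
Proof.
move=> [Tr Tl _ _]; split => [a k b c|b k a c]; first by rewrite Tr dot_linearl.
by rewrite Tl dot_linearl.
Qed.

Lemma j_antilinear_trace t : in_W S x t -> j_antilinear t -> tr t = 0.
Proof.
move=> W nn; apply: (tr_vec0 H Ux) => z; apply: (tr_JN H Ux).
  exact: in_W_form_bilinear.
by move=> a b; rewrite nn (in_W_J _ _ W) (linN lJ) JJ opprK dotNl.
Qed.

(** The contraction [<s_{e_i} v, t_u e_i>], one of the two shapes in which products of torsions
    enter the first Ricci formula; the other is [quad_sym]. *)
Definition quad s t u v := tr (fun a b => g (s a v) (t u b)).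

Lemma quad_form_bilinear s t u v : in_W S x s -> in_W S x t ->
  bilinear_map (fun a b => g (s a v) (t u b)).
Proof.
move=> [Sr Sl _ _] [Tr Tl _ _]; split => [a k b c|b k a c].
  by rewrite Tr dot_linearr.
by rewrite Sl dot_linearl.
Qed.

(** Replacing [e_i] by [J e_i] changes the sign, since the contracted slot is linear over [J] in [s]
    and antilinear in [t]. *)
Lemma quad_j_linear s t u v : in_W S x s -> in_W S x t -> j_linear s -> quad s t u v = 0.
Proof.
move=> Ws Wt hs; apply: (tr_JN H Ux); first exact: quad_form_bilinear.
by move=> a b; rewrite hs (in_W_J _ _ Wt) dotNr (lh_herm H).
Qed.

Lemma quad_j_antilinear s t u v : in_W S x s -> in_W S x t -> j_antilinear t ->
  quad s t (J u) (J v) = quad s t u v.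
Proof.
move=> Ws Wt nt; apply: tr_eq => a b.
by rewrite nt (in_W_J _ _ Ws) dotNl dotNr opprK (lh_herm H).
Qed.

Lemma quad_in_W1 s u v : in_W1 S x s -> quad s s u v = quad s s v u.
Proof.
move=> W1; rewrite /quad -(tr_sym H Ux); apply: tr_eq => a b.
by rewrite (in_W1_alt b v W1) (in_W1_alt u a W1) dotNl dotNr opprK gC.
Qed.

(** The W4 formula leaves four contractions. As [s] is antilinear in its first slot, the two that
    contain [J] repeat the two that do not. *)
Lemma quad_w4 s t al u v : in_W S x s -> in_W S x t -> j_antilinear s -> scalar al ->
  w4_eq al t ->
  2 * quad s t u v = al (s u v) + g (s (sharp S x al) u) v.
Proof.
move=> Ws Wt ns lal e; have [Sr Sl _ _] := Ws.
suff : 4 * quad s t u v = 2 * (al (s u v) + g (s (sharp S x al) u) v) by move=> h; lra.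
rewrite -trZ.
have ls (w z : E) : scalar (fun a => g (s a w) z) by move=> k a b; rewrite Sl dot_linearl.
transitivity (tr (fun a b => g b u * al (s a v) - g (sharp S x al) b * g (s a v) u
   - g b (J u) * g (s a v) (J (sharp S x al)) + g b (J (sharp S x al)) * g (s a v) (J u))).
  apply: tr_eq => a b; rewrite gC (w4_dot _ _ _ lal e).
  have -> : al (J (s a v)) = - g (s a v) (J (sharp S x al)).
    by rewrite -(dot_sharp H _ Ux lal) gC gJ.
  have -> : al (J b) = - g b (J (sharp S x al)).
    by rewrite -(dot_sharp H _ Ux lal) gC gJ.
  rewrite -(dot_sharp H b Ux lal) (gC u b) (gC (J u) b) (gC u) (gC (J u) (s a v)); ring.
rewrite !(trB, trD) !(tr_contract_swap H Ux) //.
- have -> : tr (fun a b => g (sharp S x al) b * g (s a v) u) = g (s (sharp S x al) v) u.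
    by rewrite -(tr_contract_swap H Ux _ (ls v u)) //; apply: tr_eq => a b; rewrite gC.
  rewrite !ns !dotNl !(lh_herm H) // (gC _ (sharp S x al)) (dot_sharp H) //.
  rewrite (in_W_skew _ u v Ws); ring.
- by move=> k a b; rewrite Sl lal.
Qed.

(** When [D a] is the derivative of a tensor [t] along [a], this and [cross_form] are the traces
    [<(D_{e_i} t)_{e_i} u, v>] and [<(D_{e_i} t)_u e_i, v>]. In each class the second, or its skew
    part, is expressed by simpler data. *)
Definition div_form (D : E -> E -> E -> E) u v := tr (fun a b => g (D a b u) v).
Definition cross_form (D : E -> E -> E -> E) u v := tr (fun a b => g (D a u b) v).

Lemma div_form_skew D u v : (forall a, in_W S x (D a)) -> div_form D u v = - div_form D v u.
Proof. by move=> W; rewrite /div_form -trN; apply: tr_eq => a b; exact: in_W_skew. Qed.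

Lemma div_form_J D u v : (forall a, in_W S x (D a)) ->
  div_form D (J u) (J v) = - div_form D u v.
Proof.
move=> W; rewrite /div_form -trN; apply: tr_eq => a b.
by rewrite (in_W_J _ _ (W a)) dotNl (lh_herm H).
Qed.

Lemma cross_form_W1 D u v : (forall a, in_W1 S x (D a)) ->
  cross_form D u v = - div_form D u v.
Proof.
by move=> W; rewrite /div_form -trN; apply: tr_eq => a b; rewrite (in_W1_alt _ _ (W a)) dotNl.
Qed.

Lemma in_W2_cyclic t u v w : in_W2 S x t -> g (t u v) w + g (t v w) u + g (t w u) v = 0.
Proof.
move=> W2; have nn := in_W2_j_antilinear W2; have [W cyc] := W2.
have := cyc (J u) v w; rewrite !nn JJ !dotNl !dotNr (lh_herm H) // (in_W_J _ _ W) dotNl.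
by rewrite (lh_herm H) //; lra.
Qed.

(** The cyclic identity of [D a] on [u], [v] and the contracted vector trades the two cross
    contractions for the divergence. *)
Lemma cross_form_W2 D u v : (forall a, in_W2 S x (D a)) ->
  cross_form D u v - cross_form D v u = div_form D u v.
Proof.
move=> W2; rewrite /cross_form /div_form -trB; apply: tr_eq => a b.
have W c : in_W S x (D c) by have [] := W2 c.
have := in_W2_cyclic u b v (W2 a).
rewrite (in_W_skew b v u (W a)) (in_W_skew v u b (W a)); lra.
Qed.

Lemma cross_form_j_linear D u v : (forall a, in_W S x (D a)) -> (forall a, j_linear (D a)) ->
  cross_form D (J u) (J v) = cross_form D u v.
Proof. by move=> W h; apply: tr_eq => a b; rewrite h (lh_herm H). Qed.

Section W4Derivative.
Variables (D : E -> E -> E -> E) (P : E -> E -> R).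
Hypothesis lP : bilinear_map P.
Hypothesis DP : forall a, w4_eq (P a) (D a).

Lemma cross_form_w4 u v : 4 * cross_form D u v =
  P u v - tr P * g u v + P (J u) (J v) - tr (fun a b => P a (J b)) * g (J u) v.
Proof.
have [lr ll] := lP; rewrite -trZ.
transitivity (tr (fun a b => g b u * P a v - g u v * P a b + g b (J u) * P a (J v)
   - g (J u) v * P a (J b))).
  apply: tr_eq => a b; rewrite (w4_dot _ _ _ (lr a) (DP a)) (gC b u) (gC b (J u)); ring.
by rewrite !(trB, trD) !trZ !(tr_contract_swap H Ux) //; ring.
Qed.

Lemma div_form_w4 u v : 4 * div_form D u v =
  P u v - P v u - P (J u) (J v) + P (J v) (J u).
Proof.
have [lr ll] := lP; rewrite -trZ.
transitivity (tr (fun a b => g b u * P a v - g b v * P a u - g b (J u) * P a (J v)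
   + g b (J v) * P a (J u))).
  by apply: tr_eq => a b; rewrite (w4_dot _ _ _ (lr a) (DP a)) !gJ; ring.
by rewrite !(trB, trD) !(tr_contract_swap H Ux) //; ring.
Qed.

End W4Derivative.

End ClassAlgebra.

(** * The two contractions of the defect and their combinations *)

Section RicciFormulas.
Context {R : realType} {n : nat} (S : local_structure R (2 * n)) (U : set 'rV[R]_(2 * n)).
Hypothesis H : local_hermitian S U.
Variable x : 'rV[R]_(2 * n).
Hypothesis Ux : U x.
Local Notation E := 'rV[R]_(2 * n).
Local Notation g := (dot S x).
Local Notation J := (Jv S x).
Local Notation tr := (mtrace S x).
Local Notation div_form := (div_form S x).
Local Notation cross_form := (cross_form S x).
Local Notation quad := (quad S x).
Implicit Types (u v w z a b : E).

Let lJ := Jv_linear S x.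
Let JJ u : J (J u) = - u := lh_sq H u Ux.
Let gC u v : g u v = g v u := lh_sym H u v Ux.
Let gJ u v : g (J u) v = - g u (J v) := dot_J_skew H u v Ux.

Section Trace.
Variables (xi : E -> E -> E) (D A : E -> E -> E -> E) (r : E -> E -> R).
Hypothesis Wxi : in_W S x xi.
Hypothesis WD : forall u, in_W S x (D u).
Hypothesis DL : forall v w, linear (fun u => D u v w).
Hypothesis AE : forall u v w, A u v w = D u v w - D v u w + xi (xi u v - xi v u) w.

Definition quad_sym u v := tr (fun a b => g (xi (xi a u) v) b).

Lemma quad_contract u v : tr (fun a b => g (xi (xi u a) v) b) = - quad xi xi u v.
Proof.
have [Xr Xl _ _] := Wxi.
transitivity (tr (fun a b => tr (fun c d => g c (xi u a) * g (xi d v) b))).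
  apply: tr_eq => a b; rewrite (tr_contract H Ux (f := fun c => g (xi c v) b)) //.
  by move=> k p q; rewrite Xl dot_linearl.
rewrite tr_exchange /quad -trN -[RHS](tr_sym H Ux); apply: tr_eq => c d.
transitivity (tr (fun a b => g a (xi u c) * - g (xi d v) b)).
  by apply: tr_eq => a b; rewrite gC (in_W_skew H Ux _ _ _ Wxi) (gC a); ring.
rewrite (tr_contract H Ux (f := fun b => - g (xi d v) b)) //.
by move=> k p q; rewrite dot_linearr; ring.
Qed.

(** With a second contraction this is the sum of [<e_j, xi_{e_i} u> <e_i, xi_{e_j} v>], where
    exchanging [i] and [j] exchanges [u] and [v]. The term thus drops out of skew parts. *)
Lemma quad_symC u v : quad_sym u v = quad_sym v u.
Proof.
have [Xr Xl _ _] := Wxi.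
have E1 p q : quad_sym p q = tr (fun a b => tr (fun c d => g c (xi a p) * g b (xi d q))).
  apply: tr_eq => a b; under [RHS]tr_eq do rewrite (gC b).
  rewrite (tr_contract H Ux (f := fun c => g (xi c q) b)) //.
  by move=> k p' q'; rewrite Xl dot_linearl.
rewrite !E1 tr_exchange -[LHS](tr_sym H Ux); apply: tr_eq => a b.
by rewrite -[LHS](tr_sym H Ux); apply: tr_eq => c d; rewrite mulrC.
Qed.

Lemma trace_defect u v : tr (fun a b => g (A u a v) b) =
  - g (tr (D u)) v + cross_form D u v - quad xi xi u v - quad_sym u v.
Proof.
have [Xr Xl _ _] := Wxi.
rewrite -quad_contract dot_mtrace -trN -!trD -trB; apply: tr_eq => a b.
rewrite AE (linB (Xl v)) !(dotDl, dotNl).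
rewrite (in_W_skew H Ux a v b (WD u)) (in_W_skew H Ux u v b (WD a)); ring.
Qed.

(** Under the trace, exchanging [a] and [J b] changes the sign, so the two halves of [A] contribute
    equally; the quadratic part collapses to the vector [tr xi]. *)
Lemma trace_defect_J u v : tr (fun a b => g (A a (J b) u) (J v)) =
  2 * (tr (fun a b => g (D a (J b) u) (J v)) - g (xi (J (tr xi)) u) (J v)).
Proof.
have [Xr Xl _ _] := Wxi.
pose f c := g (xi c u) (J v); pose f1 c := f (J c).
have lf : scalar f by move=> k p q; rewrite /f Xl dot_linearl.
have lf1 : scalar f1 by move=> k p q; rewrite /f1 lJ lf.
have trf (h : E -> R) : scalar h -> tr (fun a b => h (xi a b)) = h (tr xi).
  move=> lh; rewrite mtraceRE /mtrace (sca_sum lh); apply: eq_bigr => i _.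
  by rewrite (sca_sum lh); apply: eq_bigr => j _; rewrite (scaZ lh).
have DJ : tr (fun a b => g (D (J b) a u) (J v)) = - tr (fun a b => g (D a (J b) u) (J v)).
  rewrite -(tr_J H Ux (B := fun a b => g (D (J b) a u) (J v))); last first.
    split => [a k b c|b k a c]; first by rewrite (lJ k b c) DL dot_linearl.
    by have [_ Dl _ _] := WD (J b); rewrite Dl dot_linearl.
  rewrite -trN -[RHS](tr_sym H Ux); apply: tr_eq => a b.
  by rewrite JJ (linN (DL _ _)) dotNl.
have X1 : tr (fun a b => f (xi a (J b))) = - f1 (tr xi).
  by rewrite -(trf f1 lf1) -trN; apply: tr_eq => a b; rewrite (in_W_J _ _ Wxi) (scaN lf).
have X2 : tr (fun a b => f (xi (J b) a)) = f1 (tr xi).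
  rewrite -(tr_J H Ux (B := fun a b => f (xi (J b) a))); last first.
    by split => [a k b c|b k a c]; [rewrite (lJ k b c) Xl lf|rewrite Xr lf].
  rewrite -(trf f1 lf1) -[RHS](tr_sym H Ux); apply: tr_eq => a b.
  by rewrite JJ (linN (Xl _)) (in_W_J _ _ Wxi) opprK.
transitivity (tr (fun a b => g (D a (J b) u) (J v)) - tr (fun a b => g (D (J b) a u) (J v))
  + (tr (fun a b => f (xi a (J b))) - tr (fun a b => f (xi (J b) a)))).
  rewrite -!trB -trD; apply: tr_eq => a b.
  by rewrite AE (linB (Xl u)) !(dotDl, dotNl).
by rewrite DJ X1 X2 /f1 /f; ring.
Qed.

Lemma defect_J u v w : A u v (J w) = - J (A u v w).
Proof.
rewrite !AE !(in_W_J _ _ (WD _)) (in_W_J _ _ Wxi) (linD lJ) (linB lJ).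
by row_ring.
Qed.

Lemma trace_defect_J_anti u v :
  tr (fun a b => g (A a (J b) (J u)) (J (J v))) = - tr (fun a b => g (A a (J b) u) (J v)).
Proof.
by rewrite -trN; apply: tr_eq => a b; rewrite defect_J JJ dotNl dotNr opprK gJ.
Qed.

End Trace.

Lemma in_WD s t : in_W S x s -> in_W S x t -> in_W S x (fun u v => s u v + t u v).
Proof.
move=> [sr sl ss sa] [tr' tl ts ta]; split => [u k a b|v k a b|u v w|u v].
- by rewrite sr tr' scalerDr addrACA.
- by rewrite sl tl scalerDr addrACA.
- by rewrite dotDl dotDr ss ts opprD.
- by rewrite (linD lJ) addrACA sa ta addr0.
Qed.

Lemma quadDl s s' t u v : quad (fun a b => s a b + s' a b) t u v = quad s t u v + quad s' t u v.
Proof. by rewrite -trD; apply: tr_eq => a b; rewrite dotDl. Qed.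

Lemma quadDr s t t' u v : quad s (fun a b => t a b + t' a b) u v = quad s t u v + quad s t' u v.
Proof. by rewrite -trD; apply: tr_eq => a b; rewrite dotDr. Qed.

Lemma cross_formD D D' u v : cross_form (fun a b c => D a b c + D' a b c) u v =
  cross_form D u v + cross_form D' u v.
Proof. by rewrite -trD; apply: tr_eq => a b; rewrite dotDl. Qed.

Lemma div_formD D D' u v : div_form (fun a b c => D a b c + D' a b c) u v =
  div_form D u v + div_form D' u v.
Proof. by rewrite -trD; apply: tr_eq => a b; rewrite dotDl. Qed.

Lemma tr_vecD (s t : E -> E -> E) : tr (fun a b => s a b + t a b) = tr s + tr t.
Proof.
by apply: (dot_eq H Ux) => w; rewrite dotDl !dot_mtrace -trD; apply: tr_eq => a b; rewrite dotDl.
Qed.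

Lemma eq_quad s s' u v : (forall a b, s a b = s' a b) -> quad s s u v = quad s' s' u v.
Proof. by move=> e; apply: tr_eq => a b; rewrite !e. Qed.

Lemma w4_alt_form al t u v : scalar al -> w4_eq S x al t -> al (t u v) = al (t v u).
Proof.
move=> lal e; pose s := sharp S x al.
have alE w : al w = g w s by rewrite gC (dot_sharp H).
have h1 := w4_dot H Ux u v s lal e; have h2 := w4_dot H Ux v u s lal e.
have e1 : al (J s) = 0.
  by have := gJ s s; rewrite alE (gC s (J s)) => h; lra.
rewrite -!alE e1 (gC v u) in h1 h2; lra.
Qed.

Section Splitting.
Variables (xi t3 t4 : E -> E -> E) (D D3 D4 : E -> E -> E -> E) (al : E -> R) (P : E -> E -> R).
Variables (r : E -> E -> R) (A : E -> E -> E -> E).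
Hypothesis lal : scalar al.
Hypothesis lP : bilinear_map P.
Hypothesis W4 : in_W S x t4.
Hypothesis e4 : w4_eq S x al t4.
Hypothesis WD4 : forall u, in_W S x (D4 u).
Hypothesis eD4 : forall u, w4_eq S x (P u) (D4 u).
Hypothesis D4L : forall v w, linear (fun u => D4 u v w).
Hypothesis AE : forall u v w, A u v w = D u v w - D v u w + xi (xi u v - xi v u) w.
(* rI uses the symmetry of Ric, rII the first Bianchi identity: see [ric_star20_defect]
   and [ric_star20_defect_J]. *)
Hypothesis rI : forall u v, r u v = tr (fun a b => g (A v a u) b) - tr (fun a b => g (A u a v) b).
Hypothesis rII : forall u v, r u v = 2^-1 * tr (fun a b => g (A a (J b) u) (J v)).

Let h4 := w4_j_linear H Ux lal e4.
Let hD4 u := w4_j_linear H Ux (lP.1 u) (eD4 u).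

(** The differential of the Lee form written with its derivative [P] for the minimal connection,
    whose torsion accounts for the last term. *)
Definition dtheta u v := P u v - P v u + al (xi u v - xi v u).
Definition dtheta20 u v := 2^-1 * (dtheta u v - dtheta (J u) (J v)).

Section Hermitian.
Hypothesis W3 : in_W3 S x t3.
Hypothesis WD3 : forall u, in_W3 S x (D3 u).
Hypothesis D3L : forall v w, linear (fun u => D3 u v w).
Hypothesis xiE : forall u v, xi u v = t3 u v + t4 u v.
Hypothesis DE : forall u v w, D u v w = D3 u v w + D4 u v w.

Let h3 := in_W3_j_linear H Ux W3.
Let W3' : in_W S x t3. Proof. by have [] := W3. Qed.
Let xi_split : xi = fun u v => t3 u v + t4 u v.
Proof. by apply/funext => u; apply/funext => v. Qed.
Let D_split : D = fun u v w => D3 u v w + D4 u v w.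
Proof. by apply/funext => u; apply/funext => v; apply/funext => w. Qed.
Let Wxi : in_W S x xi. Proof. by rewrite xi_split; exact: in_WD. Qed.
Let WD u : in_W S x (D u). Proof. by rewrite D_split; apply: in_WD => //; have [] := WD3 u. Qed.
Let DL v w : linear (fun u => D u v w).
Proof. by move=> k p q; rewrite !DE D3L D4L scalerDr addrACA. Qed.
Let hxi : j_linear S x xi.
Proof. by move=> u v; rewrite !xiE h3 h4 (linD lJ). Qed.
Let hD u : j_linear S x (D u).
Proof. by move=> v w; rewrite !DE (in_W3_j_linear H Ux (WD3 u)) hD4 (linD lJ). Qed.

Let trace_D u v : g (tr (D u)) v = (n%:R - 1) / 2 * P u v.
Proof.
have -> : tr (D u) = tr (D3 u) + tr (D4 u) by rewrite -tr_vecD D_split.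
by have [_ _ ->] := WD3 u; rewrite add0r (w4_trace H Ux v (lP.1 u) (eD4 u)).
Qed.

Let trace_xi v : g (tr xi) v = (n%:R - 1) / 2 * al v.
Proof.
have -> : tr xi = tr t3 + tr t4 by rewrite -tr_vecD xi_split.
by have [_ _ ->] := W3; rewrite add0r (w4_trace H Ux v lal e4).
Qed.

Let r_anti u v : r (J u) (J v) = - r u v.
Proof. by rewrite !rII (trace_defect_J_anti Wxi WD AE) mulrN. Qed.

Lemma hermitian_r_dtheta u v : r u v = (n%:R - 1) / 2 * dtheta20 u v.
Proof.
suff : 2 * r u v = 2 * ((n%:R - 1) / 2 * dtheta20 u v) by move=> h; lra.
(* By [rII] the form [r] is anti-invariant under [J], so the anti-invariant part of [rI] suffices.
   In it the cross contractions, invariant in this class, and the quadratic terms disappear. *)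
have -> : 2 * r u v = r u v - r (J u) (J v) by rewrite r_anti; ring.
rewrite !rI !(trace_defect Wxi WD AE) !trace_D.
rewrite !(quad_j_linear H Ux _ _ Wxi Wxi hxi) !(quad_symC Wxi (J v)) (quad_symC Wxi v).
rewrite !(cross_form_j_linear H Ux _ _ WD hD) /dtheta20 /dtheta.
rewrite !hxi !(in_W_J _ _ Wxi) !(linN lJ) !JJ !opprK.
lra.
Qed.

Lemma hermitian_r_div u v : r u v = div_form D3 u v + 2^-1 * dtheta20 u v
  - (n%:R - 1) / 2 * g (t3 (sharp S x al) u) v.
Proof.
have [Xr Xl _ _] := Wxi.
rewrite rII (trace_defect_J Wxi WD DL AE) mulrA mulVf ?pnatr_eq0 // mul1r.
have -> : tr (fun a b => g (D a (J b) u) (J v)) = div_form D3 u v + div_form D4 u v.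
  by rewrite -div_formD; apply: tr_eq => a b; rewrite hD (lh_herm H) // DE.
(* Here [xi (J u) (J v) = xi u v], so that the torsion terms of [dtheta20] cancel. *)
have -> : div_form D4 u v = 2^-1 * dtheta20 u v.
  have := div_form_w4 H Ux lP eD4 u v; rewrite /dtheta20 /dtheta.
  rewrite !hxi !(in_W_J _ _ Wxi) !(linN lJ) !JJ !opprK => h; lra.
have -> : tr xi = ((n%:R - 1) / 2) *: sharp S x al.
  by apply: (dot_eq H Ux) => w; rewrite trace_xi dotZl (dot_sharp H).
rewrite (linZ lJ) (linZ (Xl u)) dotZl hxi (lh_herm H) // xiE dotDl.
by rewrite (w4_zero_trace_J H Ux _ _ lal e4) addr0.
Qed.

End Hermitian.

Section NonIntegrable.
Variables (t1 t2 : E -> E -> E) (D1 D2 : E -> E -> E -> E).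
Hypothesis W1 : in_W1 S x t1.
Hypothesis W2 : in_W2 S x t2.
Hypothesis WD1 : forall u, in_W1 S x (D1 u).
Hypothesis WD2 : forall u, in_W2 S x (D2 u).
Hypothesis D1L : forall v w, linear (fun u => D1 u v w).
Hypothesis D2L : forall v w, linear (fun u => D2 u v w).
Hypothesis xiE : forall u v, xi u v = t1 u v + t2 u v + t4 u v.
Hypothesis DE : forall u v w, D u v w = D1 u v w + D2 u v w + D4 u v w.

Let eta u v := t1 u v + t2 u v.
Let W1' : in_W S x t1. Proof. by have [] := W1. Qed.
Let W2' : in_W S x t2. Proof. by have [] := W2. Qed.
Let WD1' u : in_W S x (D1 u). Proof. by have [] := WD1 u. Qed.
Let WD2' u : in_W S x (D2 u). Proof. by have [] := WD2 u. Qed.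
Let Weta : in_W S x eta. Proof. exact: in_WD. Qed.
Let neta : j_antilinear S x eta.
Proof.
move=> v w; rewrite /eta (in_W1_j_antilinear W1) (in_W2_j_antilinear H Ux W2).
by rewrite (linD lJ) opprD.
Qed.
Let xi_split : xi = fun u v => eta u v + t4 u v.
Proof. by apply/funext => u; apply/funext => v; rewrite xiE. Qed.
Let D_split : D = fun u v w => D1 u v w + D2 u v w + D4 u v w.
Proof. by apply/funext => u; apply/funext => v; apply/funext => w. Qed.
Let Wxi : in_W S x xi. Proof. by rewrite xi_split; apply: in_WD; [exact: Weta|exact: W4]. Qed.
Let WD u : in_W S x (D u). Proof. by rewrite D_split; do 2! apply: in_WD => //. Qed.
Let DL v w : linear (fun u => D u v w).
Proof.
by move=> k p q; rewrite !DE D1L D2L D4L !scalerDr; row_ring.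
Qed.

Let trace_D u v : g (tr (D u)) v = (n%:R - 1) / 2 * P u v.
Proof.
have -> : tr (D u) = tr (D1 u) + tr (D2 u) + tr (D4 u) by rewrite -!tr_vecD D_split.
rewrite (j_antilinear_trace H Ux (WD1' u)); last exact: in_W1_j_antilinear.
rewrite (j_antilinear_trace H Ux (WD2' u)); last exact: (in_W2_j_antilinear H Ux).
by rewrite !add0r (w4_trace H Ux v (lP.1 u) (eD4 u)).
Qed.

Let trace_xi : tr xi = ((n%:R - 1) / 2) *: sharp S x al.
Proof.
apply: (dot_eq H Ux) => w; rewrite dotZl (dot_sharp H) //.
have -> : tr xi = tr eta + tr t4 by rewrite -tr_vecD xi_split.
by rewrite (j_antilinear_trace H Ux Weta neta) add0r (w4_trace H Ux w lal e4).
Qed.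

Let r_anti u v : r (J u) (J v) = - r u v.
Proof. by rewrite !rII (trace_defect_J_anti Wxi WD AE) mulrN. Qed.

Let h s u v := g (s (sharp S x al) u) v.
Let alt u v := al (eta u v) - al (eta v u).

Let alt_J u v : alt (J u) (J v) = - alt u v.
Proof.
rewrite /alt !neta !(in_W_J _ _ Weta) !(linN lJ) !JJ !opprK !(scaN lal); ring.
Qed.

Let h_skew s u v : in_W S x s -> h s u v = - h s v u.
Proof. by move=> Ws; exact: (in_W_skew H Ux). Qed.

Let h_J s u v : in_W S x s -> h s (J u) (J v) = - h s u v.
Proof. by move=> Ws; rewrite /h (in_W_J _ _ Ws) dotNl (lh_herm H). Qed.

Let h_split u v : h eta u v = h t1 u v + h t2 u v.
Proof. by rewrite /h dotDl. Qed.

(** Alternation doubles the W1 part, whose lowered form is a three-form; on W2 the cyclic identity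
    reduces it to a single term with opposite sign. *)
Let altE u v : alt u v = 2 * h t1 u v - h t2 u v.
Proof.
pose s := sharp S x al; have alE w : al w = g w s by rewrite gC (dot_sharp H).
rewrite /alt /h /eta !(scaD lal) !alE.
rewrite (in_W1_alt v u W1) dotNl.
have -> : g (t1 s u) v = g (t1 u v) s.
  by rewrite (in_W1_alt _ _ W1) dotNl -(in_W_skew H Ux _ _ _ W1').
have := in_W2_cyclic H Ux u v s W2.
rewrite (in_W_skew H Ux v s u W2') => h2; lra.
Qed.

Let dthetaE u v : dtheta u v = P u v - P v u + alt u v.
Proof.
rewrite /dtheta /alt !xi_split (scaB lal) !(scaD lal) (w4_alt_form v u lal e4); ring.
Qed.

Let quadE u v : 2 * (quad xi xi u v - quad xi xi v u) =
  2 * (quad eta eta u v - quad eta eta v u) + alt u v + 2 * h eta u v.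
Proof.
have q p q : quad xi xi p q = quad eta eta p q + quad eta t4 p q.
  rewrite xi_split quadDl !quadDr !(quad_j_linear H Ux _ _ W4 _ h4) //; ring.
have q4 p q := quad_w4 H Ux p q Weta W4 neta lal e4.
rewrite !q /alt; have := q4 u v; have := q4 v u.
rewrite -![g (eta _ _) _]/(h eta _ _) (h_skew v u Weta) => e1 e2; lra.
Qed.

Let crossE u v : cross_form D v u - cross_form D u v =
  2 * div_form D1 u v - div_form D2 u v
  + 4^-1 * (P v u - P u v + P (J v) (J u) - P (J u) (J v)
    + 2 * tr (fun a b => P a (J b)) * g (J u) v).
Proof.
have c p q : cross_form D p q = cross_form D1 p q + cross_form D2 p q + cross_form D4 p q.
  by rewrite D_split !cross_formD.
rewrite !c !(cross_form_W1 _ _ WD1) (div_form_skew H Ux v u WD1').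
have e2 := cross_form_W2 H Ux u v WD2.
have e4u := cross_form_w4 H Ux lP eD4 u v; have e4v := cross_form_w4 H Ux lP eD4 v u.
rewrite (gC v u) in e4v; rewrite (gJ v u) (gC v) in e4v; lra.
Qed.

Let r_ricci u v : r u v = (n%:R - 1) / 2 * (P u v - P v u) + (cross_form D v u - cross_form D u v)
  + (quad xi xi u v - quad xi xi v u).
Proof.
rewrite rI !(trace_defect Wxi WD AE) !trace_D (quad_symC Wxi v u); ring.
Qed.

Let r_bianchi u v : r u v = - div_form D1 u v - div_form D2 u v
  + 4^-1 * (P u v - P v u - P (J u) (J v) + P (J v) (J u)) + (n%:R - 1) / 2 * h eta u v.
Proof.
have [Xr Xl _ _] := Wxi.
rewrite rII (trace_defect_J Wxi WD DL AE) mulrA mulVf ?pnatr_eq0 // mul1r.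
have -> : tr (fun a b => g (D a (J b) u) (J v)) =
    - div_form D1 u v - div_form D2 u v + div_form D4 u v.
  rewrite -!trN -!trD; apply: tr_eq => a b.
  rewrite DE !dotDl (in_W1_j_antilinear (WD1 a)) (in_W2_j_antilinear H Ux (WD2 a)) hD4.
  by rewrite !dotNl !(lh_herm H).
have -> : div_form D4 u v = 4^-1 * (P u v - P v u - P (J u) (J v) + P (J v) (J u)).
  have := div_form_w4 H Ux lP eD4 u v => e; lra.
rewrite trace_xi (linZ lJ) (linZ (Xl u)) dotZl xi_split neta h4 dotDl dotNl !(lh_herm H) //.
by rewrite (w4_zero_trace_J H Ux _ _ lal e4) -/(h eta u v); ring.
Qed.

Let quad_anti u v : 2 * (quad xi xi u v - quad xi xi v u)
   - 2 * (quad xi xi (J u) (J v) - quad xi xi (J v) (J u)) = 2 * alt u v + 4 * h eta u v.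
Proof.
rewrite !quadE !(quad_j_antilinear H Ux _ _ Weta Weta neta) alt_J (h_J _ _ Weta); ring.
Qed.

Let r_ricci20 u v : r u v = (n%:R - 1) / 4 * (P u v - P v u - P (J u) (J v) + P (J v) (J u))
  + 2 * div_form D1 u v - div_form D2 u v + 2^-1 * alt u v + h eta u v.
Proof.
have e1 := r_ricci u v; have e2 := r_ricci (J u) (J v); rewrite r_anti in e2.
have q := quad_anti u v.
rewrite !crossE in e1 e2.
rewrite !(div_form_J H Ux _ _ WD1') !(div_form_J H Ux _ _ WD2') in e2.
have [Pr Pl] := lP.
rewrite !JJ !(scaN (Pr _)) !(scaN (Pl _)) !opprK dotNl -gJ in e2.
lra.
Qed.

Lemma nonintegrable_r u v : r u v = - div_form D2 u v + (n%:R + 1) / 6 * dtheta20 u v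
  + n%:R / 2 * g (t2 (sharp S x al) u) v.
Proof.
(* The divergence of the W1 part has coefficient 2 in [e1] and -1 in [e2], so [e1 + 2 e2] is free of
   it and gives [3 r]. Its coefficients [(n + 1) / 4] and [(2 n - 1) / 2] become [(n + 1) / 6] and
   [n / 2] once [dtheta20] is formed. *)
rewrite -/(h t2 u v); have e1 := r_ricci20 u v; have e2 := r_bianchi u v.
rewrite altE h_split in e1; rewrite h_split in e2.
rewrite /dtheta20 !dthetaE alt_J altE; lra.
Qed.

Lemma nonintegrable_div1 u v : div_form D1 u v =
  - (n%:R - 2) / 6 * dtheta20 u v + (n%:R - 3) / 2 * g (t1 (sharp S x al) u) v.
Proof.
(* Now [e1 - e2] eliminates [r], and the divergence of the W2 part with it. *)
rewrite -/(h t1 u v); have e1 := r_ricci20 u v; have e2 := r_bianchi u v.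
rewrite altE h_split in e1; rewrite h_split in e2.
rewrite /dtheta20 !dthetaE alt_J altE; lra.
Qed.

Lemma w1_w4_dtheta11 u v : (2 < n)%N -> (forall a b, t2 a b = 0) ->
  dtheta (J u) (J v) = - dtheta u v.
Proof.
move=> n2 t20; have [Pr Pl] := lP.
pose tau := tr (fun a b => P a (J b)).
pose X u v := P u v - P v u + P (J u) (J v) - P (J v) (J u).
(* This is the invariant part of [rI], to which [r] does not contribute. The quadratic terms drop
   out because [quad] is symmetric on W1 and the remaining mixed terms are anti-invariant. *)
have EX p q : (n%:R - 2) * X p q = - 2 * tau * g (J p) q.
  have e1 := r_ricci p q; have e2 := r_ricci (J p) (J q); rewrite r_anti in e2.
  have q1 := quadE p q; have q2 := quadE (J p) (J q).
  rewrite !(quad_j_antilinear H Ux _ _ Weta Weta neta) alt_J (h_J _ _ Weta) in q2.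
  have qs : quad eta eta p q = quad eta eta q p.
    have ee a b : eta a b = t1 a b by rewrite /eta t20 addr0.
    by rewrite !(eq_quad _ _ ee) (quad_in_W1 H Ux).
  rewrite !crossE in e1 e2.
  rewrite !(div_form_J H Ux _ _ WD1') !(div_form_J H Ux _ _ WD2') in e2.
  rewrite !JJ !(scaN (Pr _)) !(scaN (Pl _)) !opprK dotNl -gJ in e2.
  rewrite /X /tau; lra.
have t1' : tr (fun a b => P b (J a)) = tau by rewrite (tr_sym H Ux).
have t2' : tr (fun a b => P (J b) a) = - tau.
  rewrite -(tr_J H Ux (B := fun a b => P (J b) a)); last first.
    split => [a k b c|b k a c]; last exact: Pr.
    by rewrite (lJ k b c) Pl.
  by rewrite -t1' -trN; apply: tr_eq => a b; rewrite JJ (scaN (Pl _)).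
have t3' : tr (fun a b => P (J a) b) = - tau by rewrite -t2' (tr_sym H Ux).
have tX : tr (fun a b => X a (J b)) = 4 * tau.
  transitivity (tr (fun a b => P a (J b) - P (J b) a - P (J a) b + P b (J a))).
    by apply: tr_eq => a b; rewrite /X !JJ (scaN (Pr _)) (scaN (Pl _)); ring.
  by rewrite !(trB, trD) t1' t2' t3' -/tau; ring.
(* Contracting [EX] with [q] replaced by [J q] gives [4 (n - 2) tau = - 4 n tau], that is
   [8 (n - 1) tau = 0]. *)
have tau0 : tau = 0.
  have : (n%:R - 2) * (4 * tau) = - 2 * tau * (2 * n)%:R.
    have : tr (fun a b => (n%:R - 2) * X a (J b)) = tr (fun a b => (- 2 * tau) * g a b).
      by apply: tr_eq => a b; rewrite EX (lh_herm H).
    by rewrite (trZ S x (n%:R - 2)) tX (trZ S x (- 2 * tau)) (tr_g H Ux).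
  rewrite natrM => e; have : (8 * (n%:R - 1)) * tau = 0 by lra.
  move/eqP; rewrite mulf_eq0 mulf_eq0 pnatr_eq0 subr_eq0 (eqr_nat R n 1) /=.
  by case: n n2 => [|[|m]] //= _ /eqP.
have X0 : X u v = 0.
  have := EX u v; rewrite tau0 mulr0 mul0r => /eqP; rewrite mulf_eq0 subr_eq0.
  by rewrite (eqr_nat R n 2) gtn_eqF //= => /eqP.
rewrite !dthetaE alt_J; move: X0; rewrite /X => X0; lra.
Qed.

End NonIntegrable.

End Splitting.

End RicciFormulas.

(** * The Lee form and the components of the torsion *)

(* [lee] alone denotes the order of the extended reals here. *)
HB.lock Definition lee_form (R : realType) (n : nat) (S : local_structure R (2 * n))
  (x v : 'rV[R]_(2 * n)) : R := Defs.lee S x v.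

Section LeeForm.
Context {R : realType} {n : nat} (S : local_structure R (2 * n)) (U : set 'rV[R]_(2 * n)).
Hypothesis H : local_hermitian S U.
Hypothesis n2 : (2 <= n)%N.
Local Notation E := 'rV[R]_(2 * n).
Local Notation g := (dot S).
Local Notation J := (Jv S).
Local Notation G := (levi_civita S).
Local Notation xi := (minimal_torsion J G).
Local Notation C := (minimal_con J G).
Local Notation th := (lee_form S).
Implicit Types (x u v w z : E).
Let oU := lh_open H.

Lemma lee_formE x : th x = Defs.lee S x.
Proof. by rewrite lee_form.unlock. Qed.

Lemma natr_sub1_neq0 : n%:R - 1 != 0 :> R.
Proof. by rewrite subr_eq0 (eqr_nat R n 1); case: n n2 => [|[|m]]. Qed.

Lemma leeE x v : U x -> th x v = 2 / (n%:R - 1) * g x (mtrace S x (xi x)) v.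
Proof.
move=> Ux; rewrite lee_formE /Defs.lee /Jform1 (codiff_kahler H) // (lh_sq H) // dotNr; field.
exact: natr_sub1_neq0.
Qed.

Lemma lee_scalar x : U x -> scalar (th x).
Proof. by move=> Ux a u v; rewrite !leeE // dot_linearr; ring. Qed.

Lemma lee_smooth v : smooth U (fun x => th x v).
Proof.
apply: (smooth_eq oU (fun x Ux => esym (leeE v Ux))); apply: smoothZ => //.
apply: (@smooth_eq _ _ _ oU (fun x => mtrace S x (fun a b => g x (xi x a b) v))).
  by move=> x Ux; rewrite dot_mtrace.
have [_ _ xs] := xi_bilinear H.
apply: (smooth_mtrace H) => a b; apply: (smooth_dot H) => //; exact: field_cst.
Qed.

Definition cov_lee x u v := 'D_u (fun y => th y v) x - th x (C x u v).

Lemma cov_lee_bilinear x : U x -> bilinear_map (cov_lee x).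
Proof.
move=> Ux; have lt := lee_scalar Ux; have [Cr Cl _] := C_bilinear H; split => [u a v w|v a u w].
  rewrite /cov_lee (Cr x u Ux) lt.
  rewrite (derive_eq_on oU (g := fun y => a * th y v + th y w)) //; last first.
    by move=> y Uy; exact: lee_scalar.
  rewrite (sderiveD oU) //; last 2 first.
  - by apply: smoothZ => //; exact: lee_smooth.
  - exact: lee_smooth.
  by rewrite (sderiveZ oU _ u (lee_smooth v) Ux); abstract_derive; ring.
by rewrite /cov_lee (Cl x v Ux) lt (derive_linear_dir oU (lee_smooth v) Ux); abstract_derive; ring.
Qed.

Lemma dlee_dtheta x u v : U x ->
  dlee S x u v = cov_lee x u v - cov_lee x v u + th x (xi x u v - xi x v u).
Proof.
move=> Ux; have lt := lee_scalar Ux.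
have e : Defs.lee S = th by apply/funext => y; rewrite lee_formE.
rewrite /dlee /dform1 /nabla_form1 !nabla_cstE e /cov_lee !minimal_conE !(scaD lt) !(scaN lt).
by rewrite (levi_civitaC H v u Ux); abstract_derive; ring.
Qed.

Lemma dlee_dtheta20 x u v : U x -> proj20 S (dlee S) x u v =
  dtheta20 S x (xi x) (th x) (cov_lee x) u v.
Proof. by move=> Ux; rewrite /proj20 /dtheta20 /dtheta !dlee_dtheta. Qed.

Lemma w4_eq_dot x (al : E -> R) (t : E -> E -> E) : U x -> scalar al ->
  (forall v w z, 4 * g x (t v w) z = g x v w * al z - al w * g x v z
     + g x (J x v) w * al (J x z) - al (J x w) * g x (J x v) z) -> w4_eq S x al t.
Proof.
move=> Ux lal e v w; apply: (dot_eq H Ux) => z; rewrite dotZl e.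
by rewrite !(dotBl, dotZl) (dot_J_skew H (sharp S x al)) // !(dot_sharp H) //; ring.
Qed.

Section W4Field.
Variable t4 : E -> E -> E -> E.
Hypothesis W4 : forall x, U x -> in_W S x (t4 x).
Hypothesis e4 : forall x, U x -> w4_eq S x (th x) (t4 x).

(** Nothing is assumed on how the components depend on the point. This one is smooth because it is
    an explicit expression in the metric, [J] and the Lee form. *)
Lemma w4_bilinear_field : bilinear_field U t4.
Proof.
split => [y u Uy|y v Uy|u v]; first by have [] := W4 Uy.
  by have [_ + _ _] := W4 Uy; exact.
have [_ SJ] := J_linear_field H.
have sJ a b : smooth U (fun y => g y (J y a) b).
  by apply: (smooth_dot H) => //; exact: field_cst.
have tJ a : smooth U (fun y => th y (J y a)).
  apply: (@slot_smooth _ _ _ oU th) => //; first by move=> y Uy; exact: lee_scalar.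
  exact: lee_smooth.
apply: (smooth_field_dot H) => z.
apply: (@smooth_eq _ _ _ oU (fun y => 4^-1 * (g y u v * th y z - th y v * g y u z
   + g y (J y u) v * th y (J y z) - th y (J y v) * g y (J y u) z))).
  by move=> y Uy; have := w4_dot H Uy u v z (lee_scalar Uy) (e4 Uy) => <-; field.
have sg a b := smooth_dot_cst H a b; have st := lee_smooth.
apply: smoothZ => //; apply: smoothB => //; last exact: smoothM.
by apply: smoothD => //; [apply: smoothB => //; exact: smoothM|exact: smoothM].
Qed.

(** The W4 formula combines the forms [F0] to [F3], all obtained from the metric times the Lee form
    by inserting [J] and swapping slots; as the metric and [J] are parallel, only the Lee form is
    differentiated. *)
Lemma cov_tensor_w4 x u : U x -> w4_eq S x (cov_lee x u) (cov_tensor C t4 x u).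
Proof.
move=> Ux; have [lP _] := cov_lee_bilinear Ux; apply: w4_eq_dot => // v w z.
pose F0 y a b c := g y a b * th y c.
have tF0 : trilinear_form U F0.
  split => [y a b Uy k p q|y a b Uy k p q|y a b Uy k p q|a b c]; rewrite /F0.
  - by rewrite (lee_scalar Uy); ring.
  - by rewrite dot_linearr; ring.
  - by rewrite dot_linearl; ring.
  - by apply: smoothM => //; [exact: smooth_dot_cst|exact: lee_smooth].
have F0E a b c : cov_form S F0 x u a b c = g x a b * cov_lee x u c.
  rewrite /cov_form (sderiveM oU) //; [|exact: smooth_dot_cst|exact: lee_smooth].
  by rewrite (C_metric H) // /F0 /cov_lee; ring.
pose F1 y a b c := F0 y a c b.
have tF1 : trilinear_form U F1 by exact: trilinear_form_swap23.
pose F2 y a b c := F0 y (J y a) b (J y c).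
have tF2 : trilinear_form U F2.
  exact: (trilinear_form_J3 H (F := fun y a b c => F0 y (J y a) b c) (trilinear_form_J1 H tF0)).
pose F3 y a b c := F2 y a c b.
have tF3 : trilinear_form U F3 by exact: trilinear_form_swap23.
have bt := w4_bilinear_field; have tF := trilinear_form_dot H bt.
have F2E a b c : cov_form S F2 x u a b c = g x (J x a) b * cov_lee x u (J x c).
  apply: etrans (cov_form_J3 H u a b c (trilinear_form_J1 H tF0) Ux) _.
  by apply: etrans (cov_form_J1 H u a b (J x c) tF0 Ux) _; exact: F0E.
have F1E : cov_form S F1 x u v w z = g x v z * cov_lee x u w.
  by rewrite /F1 cov_form_swap23 F0E.
have F3E : cov_form S F3 x u v w z = g x (J x v) z * cov_lee x u (J x w).
  by rewrite /F3 cov_form_swap23 F2E.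
have -> : 4 * g x (cov_tensor C t4 x u v w) z =
    cov_form S (fun y a b c => (F0 y a b c + -1 * F1 y a b c)
      + (F2 y a b c + -1 * F3 y a b c)) x u v w z.
  rewrite -(cov_form_dot H) // -(cov_formZ H) //; apply: (eq_cov_form H) => // y a b c Uy.
  rewrite (w4_dot H Uy a b c (lee_scalar Uy) (e4 Uy)) /F3 /F2 /F1 /F0; ring.
have zF1 := trilinear_formZ H (-1) tF1.
have zF3 := trilinear_formZ H (-1) tF3.
have t01 := trilinear_formD H tF0 zF1; have t23 := trilinear_formD H tF2 zF3.
rewrite (cov_formD H u v w z t01 t23 Ux) (cov_formD H u v w z tF0 zF1 Ux).
rewrite (cov_formD H u v w z tF2 zF3 Ux) (cov_formZ H _ u v w z tF1 Ux).
by rewrite (cov_formZ H _ u v w z tF3 Ux) F0E F1E F2E F3E; ring.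
Qed.

End W4Field.

Lemma div_tensor_div_form (t : E -> E -> E -> E) x u v :
  div_tensor S t x u v = div_form S x (cov_tensor C t x) u v.
Proof.
rewrite /div_tensor dot_mtrace; apply: tr_eq => a b.
by rewrite nablaU_tensorE.
Qed.

Lemma cov_tensorD (t t' : E -> E -> E -> E) x u v w :
  bilinear_field U t -> bilinear_field U t' -> U x ->
  cov_tensor C (fun y a b => t y a b + t' y a b) x u v w =
  cov_tensor C t x u v w + cov_tensor C t' x u v w.
Proof.
move=> [lr ll ls] [lr' ll' ls'] Ux; have [Cr _ _] := C_bilinear H.
rewrite !cov_tensorE (fderiveD oU) // (linD (Cr x u Ux)); abstract_derive.
by row_ring.
Qed.

Lemma eq_cov_tensor (t t' : E -> E -> E -> E) x u v w :
  (forall y a b, U y -> t y a b = t' y a b) -> U x ->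
  cov_tensor C t x u v w = cov_tensor C t' x u v w.
Proof.
move=> e Ux; rewrite !cov_tensorE !(e x _ _ Ux).
by rewrite (derive_eq_on oU u (fun y => e y v w) Ux).
Qed.

Lemma cov_tensor0 x u v w : U x -> cov_tensor C (fun _ _ _ => 0) x u v w = 0.
Proof.
move=> Ux; have [Cr _ _] := C_bilinear H.
by rewrite cov_tensorE derive_cst (lin0 (Cr x u Ux)); row_ring.
Qed.

Section Components.
Variables (t1 t2 t3 t4 : E -> E -> E -> E).
Hypothesis W1 : forall x, U x -> in_W1 S x (t1 x).
Hypothesis W2 : forall x, U x -> in_W2 S x (t2 x).
Hypothesis W3 : forall x, U x -> in_W3 S x (t3 x).
Hypothesis W4 : forall x, U x -> in_W4 S x (t4 x).
Hypothesis tE : forall x u v, U x ->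
  torsion S x u v = t1 x u v + t2 x u v + t3 x u v + t4 x u v.

Lemma xi_components x u v : U x -> xi x u v = t1 x u v + t2 x u v + t3 x u v + t4 x u v.
Proof. by move=> Ux; rewrite -torsionE tE. Qed.

Lemma components_W4 x : U x -> in_W S x (t4 x).
Proof. by move=> /W4 []. Qed.

(** [in_W4] only asserts that some one-form exists. The trace of the torsion identifies it: W1, W2
    and W3 are trace free, and the factor in [leeE] inverts the one in [w4_trace]. *)
Lemma components_w4_eq x : U x -> w4_eq S x (th x) (t4 x).
Proof.
move=> Ux; have [W4' [al [lal e]]] := W4 Ux.
have xiE : xi x = fun u v => t1 x u v + t2 x u v + t3 x u v + t4 x u v.
  by apply/funext => u; apply/funext => v; exact: xi_components.
have alE v : al v = th x v.
  rewrite leeE // xiE !(tr_vecD H Ux) !dotDl.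
  have [W1' _] := W1 Ux; have [W2' _] := W2 Ux; have [W3' _ ->] := W3 Ux.
  rewrite (j_antilinear_trace H Ux W1'); last by apply: in_W1_j_antilinear; exact: W1.
  rewrite (j_antilinear_trace H Ux W2'); last by apply: (in_W2_j_antilinear H Ux); exact: W2.
  rewrite !dot0l !add0r (w4_trace H Ux v lal e); field; exact: natr_sub1_neq0.
by move=> u v; rewrite e; have -> : al = th x by apply/funext.
Qed.

Lemma t4_bilinear : bilinear_field U t4.
Proof. exact: w4_bilinear_field components_W4 components_w4_eq. Qed.

Section Hermitian.
Hypothesis t10 : forall x u v, U x -> t1 x u v = 0.
Hypothesis t20 : forall x u v, U x -> t2 x u v = 0.

Lemma xi_hermitian x u v : U x -> xi x u v = t3 x u v + t4 x u v.
Proof. by move=> Ux; rewrite xi_components // t10 // t20 // !add0r. Qed.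

Lemma t3_bilinear : bilinear_field U t3.
Proof.
apply: (bilinear_field_eq oU _ (bilinear_fieldB oU (xi_bilinear H) t4_bilinear)).
by move=> y u v Uy; rewrite xi_hermitian // addrK.
Qed.

Lemma cov_xi_hermitian x u v w : U x ->
  cov_tensor C xi x u v w = cov_tensor C t3 x u v w + cov_tensor C t4 x u v w.
Proof.
move=> Ux; rewrite -(cov_tensorD _ _ _ t3_bilinear t4_bilinear Ux).
by apply: eq_cov_tensor => // y a b Uy; exact: xi_hermitian.
Qed.

Lemma hermitian_ric_star20 x u v : U x ->
  ric_star20 S x u v = (n%:R - 1) / 2 * proj20 S (dlee S) x u v /\
  ric_star20 S x u v = div_tensor S t3 x u v + 2^-1 * proj20 S (dlee S) x u v
    - (n%:R - 1) / 2 * g x (t3 x (lee_sharp S x) u) v.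
Proof.
move=> Ux; rewrite dlee_dtheta20 // div_tensor_div_form /lee_sharp -!lee_formE.
have [c3r c3l c3L] := cov_tensor_linear oU (C_bilinear H) t3_bilinear Ux.
have [c4r c4l c4L] := cov_tensor_linear oU (C_bilinear H) t4_bilinear Ux.
have WD4 a : in_W S x (cov_tensor C t4 x a).
  by apply: (in_W_cov_tensor H t4_bilinear) => // y Uy; exact: components_W4.
have eD4 a : w4_eq S x (cov_lee x a) (cov_tensor C t4 x a).
  by apply: cov_tensor_w4 => //; [exact: components_W4|exact: components_w4_eq].
have WD3 a : in_W3 S x (cov_tensor C t3 x a).
  by apply: (in_W3_cov_tensor H) => //; exact: t3_bilinear.
have AE a b c := riem_defectE J G x a b c.
split.
- exact: (hermitian_r_dtheta H Ux (lee_scalar Ux) (cov_lee_bilinear Ux) (components_W4 Ux)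
    (components_w4_eq Ux) WD4 eD4 AE (ric_star20_defect H Ux) (ric_star20_defect_J H Ux)
    (W3 Ux) WD3 (fun a b => xi_hermitian a b Ux) (fun a b c => cov_xi_hermitian a b c Ux)).
- exact: (hermitian_r_div H Ux (lee_scalar Ux) (cov_lee_bilinear Ux) (components_W4 Ux)
    (components_w4_eq Ux) WD4 eD4 c4L AE (ric_star20_defect_J H Ux)
    (W3 Ux) WD3 c3L (fun a b => xi_hermitian a b Ux) (fun a b c => cov_xi_hermitian a b c Ux)).
Qed.

End Hermitian.

Section NonIntegrable.
Hypothesis t30 : forall x u v, U x -> t3 x u v = 0.

Let xi3 x u v : U x -> xi x u v = t1 x u v + t2 x u v + t4 x u v.
Proof. by move=> Ux; rewrite xi_components // t30 // addr0. Qed.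

(** Once W4 is removed, the cyclic sum of the torsion kills the W2 part and triples the three-form
    of the W1 part, which is therefore smooth. *)
Lemma t1_bilinear : bilinear_field U t1.
Proof.
split => [y u Uy|y v Uy|u v].
- by have [[]] := W1 Uy.
- by have [[_ + _ _] _] := W1 Uy; exact.
have eb := bilinear_fieldB oU (xi_bilinear H) t4_bilinear.
have [_ _ es] := eb.
apply: (smooth_field_dot H) => z.
pose F y a b c := g y (xi y a b - t4 y a b) c.
apply: (@smooth_eq _ _ _ oU (fun y => 3^-1 * (F y u v z + F y v z u + F y z u v))).
  move=> y Uy; have FE a b c : F y a b c = g y (t1 y a b) c + g y (t2 y a b) c.
    by rewrite /F xi3 // addrK dotDl.
  rewrite !FE; have cyc := in_W2_cyclic H Uy u v z (W2 Uy).
  have W1y := W1 Uy; have [W1' _] := W1y.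
  have e1 : g y (t1 y v z) u = g y (t1 y u v) z.
    by rewrite (in_W_skew H Uy _ _ _ W1') (in_W1_alt v u W1y) dotNl opprK.
  have e2 : g y (t1 y z u) v = g y (t1 y u v) z.
    by rewrite (in_W1_alt z u W1y) dotNl (in_W_skew H Uy _ _ _ W1') opprK.
  rewrite e1 e2; lra.
have sF a b c : smooth U (fun y => F y a b c).
  by apply: (smooth_dot H); [exact: es|exact: field_cst].
by apply: smoothZ => //; do 2! apply: smoothD => //.
Qed.

Lemma t2_bilinear : bilinear_field U t2.
Proof.
apply: (bilinear_field_eq oU _ (bilinear_fieldB oU
   (bilinear_fieldB oU (xi_bilinear H) t4_bilinear) t1_bilinear)).
by move=> y u v Uy; rewrite xi3 // addrK addrAC subrr add0r.
Qed.

Let cov_xi3 x u v w : U x ->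
  cov_tensor C xi x u v w = cov_tensor C t1 x u v w + cov_tensor C t2 x u v w
    + cov_tensor C t4 x u v w.
Proof.
move=> Ux; have b12 := bilinear_fieldD oU t1_bilinear t2_bilinear.
rewrite -(cov_tensorD _ _ _ t1_bilinear t2_bilinear Ux).
rewrite -(cov_tensorD _ _ _ b12 t4_bilinear Ux).
by apply: eq_cov_tensor => // y a b Uy; exact: xi3.
Qed.

Lemma nonintegrable_identities x u v : U x ->
  [/\ ric_star20 S x u v = - div_tensor S t2 x u v
        + (n%:R + 1) / 6 * proj20 S (dlee S) x u v
        + n%:R / 2 * g x (t2 x (lee_sharp S x) u) v,
      div_tensor S t1 x u v = - (n%:R - 2) / 6 * proj20 S (dlee S) x u v
        + (n%:R - 3) / 2 * g x (t1 x (lee_sharp S x) u) v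
    & (2 < n)%N -> (forall a b, t2 x a b = 0) ->
        dlee S x (J x u) (J x v) = - dlee S x u v].
Proof.
move=> Ux; rewrite !dlee_dtheta20 // !div_tensor_div_form /lee_sharp -!lee_formE !dlee_dtheta //.
have [c1r c1l c1L] := cov_tensor_linear oU (C_bilinear H) t1_bilinear Ux.
have [c2r c2l c2L] := cov_tensor_linear oU (C_bilinear H) t2_bilinear Ux.
have [c4r c4l c4L] := cov_tensor_linear oU (C_bilinear H) t4_bilinear Ux.
have WD4 a : in_W S x (cov_tensor C t4 x a).
  by apply: (in_W_cov_tensor H t4_bilinear) => // y Uy; exact: components_W4.
have eD4 a : w4_eq S x (cov_lee x a) (cov_tensor C t4 x a).
  by apply: cov_tensor_w4 => //; [exact: components_W4|exact: components_w4_eq].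
have WD1 a : in_W1 S x (cov_tensor C t1 x a) by exact: (in_W1_cov_tensor H t1_bilinear).
have WD2 a : in_W2 S x (cov_tensor C t2 x a) by exact: (in_W2_cov_tensor H t2_bilinear).
have AE a b c := riem_defectE J G x a b c.
split.
- exact: (nonintegrable_r H Ux (lee_scalar Ux) (cov_lee_bilinear Ux) (components_W4 Ux)
    (components_w4_eq Ux) WD4 eD4 c4L AE (ric_star20_defect H Ux) (ric_star20_defect_J H Ux)
    (W1 Ux) (W2 Ux) WD1 WD2 c1L c2L (fun a b => xi3 a b Ux) (fun a b c => cov_xi3 a b c Ux)).
- exact: (nonintegrable_div1 H Ux (lee_scalar Ux) (cov_lee_bilinear Ux) (components_W4 Ux)
    (components_w4_eq Ux) WD4 eD4 c4L AE (ric_star20_defect H Ux) (ric_star20_defect_J H Ux)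
    (W1 Ux) (W2 Ux) WD1 WD2 c1L c2L (fun a b => xi3 a b Ux) (fun a b c => cov_xi3 a b c Ux)).
- exact: (w1_w4_dtheta11 H Ux (lee_scalar Ux) (cov_lee_bilinear Ux) (components_W4 Ux)
    (components_w4_eq Ux) WD4 eD4 AE (ric_star20_defect H Ux) (ric_star20_defect_J H Ux)
    (W1 Ux) (W2 Ux) WD1 WD2 (fun a b => xi3 a b Ux) (fun a b c => cov_xi3 a b c Ux)).
Qed.

End NonIntegrable.
End Components.
End LeeForm.

Lemma almost_hermitian_local (R : realType) (n : nat) (M : manifold R (2 * n))
  (H : almost_hermitian M) (c : chart M) : local_hermitian (H c) (crange c).
Proof.
have oU : open (crange c) by exact: range_open.
split => //.
- by move=> i j; apply: smooth_on_smooth; exact: met_smooth.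
- by move=> i j; apply: smooth_on_smooth; exact: acs_smooth.
- by move=> x u v; exact: met_sym.
- by move=> x u; exact: met_pos.
- by move=> x u; exact: acs_sq.
- by move=> x u v; exact: met_acs.
Qed.

(** * Dimension four *)

Section OrthogonalFrames.
Context {R : realType} {m : nat} (S : local_structure R m) (U : set 'rV[R]_m).
Hypothesis H : local_hermitian S U.
Variable x : 'rV[R]_m.
Hypothesis Ux : U x.
Local Notation E := 'rV[R]_m.
Local Notation g := (dot S x).
Local Notation tr := (mtrace S x).
Implicit Types (u v w z a b X : E) (s : seq E).

(** Frames are not normalised: dividing by [g a a] in the expansions spares square roots. *)
Definition orthogonal_frame s :=
  [/\ size s = m, pairwise (fun a b => g a b == 0) s & all (fun a => a != 0) s].

(** Orthogonality to [s] is a homogeneous linear system with fewer equations than unknowns. *)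
Lemma exists_orthogonal s : (size s < m)%N ->
  exists2 v, v != 0 & forall a, a \in s -> g v a = 0.
Proof.
move=> sm; pose B := met S x *m (\matrix_(j < size s) s`_j)^T.
have : kermx B != 0.
  by rewrite kermx_eq0 /row_free neq_ltn (leq_ltn_trans (rank_leq_col B) sm).
case/rowV0Pn => v /sub_kermxP vB v0; exists v => // a /(nthP 0)[j js <-].
have /rowP/(_ (Ordinal js)) := vB; rewrite mulmxA !mxE => e.
by rewrite /dot mxE -[RHS]e; apply: eq_bigr => i _; rewrite !mxE.
Qed.

Lemma frame_orthogonal s i j : orthogonal_frame s -> (i < m)%N -> (j < m)%N -> i != j ->
  g s`_i s`_j = 0.
Proof.
move=> [ss /(pairwiseP 0) ps _] im jm; rewrite neq_ltn => /orP[ij|ji].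
  by have := ps i j; rewrite !inE ss => /(_ im jm ij) /eqP.
by rewrite (lh_sym H) //; have := ps j i; rewrite !inE ss => /(_ jm im ji) /eqP.
Qed.

Lemma frame_complete s X : orthogonal_frame s -> (forall a, a \in s -> g X a = 0) -> X = 0.
Proof.
move=> fs X0; have [ss _ ns] := fs; pose A := \matrix_(i < m) s`_i.
have uA : A \in unitmx.
  rewrite -row_free_unit -kermx_eq0; apply/eqP/row_matrixP => k; rewrite row0.
  set c := row k _; have cA : c *m A = 0 by rewrite -row_mul mulmx_ker row0.
  apply/rowP => j; rewrite [RHS]mxE; have jm : (j < size s)%N by rewrite ss.
  have sj : s`_j != 0 by exact: (all_nthP 0 ns).
  have : g (c *m A) s`_j = 0 by rewrite cA dot0l.
  rewrite mulmx_sum_row (sca_sum (dot_linearl S x _)) (bigD1 j) //= big1 => [|i ij].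
    rewrite addr0 dotZl rowK => /eqP; rewrite mulf_eq0 => /orP[/eqP //|].
    by rewrite gt_eqF // (lh_pos H).
  by rewrite dotZl rowK (frame_orthogonal fs) ?mulr0.
have XA : X *m met S x *m A^T = 0.
  apply/rowP => j; rewrite [RHS]mxE -(X0 s`_j) ?mem_nth ?ss //.
  by rewrite /dot !mxE; apply: eq_bigr => k _; rewrite !mxE.
have := congr1 (fun Y => Y *m invmx A^T *m invmx (met S x)) XA.
by rewrite mulmxK ?unitmx_tr // mulmxK ?(met_unit H) // !mul0mx.
Qed.

Lemma frame_expand s X : orthogonal_frame s -> X = \sum_(a <- s) (g X a / g a a) *: a.
Proof.
move=> fs; apply/eqP; rewrite -subr_eq0; apply/eqP; apply: (frame_complete fs) => b bs.
have [ss _ ns] := fs; rewrite dotBl (sca_sum (dot_linearl S x _)) (big_nth 0) ss big_mkord.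
have [j jm bE] := nthP 0 bs; rewrite ss in jm.
rewrite (bigD1 (Ordinal jm)) //= big1 => [|i ij]; last first.
  by rewrite dotZl -bE (frame_orthogonal fs (ltn_ord i) jm) ?mulr0.
rewrite dotZl bE addr0 divfK ?subrr // gt_eqF // (lh_pos H) //.
by have /allP := ns; exact.
Qed.

Lemma frame_trace s (B : E -> E -> R) : orthogonal_frame s -> bilinear_map B ->
  tr B = \sum_(a <- s) B a a / g a a.
Proof.
move=> fs [Br Bl].
have lin (r : seq E) : tr (fun a b => \sum_(c <- r) (g a c / g c c) * B c b) =
    \sum_(c <- r) B c c / g c c.
  elim: r => [|c r IH].
    rewrite big_nil; transitivity (tr (fun a b => 0 * B a b)).
      by apply: tr_eq => a b; rewrite big_nil mul0r.
    by rewrite trZ mul0r.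
  rewrite big_cons -IH; transitivity (tr (fun a b => (g c c)^-1 * (g a c * B c b)
      + \sum_(c <- r) (g a c / g c c) * B c b)).
    by apply: tr_eq => a b; rewrite big_cons; congr (_ + _); ring.
  by rewrite trD trZ (tr_contract H Ux) // mulrC.
rewrite -lin; apply: tr_eq => a b.
rewrite {1}(frame_expand a fs) (sca_sum (Bl b)); apply: eq_bigr => c _.
by rewrite (scaZ (Bl b)).
Qed.

Lemma J_neq0 u : u != 0 -> Jv S x u != 0.
Proof.
move=> u0; apply/eqP => Ju0; move: (lh_sq H u Ux); rewrite Ju0 (lin0 (Jv_linear S x)) => /eqP.
by rewrite eq_sym oppr_eq0 (negbTE u0).
Qed.

Lemma dot_self_J u : g u (Jv S x u) = 0.
Proof. have := dot_J_skew H u u Ux; rewrite (lh_sym H (Jv S x u) _ Ux) => h; lra. Qed.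

End OrthogonalFrames.

Section Dimension4.
Context {R : realType} (S : local_structure R (2 * 2)) (U : set 'rV[R]_(2 * 2)).
Hypothesis H : local_hermitian S U.
Variable x : 'rV[R]_(2 * 2).
Hypothesis Ux : U x.
Local Notation E := 'rV[R]_(2 * 2).
Local Notation g := (dot S x).
Local Notation J := (Jv S x).
Local Notation tr := (mtrace S x).
Implicit Types (u v w z a b : E).

Let lJ := Jv_linear S x.
Let JJ u : J (J u) = - u := lh_sq H u Ux.
Let gC u v : g u v = g v u := lh_sym H u v Ux.
Let gJ u v : g (J u) v = - g u (J v) := dot_J_skew H u v Ux.

Lemma in_W_self t u : in_W S x t -> g (t u u) u = 0 /\ g (t u u) (J u) = 0.
Proof.
move=> W; have h1 := in_W_skew H Ux u u u W; have h2 := in_W_skew H Ux u u (J u) W.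
rewrite (in_W_J _ _ W) dotNl opprK gJ in h2; split; lra.
Qed.

(** The trace condition makes [t a a] and [t b b] proportional, while they are orthogonal to the
    complex lines of [a] and of [b] respectively; so [t a a] is 0. Then [t] alternates, but it is
    linear over [J] in one slot and antilinear in the other, hence 0. *)
Lemma in_W3_dim4 t u v : in_W3 S x t -> t u v = 0.
Proof.
move=> W3; have hl := in_W3_j_linear H Ux W3; have [W inv t0] := W3; have [Tr Tl _ _] := W.
suff self a : t a a = 0.
  have alt a b : t a b = - t b a.
    apply/eqP; rewrite -addr_eq0; apply/eqP; have := self (a + b).
    by rewrite (linD (Tr _)) !(linD (Tl _)) !self add0r addr0 addrC.
  have e1 : J (t u v) = - J (t u v).
    by rewrite -{1}hl alt (in_W_J _ _ W) opprK (alt v u) (linN lJ).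
  have : J (J (t u v)) = 0.
    have -> : J (t u v) = 0.
      apply/rowP => i; move/rowP: e1 => /(_ i); rewrite !mxE => h; lra.
    exact: lin0 lJ.
  by rewrite JJ => /eqP; rewrite oppr_eq0 => /eqP.
have [->|a0] := eqVneq a 0; first exact: (lin0 (Tr 0)).
have [b b0 bo] := @exists_orthogonal _ _ S x [:: a; J a] isT.
have ba : g b a = 0 by apply: bo; rewrite !inE eqxx.
have bJa : g b (J a) = 0 by apply: bo; rewrite !inE eqxx orbT.
have Jba : g (J b) a = 0 by rewrite gJ bJa oppr0.
have JbJa : g (J b) (J a) = 0 by rewrite (lh_herm H).
have fr : orthogonal_frame S x [:: a; J a; b; J b].
  split => //=; last by rewrite a0 b0 !(J_neq0 H Ux).
  by rewrite !(dot_self_J H Ux) !(gC a b) !(gC a (J b)) !(gC (J a)) ba Jba bJa JbJa eqxx.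
have gp c : c != 0 -> g c c != 0 by move=> c0; rewrite gt_eqF // (lh_pos H).
have z0 c : (g (t a a) c) / g a a + g (t b b) c / g b b = 0.
  have : tr (fun p q => g (t p q) c) = 0 by rewrite -dot_mtrace t0 dot0l.
  rewrite (frame_trace H Ux fr) ?big_cons ?big_nil; last exact: in_W_form_bilinear.
  by rewrite !inv !(lh_herm H) // => h; lra.
have [a1 a2] := in_W_self a W; have [b1 b2] := in_W_self b W.
apply: (frame_complete H Ux fr) => c; rewrite !inE => /or4P[] /eqP -> //.
- have := z0 b; rewrite b1 mul0r addr0 => /eqP.
  by rewrite mulf_eq0 invr_eq0 (negbTE (gp a a0)) orbF => /eqP.
- have := z0 (J b); rewrite b2 mul0r addr0 => /eqP.
  by rewrite mulf_eq0 invr_eq0 (negbTE (gp a a0)) orbF => /eqP.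
Qed.

Section RicciW4.
Variables (xi : E -> E -> E) (D A : E -> E -> E -> E) (al : E -> R) (P b : E -> E -> R).
Hypothesis lal : scalar al.
Hypothesis lP : bilinear_map P.
Hypothesis Wxi : in_W S x xi.
Hypothesis exi : w4_eq S x al xi.
Hypothesis WD : forall u, in_W S x (D u).
Hypothesis eD : forall u, w4_eq S x (P u) (D u).
Hypothesis AE : forall u v w, A u v w = D u v w - D v u w + xi (xi u v - xi v u) w.
Hypothesis bE : forall u v, b u v = 2 * tr (fun p q => g (A u p v) q).

(** For [n = 2] the trace of [D] carries the factor [(n - 1) / 2 = 1 / 2], and its terms cancel
    those of [P] in the cross contractions; only the multiple of the metric in [cross_form_w4]
    survives. The quadratic terms are 0 or anti-invariant. *)
Lemma w4_dim4_b u v :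
  b u v + b v u + (b (J u) (J v) + b (J v) (J u)) = - 2 * tr P * g u v.
Proof.
have hxi := w4_j_linear H Ux lal exi; have [Xr Xl _ _] := Wxi.
have qs p q : quad_sym S x xi (J p) (J q) = - quad_sym S x xi p q.
  rewrite /quad_sym -trN; apply: tr_eq => c d.
  by rewrite (in_W_J c p Wxi) (linN (Xl _)) hxi (in_W_J _ q Wxi) (linN lJ) JJ !opprK dotNl.
have q0 p q : quad S x xi xi p q = 0 by exact: (quad_j_linear H Ux).
have trD p q : g (tr (D p)) q = 2^-1 * P p q.
  rewrite (w4_trace H Ux q (lP.1 p) (eD p)); congr (_ * _); lra.
rewrite !bE !(trace_defect H Ux Wxi WD AE) !qs !q0 !trD.
have [Pr Pl] := lP.
have c1 := cross_form_w4 H Ux lP eD u v; have c2 := cross_form_w4 H Ux lP eD v u.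
have c3 := cross_form_w4 H Ux lP eD (J u) (J v); have c4 := cross_form_w4 H Ux lP eD (J v) (J u).
rewrite !JJ !(scaN (Pr _)) !(scaN (Pl _)) !opprK !dotNl !(lh_herm H) // in c3 c4.
rewrite (gC v u) in c2 c4.
have e1 : g (J v) u = - g (J u) v by rewrite gJ gC.
have e2 : g v (J u) = g (J u) v by rewrite gC.
have e3 : g u (J v) = - g (J u) v by rewrite gJ opprK.
rewrite e1 in c2; rewrite e2 in c4; rewrite e3 in c3; lra.
Qed.

End RicciW4.

End Dimension4.

Section HermitianDimension4.
Context {R : realType} (S : local_structure R (2 * 2)) (U : set 'rV[R]_(2 * 2)).
Hypothesis H : local_hermitian S U.
Local Notation E := 'rV[R]_(2 * 2).
Local Notation J := (Jv S).
Local Notation G := (levi_civita S).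
Local Notation xi := (minimal_torsion J G).
Local Notation C := (minimal_con J G).
Implicit Types (x u v w : E).

Lemma proj11_0_dim4 x u v :
  (forall y, U y -> in_W S y (xi y)) -> (forall y, U y -> w4_eq S y (lee_form S y) (xi y)) ->
  U x -> proj11_0 S (fun y u v => ric S y u v - ric_star S y u v) x u v = 0.
Proof.
move=> Wxi exi Ux; have bxi := xi_bilinear H.
have WD a : in_W S x (cov_tensor C xi x a) by apply: (in_W_cov_tensor H bxi).
have eD a : w4_eq S x (cov_lee S x a) (cov_tensor C xi x a) by apply: (cov_tensor_w4 H).
have AE a b c := riem_defectE J G x a b c.
pose b p q := ric S x p q - ric_star S x p q.
have bE p q : b p q = 2 * mtrace S x (fun a c => dot S x (riem_defect J G x p a q) c).
  by rewrite /b (ric_star_ric H Ux) opprB addrC subrK.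
have lP := cov_lee_bilinear H isT Ux.
have key := w4_dim4_b H Ux (lee_scalar H isT Ux) lP (Wxi x Ux) (exi x Ux) WD eD AE bE.
pose k := mtrace S x (cov_lee S x).
have num (b1 b2 b3 b4 c d : R) : b1 + b2 + (b3 + b4) = - 2 * c * d ->
    2^-1 * (2^-1 * (b1 + b2) + 2^-1 * (b3 + b4)) = - (2^-1) * c * d by move=> e; lra.
have JE p q : Jinv_part S (sym_part (fun y u v => ric S y u v - ric_star S y u v)) x p q
    = - (2^-1) * k * dot S x p q.
  transitivity (2^-1 * (2^-1 * (b p q + b q p) + 2^-1 * (b (J x p) (J x q) + b (J x q) (J x p)))).
    by [].
  exact: num (key p q).
rewrite /proj11_0 /tracefree_part JE.
have -> : mtrace S x (Jinv_part S (sym_part (fun y u v => ric S y u v - ric_star S y u v)) x)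
   = - (2^-1) * k * (2 * 2)%:R.
  by rewrite -(tr_g H Ux) -trZ; apply: tr_eq => p q; exact: JE.
by rewrite natrM; field.
Qed.

End HermitianDimension4.

(** * Dimension six *)

Section Dimension6.
Context {R : realType} (S : local_structure R (2 * 3)) (U : set 'rV[R]_(2 * 3)).
Hypothesis H : local_hermitian S U.
Variable x : 'rV[R]_(2 * 3).
Hypothesis Ux : U x.
Local Notation E := 'rV[R]_(2 * 3).
Local Notation g := (dot S x).
Local Notation J := (Jv S x).
Implicit Types (u v w z a b c X Y Z W : E) (t : E -> E -> E).

Let lJ := Jv_linear S x.
Let JJ u : J (J u) = - u := lh_sq H u Ux.
Let gC u v : g u v = g v u := lh_sym H u v Ux.
Let gJ u v : g (J u) v = - g u (J v) := dot_J_skew H u v Ux.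
Let gJJ u v : g (J u) (J v) = g u v := lh_herm H u v Ux.
Let gp u : u != 0 -> 0 < g u u := fun h => lh_pos H Ux h.
Let gn u : u != 0 -> g u u != 0.
Proof. by move=> /gp /gt_eqF ->. Qed.

Lemma adapted_frame u v w : u != 0 -> v != 0 -> w != 0 ->
  g v u = 0 -> g v (J u) = 0 -> g w u = 0 -> g w (J u) = 0 -> g w v = 0 -> g w (J v) = 0 ->
  orthogonal_frame S x [:: u; J u; v; J v; w; J w].
Proof.
move=> u0 v0 w0 vu vJu wu wJu wv wJv; split => //=; last by rewrite u0 v0 w0 !(J_neq0 H Ux).
have sJ a b : g b (J a) = 0 -> g a (J b) = 0 by move=> e; rewrite gC gJ e oppr0.
rewrite !gJJ !(dot_self_J H Ux) (gC u v) (gC u w) (gC v w) vu wu wv (sJ _ _ vJu) (sJ _ _ wJu).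
by rewrite (sJ _ _ wJv) (gC (J u) v) (gC (J u) w) (gC (J v) w) vJu wJu wJv eqxx.
Qed.

Definition orth_part u X := X - (g X u / g u u) *: u - (g X (J u) / g u u) *: J u.

Lemma orth_partE u X : X = orth_part u X + (g X u / g u u) *: u + (g X (J u) / g u u) *: J u.
Proof. by row_ring. Qed.

Lemma orth_part_l u X : u != 0 -> g (orth_part u X) u = 0.
Proof.
move=> u0; rewrite !dotBl !dotZl (gC (J u) u) (dot_self_J H Ux) mulr0 subr0.
by rewrite divfK ?subrr ?gn.
Qed.

Lemma orth_part_J u X : u != 0 -> g (orth_part u X) (J u) = 0.
Proof.
move=> u0; rewrite !dotBl !dotZl gJJ (dot_self_J H Ux) mulr0 subr0.
by rewrite divfK ?subrr ?gn.
Qed.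

Lemma orth_part_orth u v X : g v u = 0 -> g v (J u) = 0 -> g (orth_part u X) v = g X v.
Proof. by move=> e1 e2; rewrite !dotBl !dotZl !(gC _ v) e1 e2 !mulr0 !subr0. Qed.

Section W1.
Variable t : E -> E -> E.
Hypothesis W1 : in_W1 S x t.

Let W : in_W S x t. Proof. by have [] := W1. Qed.
Let Tr u : linear (t u). Proof. by have [] := W. Qed.
Let Tl v : linear (t^~ v). Proof. by have [_ + _ _] := W; exact. Qed.

Lemma w1_self a : t a a = 0. Proof. by have [_] := W1; exact. Qed.
Lemma w1_Jr a b : t a (J b) = - J (t a b). Proof. exact: in_W_J W. Qed.
Lemma w1_Jl a b : t (J a) b = - J (t a b). Proof. exact: in_W1_j_antilinear W1 _ _. Qed.

Lemma w1_cycle a b c : g (t a b) c = g (t b c) a.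
Proof. by rewrite (in_W1_alt a b W1) dotNl (in_W_skew H Ux b a c W) opprK. Qed.

Lemma w1_selfJ a : t a (J a) = 0.
Proof. by rewrite w1_Jr w1_self (lin0 lJ) oppr0. Qed.
Lemma w1_dot_l a b : g (t a b) a = 0.
Proof. by rewrite (in_W_skew H Ux a b a W) w1_self dot0l oppr0. Qed.
Lemma w1_dot_r a b : g (t a b) b = 0.
Proof. by rewrite w1_cycle w1_self dot0l. Qed.
Lemma w1_dot_Jl a b : g (t a b) (J a) = 0.
Proof. by rewrite (in_W_skew H Ux a b _ W) w1_selfJ dot0l oppr0. Qed.
Lemma w1_dot_Jr a b : g (t a b) (J b) = 0.
Proof. by rewrite w1_cycle w1_selfJ dot0l. Qed.

Lemma w1_comb k l : in_W1 S x (fun a b => k *: t a b + l *: J (t a b)).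
Proof.
split; last by move=> u; rewrite w1_self (lin0 lJ) !scaler0 addr0.
split => [u p a b|v p a b|u v w|u v].
- by rewrite Tr lJ; row_ring.
- by rewrite Tl lJ; row_ring.
- have e1 : g (t u v) w = - g v (t u w) by rewrite (in_W_skew H Ux u v w W) (gC v).
  have e2 : g (J (t u v)) w = - g v (J (t u w)).
    by rewrite gJ (in_W_skew H Ux u v _ W) w1_Jr dotNl opprK (gC v).
  by rewrite !(dotDl, dotDr, dotZl, dotZr) e1 e2; ring.
- by rewrite w1_Jr (linD lJ) !(linZ lJ) (linN lJ) !JJ; row_ring.
Qed.

End W1.

(** Cyclic symmetry carries the value on [(u, v)] to [(w, u)] and [(v, w)], and compatibility with
    [J] gives the rest of the frame: a complex three-form in dimension 3 is determined by one
    value. *)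
Lemma w1_eq t t' u v w : in_W1 S x t -> in_W1 S x t' ->
  orthogonal_frame S x [:: u; J u; v; J v; w; J w] -> t u v = t' u v ->
  forall a b, t a b = t' a b.
Proof.
move=> W1 W1' fr uv.
have sub X Y : (forall c, c \in [:: u; J u; v; J v; w; J w] -> g X c = g Y c) -> X = Y.
  move=> e; apply/eqP; rewrite -subr_eq0; apply/eqP; apply: (frame_complete H Ux fr) => c ci.
  by rewrite dotBl e // subrr.
have alt a b : t a b = t' a b -> t b a = t' b a.
  by rewrite (in_W1_alt a b W1) (in_W1_alt a b W1') => /oppr_inj.
have step p q r :
    (forall a b, (forall c, c \in [:: p; J p; q; J q; r; J r] -> g a c = g b c) -> a = b) ->
    t p q = t' p q -> t r p = t' r p.
  move=> sb pq; apply: sb => c; rewrite !inE => /or4P[/eqP->|/eqP->|/eqP->|/or3P[]/eqP->].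
  - by rewrite (w1_dot_r W1) (w1_dot_r W1').
  - by rewrite (w1_dot_Jr W1) (w1_dot_Jr W1').
  - by rewrite (w1_cycle W1) pq -(w1_cycle W1').
  - by rewrite (w1_cycle W1) (w1_Jr W1) pq -(w1_Jr W1') -(w1_cycle W1').
  - by rewrite (w1_dot_l W1) (w1_dot_l W1').
  - by rewrite (w1_dot_Jl W1) (w1_dot_Jl W1').
have wu : t w u = t' w u by exact: step uv.
have vw : t v w = t' v w.
  apply: (step w u v) => // a b e; apply: sub => c.
  by rewrite !inE => h; apply: e; rewrite !inE; move: h; do 6! case: eqP => //.
have full p : t p u = t' p u -> t p v = t' p v -> t p w = t' p w -> forall b, t p b = t' p b.
  move=> eu ev ew b; apply: sub => c.
  have r d : t p d = t' p d -> g (t p b) d = g (t' p b) d.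
    move=> e; rewrite -(w1_cycle W1 d p b) -(w1_cycle W1' d p b).
    by rewrite (in_W1_alt d p W1) (in_W1_alt d p W1') e.
  have rJ d : t p d = t' p d -> g (t p b) (J d) = g (t' p b) (J d).
    by move=> e; apply: r; rewrite (w1_Jr W1) (w1_Jr W1') e.
  by rewrite !inE => /or4P[/eqP->|/eqP->|/eqP->|/or3P[]/eqP->]; auto.
have fu b : t b u = t' b u.
  by apply: (alt _ _); apply: full => //; [rewrite (w1_self W1) (w1_self W1')|exact: alt].
have fv b : t b v = t' b v.
  by apply: (alt _ _); apply: full => //; rewrite (w1_self W1) (w1_self W1').
have fw b : t b w = t' b w.
  by apply: (alt _ _); apply: full => //; rewrite (w1_self W1) (w1_self W1').
by move=> a b; exact: full.
Qed.

Lemma w1_adapted_frame t u v : in_W1 S x t -> u != 0 -> v != 0 -> g v u = 0 -> g v (J u) = 0 ->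
  t u v != 0 -> orthogonal_frame S x [:: u; J u; v; J v; t u v; J (t u v)].
Proof.
move=> W1 u0 v0 vu vJu w0; apply: adapted_frame => //.
- exact: w1_dot_l. - exact: w1_dot_Jl. - exact: w1_dot_r. - exact: w1_dot_Jr.
Qed.

(** By alternation [t' u v] is orthogonal to the complex lines of [u] and [v], so it lies in that of
    [t u v]; [w1_eq] propagates the two coefficients. *)
Lemma w1_span t t' u v : in_W1 S x t -> in_W1 S x t' ->
  u != 0 -> v != 0 -> g v u = 0 -> g v (J u) = 0 -> t u v != 0 ->
  forall a b, t' a b = (g (t' u v) (t u v) / g (t u v) (t u v)) *: t a b
    + (g (t' u v) (J (t u v)) / g (t u v) (t u v)) *: J (t a b).
Proof.
move=> W1 W1' u0 v0 vu vJu w0; have fr := w1_adapted_frame W1 u0 v0 vu vJu w0.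
apply: (w1_eq W1' (w1_comb W1 _ _) fr); rewrite {1}(frame_expand H Ux (t' u v) fr).
rewrite !big_cons big_nil (w1_dot_l W1') (w1_dot_Jl W1') (w1_dot_r W1') (w1_dot_Jr W1').
by rewrite !mul0r !scale0r !add0r gJJ addr0.
Qed.

(** The real part of [h(a,c) h(b,d) - h(a,d) h(b,c)], for the Hermitian form [h] with real part [g]:
    the inner product of complex bivectors. *)
Definition type_form a b c d := g a c * g b d - g a d * g b c
  - g (J a) c * g (J b) d + g (J a) d * g (J b) c.

Definition w1_type t u v := g (t u v) (t u v) / (g u u * g v v).

Lemma w1_type_pair t u v Z W : in_W1 S x t -> u != 0 -> v != 0 -> g v u = 0 -> g v (J u) = 0 ->
  g (t u v) (t Z W) = w1_type t u v * type_form u v Z W.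
Proof.
move=> W1 u0 v0 vu vJu; rewrite /w1_type; have [[Tr Tl _ _] _] := W1.
have [->|w0] := eqVneq (t u v) 0; first by rewrite !dot0l !mul0r.
have fr := w1_adapted_frame W1 u0 v0 vu vJu w0.
move: fr w0; set w := t u v => fr w0; rewrite gC (w1_cycle W1 Z W w) (w1_cycle W1 W w Z).
have wu : t w u = (g w w / g v v) *: v.
  rewrite [LHS](frame_expand H Ux _ fr) !big_cons big_nil.
  rewrite (w1_dot_l W1) (w1_dot_Jl W1) (w1_dot_r W1) (w1_dot_Jr W1).
  rewrite (w1_cycle W1 w u v) (w1_cycle W1 w u (J v)) (w1_Jr W1) -/w dotNl gC (dot_self_J H Ux).
  by rewrite oppr0 !mul0r !scale0r !add0r !addr0.
have wv : t w v = - ((g w w / g u u) *: u).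
  rewrite (in_W1_alt _ _ W1); congr (- _).
  rewrite [LHS](frame_expand H Ux _ fr) !big_cons big_nil.
  rewrite (w1_dot_l W1) (w1_dot_Jl W1) (w1_dot_r W1) (w1_dot_Jr W1).
  rewrite -(w1_cycle W1 u v w) -(w1_cycle W1 (J u) v w) (w1_Jl W1) -/w dotNl gC (dot_self_J H Ux).
  by rewrite oppr0 !mul0r !scale0r !add0r !addr0.
rewrite {1}(frame_expand H Ux Z fr) !big_cons big_nil addr0 !(linD (Tr w)) !(linZ (Tr w)).
rewrite (w1_self W1) (w1_selfJ W1) !(w1_Jr W1) wu wv (linN lJ) !(linZ lJ) /type_form.
rewrite !gJJ !scaler0 !addr0 !(dotDl, dotNl, dotZl) !(gC Z) !gJ.
by field; rewrite !gn.
Qed.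

(** [w1_type_pair] computes the symmetric quantity [g (t u a) (t u b)] in two ways, as either type
    times [g u u * g a b]; so the types agree when [g a b] is nonzero. Orthogonal [v] and [v'] are
    compared through [v + v']. *)
Lemma w1_type_eq t u v v' : in_W1 S x t -> u != 0 -> v != 0 -> v' != 0 ->
  g v u = 0 -> g v (J u) = 0 -> g v' u = 0 -> g v' (J u) = 0 ->
  w1_type t u v = w1_type t u v'.
Proof.
move=> W1 u0.
have aux a b : a != 0 -> b != 0 -> g a u = 0 -> g a (J u) = 0 -> g b u = 0 -> g b (J u) = 0 ->
    g a b != 0 -> w1_type t u a = w1_type t u b.
  move=> a0 b0 au aJu bu bJu ab.
  have := w1_type_pair u b W1 u0 a0 au aJu; have := w1_type_pair u a W1 u0 b0 bu bJu.
  have Q c d : g c u = 0 -> g c (J u) = 0 -> type_form u c u d = g u u * g c d.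
    move=> cu cJu; have e1 : g (J u) u = 0 by rewrite gC (dot_self_J H Ux).
    by rewrite /type_form cu e1 (gJ c u) cJu; ring.
  rewrite !Q // (gC (t u b)) (gC b) => -> /eqP; rewrite (inj_eq (mulIf _)); first by move/eqP.
  by rewrite mulf_neq0 ?gn.
move=> v0 v'0 vu vJu v'u v'Ju; have [e|e] := eqVneq (g v v') 0; last exact: aux.
have s1 : g v (v + v') != 0 by rewrite dotDr e addr0 gn.
have s2 : g v' (v + v') != 0 by rewrite dotDr (gC v') e add0r gn.
have s0 : v + v' != 0 by apply: contraNneq s1 => ->; rewrite dot0r.
have su : g (v + v') u = 0 by rewrite dotDl vu v'u addr0.
have sJ : g (v + v') (J u) = 0 by rewrite dotDl vJu v'Ju addr0.
by rewrite (aux v (v + v')) // -(aux v' (v + v')).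
Qed.

Lemma w1_type_sym t u v : in_W1 S x t -> w1_type t u v = w1_type t v u.
Proof. by move=> W1; rewrite /w1_type (in_W1_alt v u W1) dotNl dotNr opprK [g u u * _]mulrC. Qed.

(* Gray's constant type condition. *)
Lemma w1_constant_type t : in_W1 S x t ->
  exists mu, forall X Y Z W, g (t X Y) (t Z W) = mu * type_form X Y Z W.
Proof.
move=> W1; have [[Tr Tl _ _] _] := W1.
have [u u0 _] := @exists_orthogonal _ _ S x [::] isT.
have [v v0 vo] := @exists_orthogonal _ _ S x [:: u; J u] isT.
have vu : g v u = 0 by apply: vo; rewrite !inE eqxx.
have vJu : g v (J u) = 0 by apply: vo; rewrite !inE eqxx orbT.
have orthJ a b : g a (J b) = 0 -> g b (J a) = 0 by move=> e; rewrite -[LHS]opprK -gJ gC e oppr0.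
have const X Y : X != 0 -> Y != 0 -> g Y X = 0 -> g Y (J X) = 0 -> w1_type t X Y = w1_type t u v.
  (* Two complex lines do not exhaust six dimensions: a vector [z] orthogonal to those of [X] and
     [u] links the type of [(X, Y)] to that of [(u, v)]. *)
  move=> X0 Y0 YX YJX; have [z z0 zo] := @exists_orthogonal _ _ S x [:: X; J X; u; J u] isT.
  have zX : g z X = 0 by apply: zo; rewrite !inE eqxx.
  have zJX : g z (J X) = 0 by apply: zo; rewrite !inE eqxx !orbT.
  have zu : g z u = 0 by apply: zo; rewrite !inE eqxx !orbT.
  have zJu : g z (J u) = 0 by apply: zo; rewrite !inE eqxx !orbT.
  rewrite (w1_type_eq (v' := z) W1) // (w1_type_sym X z W1).
  rewrite (w1_type_eq (v' := u) W1) //; [|by rewrite gC|exact: orthJ|by rewrite gC|exact: orthJ].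
  by rewrite w1_type_sym // (w1_type_eq (v' := v) W1).
exists (w1_type t u v) => X Y Z W.
have [->|X0] := eqVneq X 0.
  by rewrite (lin0 (Tl _)) /type_form (lin0 lJ) !dot0l; ring.
set Y' := orth_part X Y.
have -> : t X Y = t X Y'.
  rewrite {1}(orth_partE X Y) !(linD (Tr X)) !(linZ (Tr X)) (w1_self W1) (w1_selfJ W1).
  by rewrite !scaler0 !addr0.
have -> : type_form X Y Z W = type_form X Y' Z W.
  rewrite /type_form {1 2 3 4}(orth_partE X Y) -/Y' !(linD lJ) !(linZ lJ) JJ !(dotDl, dotZl, dotNl).
  ring.
have YX : g Y' X = 0 by exact: orth_part_l.
have YJX : g Y' (J X) = 0 by exact: orth_part_J.
have [->|Y0] := eqVneq Y' 0.
  by rewrite (lin0 (Tr _)) /type_form (lin0 lJ) !dot0l; ring.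
by rewrite -(const X Y') // w1_type_pair.
Qed.

(* Complex dimension 3 leaves no room for forms of type (4,0). *)
Lemma form40_dim6 (F : E -> E -> E -> E -> R) :
  (forall b c d, scalar (fun a => F a b c d)) ->
  (forall a b c d, F b a c d = - F a b c d) -> (forall a b c d, F a c b d = - F a b c d) ->
  (forall a b c d, F a b d c = - F a b c d) ->
  (forall a b c d, F (J a) (J b) c d = - F a b c d) ->
  forall a b c d, F a b c d = 0.
Proof.
move=> l1 s12 s23 s34 FJ a b c d.
have l2 p q r : scalar (fun c => F p c q r).
  by move=> k y z; rewrite !(s12 _ p) l1; ring.
have l3 p q r : scalar (fun c => F p q c r).
  by move=> k y z; rewrite !(s23 p _ q) l2; ring.
have l4 p q r : scalar (F p q r).
  by move=> k y z; rewrite !(s34 p q _ r) l3; ring.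
have z12 p q r : F p p q r = 0 by have := s12 p p q r => h; lra.
have j12 p q r : F p (J p) q r = 0.
  have := FJ p (J p) q r; rewrite JJ.
  have -> : F (J p) (- p) q r = F p (J p) q r by rewrite s12 (scaN (l1 _ _ _)) opprK.
  by move=> h; lra.
have z14 p q r : F p q r p = 0 by rewrite s34 s23 z12 !oppr0.
have j14 p q r : F p q r (J p) = 0 by rewrite s34 s23 j12 !oppr0.
have z24 p q r : F q p r p = 0 by rewrite s12 z14 oppr0.
have j24 p q r : F q p r (J p) = 0 by rewrite s12 j14 oppr0.
have z34 p q r : F q r p p = 0 by rewrite s23 z24 oppr0.
have j34 p q r : F q r p (J p) = 0 by rewrite s23 j24 oppr0.
have [->|a0] := eqVneq a 0; first exact: sca0 (l1 _ _ _).
pose b' := orth_part a b.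
have -> : F a b c d = F a b' c d.
  by rewrite {1}(orth_partE a b) !(scaD (l2 _ _ _)) !(scaZ (l2 _ _ _)) j12 z12 -/b' !mulr0 !addr0.
have ba : g b' a = 0 by exact: orth_part_l.
have bJa : g b' (J a) = 0 by exact: orth_part_J.
have [->|b0] := eqVneq b' 0; first by rewrite s12 (sca0 (l1 _ _ _)) oppr0.
pose c' := orth_part b' (orth_part a c).
have -> : F a b' c d = F a b' c' d.
  rewrite s34 [RHS]s34; congr (- _).
  by rewrite {1}(orth_partE a c) {1}(orth_partE b' (orth_part a c)) -/c' !(scaD (l4 _ _ _))
    !(scaZ (l4 _ _ _)) z14 j14 z24 j24 !mulr0 !addr0.
have ab : g a b' = 0 by rewrite gC.
have aJb : g a (J b') = 0 by rewrite gC gJ bJa oppr0.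
have JaJb : g (J a) (J b') = 0 by rewrite gJJ.
have Jab : g (J a) b' = 0 by rewrite gC.
have cb : g c' b' = 0 by exact: orth_part_l.
have cJb : g c' (J b') = 0 by exact: orth_part_J.
have ca : g c' a = 0 by rewrite orth_part_orth // orth_part_l.
have cJa : g c' (J a) = 0 by rewrite orth_part_orth // orth_part_J.
have [->|c0] := eqVneq c' 0; first by rewrite s34 (sca0 (l4 _ _ _)) oppr0.
have fr := adapted_frame a0 b0 c0 ba bJa ca cJa cb cJb.
rewrite (frame_expand H Ux d fr) !big_cons big_nil addr0 !(scaD (l4 _ _ _)) !(scaZ (l4 _ _ _)).
by rewrite z14 j14 z24 j24 z34 j34 !mulr0 !addr0.
Qed.

(** * The Bianchi identity for a derivative along the complex line W1 *)

Section WeylBianchi.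
Variables (r A D : E -> E -> E -> E) (t : E -> E -> E) (al be : E -> R).
Hypothesis rB : forall u v w, r u v w + r v w u + r w u v = 0.
Hypothesis rJ : forall u v w, r u v (J w) - J (r u v w) = - (2 *: J (A u v w)).
Hypothesis W1 : in_W1 S x t.
Hypothesis AE : forall u v w, A u v w = D u v w - D v u w + t (t u v - t v u) w.
Hypothesis DE : forall X u v, D X u v = al X *: t u v + be X *: J (t u v).
Hypothesis lal : scalar al.
Hypothesis lbe : scalar be.

(* The terms of A that are quadratic in t cancel in e. *)
Let e X Y Z := A X Y Z - A (J X) (J Y) Z + J (A (J X) Y Z) + J (A X (J Y) Z).
Let q X Y Z := (al X - be (J X)) *: t Y Z + (be X + al (J X)) *: J (t Y Z).

(** By [rJ] the defect is half of [r + J r J], and the cyclic sum of [e] becomes a combination of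
    eight Bianchi sums, four of them with [J] applied. *)
Lemma defect_cycle X Y Z : e X Y Z + e Y Z X + e Z X Y = 0.
Proof.
have A2 u v w : A u v w = 2^-1 *: (r u v w + J (r u v (J w))).
  have := congr1 J (rJ u v w); rewrite (linB lJ) (linN lJ) (linZ lJ) !JJ opprK scalerN opprK => h.
  by apply/rowP => i; move/rowP: h => /(_ i); rewrite !mxE => h; lra.
rewrite /e !A2 !(linZ lJ) !(linD lJ) !JJ.
have B1 := rB X Y Z.
have B2 := rB (J X) (J Y) Z; have B3 := rB (J Y) (J Z) X; have B4 := rB (J Z) (J X) Y.
have B5 := congr1 J (rB X Y (J Z)); have B6 := congr1 J (rB Y Z (J X)).
have B7 := congr1 J (rB Z X (J Y)); have B8 := congr1 J (rB (J X) (J Y) (J Z)).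
rewrite !(linD lJ) (lin0 lJ) in B5 B6 B7 B8.
apply/rowP => i; move/rowP: B1 => /(_ i); move/rowP: B2 => /(_ i); move/rowP: B3 => /(_ i).
move/rowP: B4 => /(_ i); move/rowP: B5 => /(_ i); move/rowP: B6 => /(_ i).
move/rowP: B7 => /(_ i); move/rowP: B8 => /(_ i); rewrite !mxE; lra.
Qed.

Lemma defect_w1 X Y Z : e X Y Z = 2 *: (q X Y Z - q Y X Z).
Proof.
have [[Tr Tl _ _] _] := W1; rewrite /e !AE !DE.
have tt a b : t a b - t b a = 2 *: t a b.
  by rewrite (in_W1_alt b a W1) opprK scaler_nat.
rewrite !tt !(linZ (Tl _)) !(w1_Jl W1) !(linN (Tl _)) !(w1_Jl W1) !(w1_Jr W1)
  ?(linN (Tl _)) ?(w1_Jl W1).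
rewrite /q !(linD lJ, linN lJ, linZ lJ, JJ).
by row_ring.
Qed.

Lemma w1_derivative_cycle X Y Z : q X Y Z + q Y Z X + q Z X Y = 0.
Proof.
have := defect_cycle X Y Z; rewrite !defect_w1 /q.
rewrite (in_W1_alt X Z W1) (in_W1_alt Y X W1) (in_W1_alt Z Y W1) !(linN lJ) => h.
by apply/rowP => i; move/rowP: h => /(_ i); rewrite !mxE => h; lra.
Qed.

Lemma w1_derivative_type a b : t a b != 0 -> forall X, be X = - al (J X).
Proof.
move=> tab; have [mu muE] := w1_constant_type W1.
have mu0 : mu != 0.
  by apply: contraTneq (gn tab) => m0; rewrite muE m0 mul0r eqxx.
suff key X : al X = be (J X) by move=> X; rewrite key JJ (scaN lbe) opprK.
have [->|X0] := eqVneq X 0; first by rewrite (sca0 lal) (lin0 lJ) (sca0 lbe).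
have [v v0 vo] := @exists_orthogonal _ _ S x [:: X; J X] isT.
have vX : g v X = 0 by apply: vo; rewrite !inE eqxx.
have vJX : g v (J X) = 0 by apply: vo; rewrite !inE eqxx orbT.
have w0 : g (t X v) (t X v) != 0.
  rewrite muE /type_form vX (dot_J_skew H X X Ux) (dot_self_J H Ux) (gC (J X) v) vJX.
  rewrite oppr0 !mulr0 !mul0r !subr0 addr0.
  by rewrite !mulf_neq0 ?gn.
(* Paired with [X], the last two terms of the cycle vanish since [t] with an argument [X] is
   orthogonal to [X] and [J X]; the first leaves [al X - be (J X)] times the squared length of
   [t X v]. *)
have := congr1 (g^~ X) (w1_derivative_cycle X v (t X v)).
rewrite /q !(dotDl, dotZl) dot0l !(dot_J_skew H (t _ _) X Ux).
rewrite (w1_dot_r W1) (w1_dot_l W1) (w1_dot_Jr W1) (w1_dot_Jl W1).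
rewrite -(w1_cycle W1 X v (t X v)) -(w1_cycle W1 (J X) v (t X v)) (w1_Jl W1) dotNl.
rewrite (gC (J _)) (dot_self_J H Ux) => h.
have : (al X - be (J X)) * g (t X v) (t X v) = 0 by lra.
by move/eqP; rewrite mulf_eq0 (negbTE w0) orbF subr_eq0 => /eqP.
Qed.

End WeylBianchi.

End Dimension6.

(* This torsion-free connection absorbs the W4 part of the torsion: see [weyl_torsion]. *)
HB.lock Definition weyl_con (R : realType) (n : nat) (S : local_structure R (2 * n))
    (x u v : 'rV[R]_(2 * n)) : 'rV[R]_(2 * n) :=
  levi_civita S x u v
  - 2^-1 *: (lee_form S x u *: v + lee_form S x v *: u
             - dot S x u v *: sharp S x (lee_form S x)).

(** * The Weyl connection of the Lee form *)

Section WeylConnection.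
Context {R : realType} {n : nat} (S : local_structure R (2 * n)) (U : set 'rV[R]_(2 * n)).
Hypothesis H : local_hermitian S U.
Hypothesis n2 : (2 <= n)%N.
Local Notation E := 'rV[R]_(2 * n).
Local Notation g := (dot S).
Local Notation J := (Jv S).
Local Notation G := (levi_civita S).
Local Notation W := (weyl_con S).
Local Notation th := (lee_form S).
Local Notation eta := (minimal_torsion J W).
Local Notation K := (minimal_con J W).
Implicit Types (x u v w z : E).
Let oU := lh_open H.

Lemma weyl_conE x u v : W x u v = G x u v
  - 2^-1 *: (th x u *: v + th x v *: u - g x u v *: sharp S x (th x)).
Proof. by rewrite weyl_con.unlock. Qed.

Lemma smooth_sharp_lee : smooth_field U (fun y => sharp S y (th y)).
Proof.
apply: (smooth_field_dot H) => v; apply: (smooth_eq oU _ (lee_smooth H n2 v)) => y Uy.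
by rewrite (dot_sharp H) //; exact: (lee_scalar H n2 Uy).
Qed.

Lemma weyl_con_bilinear : bilinear_field U W.
Proof.
apply: (bilinear_field_eq oU (fun y u v _ => esym (weyl_conE y u v))).
apply: bilinear_fieldB => //; first exact: levi_civita_bilinear H.
apply: bilinear_fieldZ => //; split => [y u Uy a v w|y v Uy a u w|u v].
- rewrite (lee_scalar H n2 Uy) dot_linearr; row_ring.
- rewrite (lee_scalar H n2 Uy) dot_linearl; row_ring.
- apply: fieldB => //; last by apply: fieldZ => //; [exact: smooth_dot_cst|exact: smooth_sharp_lee].
  by apply: fieldD => //; apply: fieldZ => //;
    first [exact: lee_smooth|exact: field_cst].
Qed.

Lemma weyl_conC x u v : U x -> W x u v = W x v u.
Proof.
move=> Ux; rewrite !weyl_conE (levi_civitaC H) // (lh_sym H u) //.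
by rewrite (addrC (th x u *: v)).
Qed.

Lemma weyl_con_metric x u v w : U x ->
  'D_u (fun y => g y v w) x = g x (W x u v) w + g x v (W x u w) + th x u * g x v w.
Proof.
move=> Ux; rewrite (levi_civita_metric H) // !weyl_conE !(dotDl, dotDr, dotNl, dotNr, dotZl, dotZr).
have lt := lee_scalar H n2 Ux.
rewrite (lh_sym H v (sharp _ _ _) Ux) !(dot_sharp H) // (lh_sym H v u Ux).
by field.
Qed.

(** The correction [th u *: v] commutes with [J] and drops out of the minimal torsion; the other two
    correction terms contribute exactly minus the W4 tensor of the Lee form. *)
Lemma weyl_torsion x t u v : U x -> w4_eq S x (th x) t ->
  eta x u v = minimal_torsion J G x u v - t u v.
Proof.
move=> Ux e; have lJ := Jv_linear S x; have JJ a := lh_sq H a Ux.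
have -> : t u v = 4^-1 *: (4 *: t u v) by rewrite scalerA mulVf ?scale1r ?pnatr_eq0.
rewrite e !minimal_torsionE !weyl_conE.
rewrite !(linD lJ, linN lJ, linZ lJ, JJ) (dot_J_skew H u v Ux).
by abstract_derive; apply/rowP => i; rewrite !mxE; field.
Qed.

Hypothesis Weta : forall y, U y -> in_W1 S y (eta y).

Lemma weyl_eta_bilinear : bilinear_field U eta.
Proof. exact: minimal_torsion_bilinear (J_linear_field H) weyl_con_bilinear. Qed.

Lemma weyl_min_bilinear : bilinear_field U K.
Proof. exact: minimal_con_bilinear (J_linear_field H) weyl_con_bilinear. Qed.

Lemma weyl_min_metric x u v w : U x ->
  'D_u (fun y => g y v w) x = g x (K x u v) w + g x v (K x u w) + th x u * g x v w.
Proof.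
move=> Ux; rewrite weyl_con_metric // !minimal_conE dotDl dotDr.
have [[_ _ sk _] _] := Weta Ux; rewrite sk; ring.
Qed.

Lemma weyl_derive_J x u v : U x -> 'D_u (fun y => J y v) x = J x (K x u v) - K x u (J x v).
Proof.
by move=> Ux; apply: (derive_J_con oU (J_linear_field H) _ weyl_con_bilinear) => //; exact: lh_sq H.
Qed.

Lemma in_W1_weyl_cov x u : U x -> in_W1 S x (cov_tensor K eta x u).
Proof.
exact: (in_W1_cov H weyl_min_bilinear weyl_min_metric weyl_derive_J weyl_eta_bilinear u Weta).
Qed.

End WeylConnection.

(** * The normalised three-form and its exterior derivative *)

Section ExteriorDerivative.
Context {R : realType} (S : local_structure R (2 * 3)) (U : set 'rV[R]_(2 * 3)).
Hypothesis H : local_hermitian S U.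
Local Notation E := 'rV[R]_(2 * 3).
Local Notation g := (dot S).
Local Notation J := (Jv S).
Local Notation W := (weyl_con S).
Local Notation th := (lee_form S).
Local Notation eta := (minimal_torsion J W).
Local Notation K := (minimal_con J W).
Implicit Types (x y u v w z a b c d X : E).
Let oU := lh_open H.
Let n2 : (2 <= 3)%N := isT.
Hypothesis Weta : forall y, U y -> in_W1 S y (eta y).
Variables p q : E.
Hypothesis nz : forall y, U y -> eta y p q != 0.

(** This is the opposite of [kahler]. *)
Let om y a b := g y (J y a) b.
Let psi y a b c := g y (eta y a b) c.

Lemma w1_pair x (t : E -> E -> E) a b : U x -> in_W1 S x t -> t a b != 0 ->
  exists u v, [/\ u != 0, v != 0, g x v u = 0, g x v (J x u) = 0 & t u v != 0].
Proof.
move=> Ux W1 tab; have [[Tr Tl _ _] _] := W1.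
have a0 : a != 0 by apply: contraNneq tab => ->; rewrite (lin0 (Tl b)).
have tE : t a b = t a (orth_part S x a b).
  rewrite {1}(orth_partE S x a b) !(linD (Tr a)) !(linZ (Tr a)) (w1_self W1) (w1_selfJ W1).
  by rewrite !scaler0 !addr0.
exists a, (orth_part S x a b); rewrite -tE; split => //.
- by apply: contraNneq tab; rewrite tE => ->; rewrite (lin0 (Tr a)).
- exact: (orth_part_l H Ux).
- exact: (orth_part_J H Ux).
Qed.

Lemma weyl_cov_type x : U x -> exists2 al : E -> R, scalar al &
  forall X u v, cov_tensor K eta x X u v = al X *: eta x u v - al (J x X) *: J x (eta x u v).
Proof.
move=> Ux; have W1 := Weta Ux.
have [u [v [u0 v0 vu vJu w0]]] := w1_pair Ux W1 (nz Ux).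
pose D := cov_tensor K eta x; pose w := eta x u v.
pose al X := g x (D X u v) w / g x w w; pose be X := g x (D X u v) (J x w) / g x w w.
have [_ _ DL] := cov_tensor_linear oU (weyl_min_bilinear H n2) (weyl_eta_bilinear H n2) Ux.
have lal : scalar al.
  by move=> k X Y; rewrite /al /D (DL u v) dot_linearl mulrDl mulrA.
have lbe : scalar be.
  by move=> k X Y; rewrite /be /D (DL u v) dot_linearl mulrDl mulrA.
have DE X a b : D X a b = al X *: eta x a b + be X *: J x (eta x a b).
  exact: (w1_span H Ux W1 (in_W1_weyl_cov H n2 Weta X Ux) u0 v0 vu vJu w0).
have rB a b c : riem W x a b c + riem W x b c a + riem W x c a b = 0.
  by apply: (riem_bianchi oU) => // y ? ? Uy; exact: (weyl_conC H).
have rJ a b c : riem W x a b (J x c) - J x (riem W x a b c) =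
    - (2 *: J x (riem_defect J W x a b c)).
  apply: (ricci_identity_J oU (J_linear_field H) _ (weyl_con_bilinear H n2)) => //.
    by move=> y e Uy; exact: (lh_sq H e Uy).
  by move=> y d e Uy; exact: (weyl_conC H).
have AE a b c := riem_defectE J W x a b c.
have beE := w1_derivative_type H Ux rB rJ W1 AE DE lal lbe w0.
by exists al => // X a b; rewrite -/D DE beE scaleNr.
Qed.

Let psi_smooth a b c : smooth U (fun y => psi y a b c).
Proof.
have [_ _ Se] := weyl_eta_bilinear H n2.
by apply: (smooth_dot H) => //; exact: field_cst.
Qed.

Let om_smooth a b : smooth U (fun y => om y a b).
Proof.
have [_ SJ] := J_linear_field H.
by apply: (smooth_dot H) => //; exact: field_cst.
Qed.

Lemma derive_om x X a b : U x ->
  'D_X (fun y => om y a b) x = om x (K x X a) b + om x a (K x X b) + th x X * om x a b.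
Proof.
move=> Ux; have [_ SJ] := J_linear_field H.
rewrite /om (derive_dot_con H (weyl_min_metric H n2 Weta) X (SJ a) (field_cst oU b) Ux)
  derive_cst add0r.
by rewrite (weyl_derive_J H n2) // subrK.
Qed.

Lemma derive_psi x (al : E -> R) X a b c : U x ->
  (forall X u v, cov_tensor K eta x X u v = al X *: eta x u v - al (J x X) *: J x (eta x u v)) ->
  'D_X (fun y => psi y a b c) x = (al X + th x X) * psi x a b c + al (J x X) * psi x (J x a) b c
    + (psi x (K x X a) b c + psi x a (K x X b) c + psi x a b (K x X c)).
Proof.
move=> Ux DE; have [_ _ Se] := weyl_eta_bilinear H n2.
rewrite /psi (derive_dot_con H (weyl_min_metric H n2 Weta) X (Se a b) (field_cst oU c) Ux)
  derive_cst add0r.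
rewrite (derive_cov_tensor K) DE (w1_Jl (Weta Ux)) !(dotDl, dotNl, dotZl) /cst; ring.
Qed.

Let Dn y := type_form S y p q p q.
Let N y := g y (eta y p q) (eta y p q).
(** [w1_constant_type] gives a constant at each point separately; computing it on the fixed pair
    [(p, q)] exhibits it as a smooth function. *)
Definition type_constant y := N y / Dn y.
Local Notation mu := type_constant.

Let N0 y : U y -> N y != 0.
Proof. by move=> Uy; rewrite gt_eqF // (lh_pos H Uy) // nz. Qed.

Lemma type_constantE y a b c d : U y ->
  g y (eta y a b) (eta y c d) = mu y * type_form S y a b c d.
Proof.
move=> Uy; have [m mE] := w1_constant_type H Uy (Weta Uy).
have := N0 Uy; rewrite /mu /N mE -/(Dn y) mulf_eq0 negb_or => /andP[_ D0].
by rewrite mulfK.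
Qed.

Let D0 y : U y -> Dn y != 0.
Proof.
move=> Uy; have := N0 Uy; rewrite /N type_constantE // mulf_eq0 negb_or => /andP[_]; exact.
Qed.

Lemma type_constant_neq0 y : U y -> mu y != 0.
Proof.
move=> Uy; have := N0 Uy; rewrite /N type_constantE // mulf_eq0 negb_or => /andP[]; exact.
Qed.

Let DnE y : U y -> Dn y = g y p p * g y q q - g y p q * g y p q - om y p q * om y p q.
Proof.
move=> Uy; rewrite /Dn /type_form -!/(om y _ _) (lh_sym H q p Uy).
have e : om y q p = - om y p q.
  by rewrite /om (dot_J_skew H) // (lh_sym H q _ Uy).
have e0 : om y p p = 0 by rewrite /om (lh_sym H) // (dot_self_J H Uy).
by rewrite e e0; ring.
Qed.

Let Dn_smooth : smooth U Dn.
Proof.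
apply: (smooth_eq oU (fun y Uy => esym (DnE Uy))).
have sg a b := smooth_dot_cst H a b.
by apply: smoothB => //; [apply: smoothB => //|]; apply: smoothM.
Qed.

Let N_smooth : smooth U N.
Proof. by have [_ _ Se] := weyl_eta_bilinear H n2; apply: (smooth_dot H). Qed.

Lemma type_constant_smooth : smooth U mu.
Proof. by apply: smoothM => //; apply: smoothV. Qed.

(** In [N = mu * Dn] the metric in [N] contributes [th], the two metric factors of [Dn] contribute
    [2 th], and [eta] contributes [2 al], its component along [J eta] being orthogonal to [eta]. *)
Lemma derive_type_constant x (al : E -> R) X : U x ->
  (forall X u v, cov_tensor K eta x X u v = al X *: eta x u v - al (J x X) *: J x (eta x u v)) ->
  'D_X mu x = (2 * al X - th x X) * mu x.
Proof.
move=> Ux DE; have [_ _ Se] := weyl_eta_bilinear H n2.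
have eN : 'D_X N x = (2 * al X + th x X) * N x
   + 2 * mu x * (type_form S x (K x X p) q p q + type_form S x p (K x X q) p q).
  rewrite /N (derive_dot_con H (weyl_min_metric H n2 Weta) X (Se p q) (Se p q) Ux)
    (derive_cov_tensor K) DE.
  have -> : al X *: eta x p q - al (J x X) *: J x (eta x p q) - K x X (eta x p q)
      + eta x (K x X p) q + eta x p (K x X q) + K x X (eta x p q) =
    al X *: eta x p q - al (J x X) *: J x (eta x p q) + eta x (K x X p) q + eta x p (K x X q).
    by row_ring.
  have eQ a b : mu x * type_form S x a b p q = g x (eta x a b) (eta x p q).
    by rewrite type_constantE.
  rewrite -mulrA mulrDr !eQ !(dotDl, dotDr, dotNl, dotNr, dotZl, dotZr).
  rewrite (lh_sym H (J x _) _ Ux) (dot_self_J H Ux).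
  rewrite (lh_sym H _ (eta x (K x X p) q) Ux) (lh_sym H _ (eta x p (K x X q)) Ux); ring.
have eD : 'D_X Dn x = 2 * (type_form S x (K x X p) q p q + type_form S x p (K x X q) p q)
    + 2 * th x X * Dn x.
  have sg a b := smooth_dot_cst H a b.
  rewrite (derive_eq_on oU X (fun y Uy => DnE Uy) Ux).
  rewrite (sderiveB oU) ?(sderiveB oU) ?(sderiveM oU) //;
    try by repeat first [apply: smoothB => //|apply: smoothM => //].
  rewrite !(weyl_min_metric H n2 Weta) // !derive_om // DnE // /type_form -!/(om x _ _).
  have gC a b : g x a b = g x b a := lh_sym H a b Ux.
  have oC a b : om x a b = - om x b a by rewrite /om (dot_J_skew H) // (gC a).
  have o0 a : om x a a = 0 by have := oC a a => h; lra.
  rewrite (gC p (K x X p)) (gC q (K x X q)) (gC p (K x X q)) (gC q p).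
  by rewrite !o0 (oC q p) (oC p (K x X q)); ring.
have e : 'D_X N x = 'D_X mu x * Dn x + mu x * 'D_X Dn x.
  rewrite -(sderiveM oU) //; last exact: type_constant_smooth.
  by apply: (derive_eq_on oU) Ux => y Uy; rewrite /mu divfK // D0.
apply: (mulIf (D0 Ux)); move: e; rewrite eN eD.
have -> : N x = mu x * Dn x by rewrite /mu divfK // D0.
move: ('D_X mu x) => dm e; lra.
Qed.

(** Dividing by [mu] turns the coefficient [al X] of the derivative of [psi] into [- al X]. With
    this sign the terms in the unknown [al] alternate to a form of type (4,0)+(0,4), which is 0
    here. *)
Let phi y a b c := (mu y)^-1 * psi y a b c.

Let phi_smooth a b c : smooth U (fun y => phi y a b c).
Proof.
apply: smoothM => //; apply: smoothV => //; [exact: type_constant_neq0|exact: type_constant_smooth].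
Qed.

Lemma derive_phi x (al : E -> R) X a b c : U x ->
  (forall X u v, cov_tensor K eta x X u v = al X *: eta x u v - al (J x X) *: J x (eta x u v)) ->
  'D_X (fun y => phi y a b c) x = (mu x)^-1 * ((2 * th x X - al X) * psi x a b c
    + al (J x X) * psi x (J x a) b c
    + (psi x (K x X a) b c + psi x a (K x X b) c + psi x a b (K x X c))).
Proof.
move=> Ux DE; have m0 := type_constant_neq0 Ux.
have e : 'D_X (fun y => psi y a b c) x =
    'D_X mu x * phi x a b c + mu x * 'D_X (fun y => phi y a b c) x.
  rewrite -(sderiveM oU) //; last exact: type_constant_smooth.
  by apply: (derive_eq_on oU) Ux => y Uy; rewrite /phi mulVKf // type_constant_neq0.
move: e; rewrite (derive_psi X a b c Ux DE) (derive_type_constant X Ux DE).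
have : psi x a b c = mu x * phi x a b c by rewrite /phi mulVKf.
move=> pE; move: ('D_X (fun y => phi y a b c) x) => dp e; apply: (mulfI m0); rewrite mulVKf //.
by move: (phi x a b c) pE e => ph -> e; lra.
Qed.

(** The left side is [d phi] on constant fields. As [omega /\ omega] evaluates to twice the last
    parenthesis, the coefficient 8 is that of [4 omega /\ omega]. *)
Lemma dphi x a b c d : U x ->
  'D_a (fun y => phi y b c d) x - 'D_b (fun y => phi y a c d) x
  + 'D_c (fun y => phi y a b d) x - 'D_d (fun y => phi y a b c) x =
  2 * (th x a * phi x b c d - th x b * phi x a c d + th x c * phi x a b d - th x d * phi x a b c)
  + 8 * (om x a b * om x c d - om x a c * om x b d + om x a d * om x b c).
Proof.
move=> Ux; have [al lal DE] := weyl_cov_type Ux.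
have W1 := Weta Ux; have [[Tr Tl _ _] _] := W1; have lJ := Jv_linear S x.
have JJ e : J x (J x e) = - e := lh_sq H e Ux.
have pC y e f : psi x y e f = psi x e f y by exact: (w1_cycle H Ux W1).
have pS y e f : psi x e y f = - psi x y e f by rewrite /psi (in_W1_alt e y W1) dotNl.
have pS' y e f : psi x y f e = - psi x y e f by rewrite (pC y f e) (pS e f y) -(pC y e f).
have pJ y e f : psi x y (J x e) f = psi x (J x y) e f by rewrite /psi (w1_Jr W1) (w1_Jl W1).
have pJ' y e f : psi x y e (J x f) = psi x (J x y) e f by rewrite -pC -pJ pC.
have hS y e f : psi x (J x e) y f = - psi x (J x y) e f by rewrite pS pJ.
have p1 e f : scalar (fun y => psi x y e f) by move=> k y z; rewrite /psi (Tl e) dot_linearl.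
pose w3 X y e f := al X * psi x y e f - al (J x X) * psi x (J x y) e f.
have w30 : w3 a b c d - w3 b a c d + w3 c a b d - w3 d a b c = 0.
  apply: (form40_dim6 H Ux (F := fun a b c d => w3 a b c d - w3 b a c d + w3 c a b d - w3 d a b c)).
  - by move=> b' c' d' k y z; rewrite /w3 !lJ !lal !p1; ring.
  - by move=> a' b' c' d'; rewrite /w3 !(pS a' b') !(hS a' b'); ring.
  - by move=> a' b' c' d'; rewrite /w3 !(pS b' c') !(hS b' c') !(pS' _ b' c'); ring.
  - by move=> a' b' c' d'; rewrite /w3 !(pS' _ c' d'); ring.
  - move=> a' b' c' d'; rewrite /w3 !pJ !JJ !(linN lJ) !(scaN (p1 _ _)) !(scaN lal); ring.
(* The torsion of [K] is [2 eta], and [type_constantE] turns [psi] of it into products of metric and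
   [om] terms: this is the source of [omega /\ omega]. *)
have pK y z e f : psi x (K x y z) e f - psi x (K x z y) e f = 2 * (mu x * type_form S x e f y z).
  have -> : K x y z = K x z y + 2 *: eta x y z.
    rewrite !minimal_conE (weyl_conC H z y Ux) (in_W1_alt z y W1).
    by row_ring.
  by rewrite (scaD (p1 e f)) (scaZ (p1 e f)) addrAC subrr add0r pC -type_constantE.
have Kform : psi x (K x a b) c d + psi x b (K x a c) d + psi x b c (K x a d)
    - (psi x (K x b a) c d + psi x a (K x b c) d + psi x a c (K x b d))
    + (psi x (K x c a) b d + psi x a (K x c b) d + psi x a b (K x c d))
    - (psi x (K x d a) b c + psi x a (K x d b) c + psi x a b (K x d c))
    = 8 * mu x * (om x a b * om x c d - om x a c * om x b d + om x a d * om x b c).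
  rewrite (pS (K x a c) b d) (pS (K x b c) a d) (pS (K x c b) a d) (pS (K x d b) a c).
  rewrite -(pC (K x a d) b c) -(pC (K x b d) a c) -(pC (K x c d) a b) -(pC (K x d c) a b).
  have h1 := pK a b c d; have h2 := pK a c b d; have h3 := pK a d b c.
  have h4 := pK b c a d; have h5 := pK b d a c; have h6 := pK c d a b.
  have gC e f : g x e f = g x f e := lh_sym H e f Ux.
  have oC e f : om x e f = - om x f e by rewrite /om (dot_J_skew H) // (gC e).
  move: h1 h2 h3 h4 h5 h6; rewrite /type_form -!/(om x _ _).
  rewrite (gC d a) (gC d b) (gC d c) (gC c b) (gC c a) (gC b a)
    (oC d a) (oC d b) (oC d c) (oC c b) (oC c a) (oC b a).
  move=> *; lra.
rewrite !(derive_phi _ _ _ _ Ux DE).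
transitivity ((mu x)^-1 * (2 * (th x a * psi x b c d - th x b * psi x a c d + th x c * psi x a b d
    - th x d * psi x a b c) - (w3 a b c d - w3 b a c d + w3 c a b d - w3 d a b c)
  + (8 * mu x * (om x a b * om x c d - om x a c * om x b d + om x a d * om x b c)))).
  by rewrite -Kform /w3; ring.
by rewrite w30 /phi; field; exact: type_constant_neq0.
Qed.

(** The torsion [2 eta] of [K] enters three times, with equal contributions because
    [g (J eta a b) c] is alternating; hence the coefficient 6. *)
Lemma dom x a b c : U x ->
  'D_a (fun y => om y b c) x - 'D_b (fun y => om y a c) x + 'D_c (fun y => om y a b) x =
  th x a * om x b c - th x b * om x a c + th x c * om x a b + 6 * g x (J x (eta x a b)) c.
Proof.
move=> Ux; rewrite !derive_om //; have W1 := Weta Ux; have lJ := Jv_linear S x.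
have o1 e : scalar (fun y => om x y e) by move=> k y z; rewrite /om lJ dot_linearl.
have gC e f : g x e f = g x f e := lh_sym H e f Ux.
have oC e f : om x e f = - om x f e by rewrite /om (dot_J_skew H) // (gC e).
have oK y z e : om x (K x y z) e = om x (K x z y) e + 2 * om x (eta x y z) e.
  rewrite -(scaZ (o1 e)) -(scaD (o1 e)); congr (om x _ e).
  rewrite !minimal_conE (weyl_conC H z y Ux) (in_W1_alt z y W1).
  by row_ring.
have ch y z e : om x (eta x y z) e = om x (eta x z e) y.
  rewrite /om -[J x (eta x y z)]opprK -(w1_Jl W1) dotNl (w1_cycle H Ux W1 (J x y) z e).
  by rewrite (dot_J_skew H).
have h1 := oK a b c; have h2 := oK a c b; have h3 := oK b c a.
have c1 := ch a b c; have c2 := ch b c a.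
have c3 : om x (eta x a c) b = - om x (eta x c a) b.
  by rewrite -(scaN (o1 b)) -(in_W1_alt a c W1).
have s1 := oC b (K x a c); have s2 := oC a (K x b c); have s3 := oC a (K x c b).
rewrite -/(om x (eta x a b) c) s1 s2 s3; lra.
Qed.

Let F y a b c d := 2 * (th y a * phi y b c d - th y b * phi y a c d
    + th y c * phi y a b d - th y d * phi y a b c)
  + 8 * (om y a b * om y c d - om y a c * om y b d + om y a d * om y b c).

(** [F] being the value of [d phi], this is [d d phi = 0]: the twenty second derivatives of [phi]
    cancel in pairs. *)
Lemma ddphi x a b c d e : U x ->
  'D_a (fun y => F y b c d e) x - 'D_b (fun y => F y a c d e) x + 'D_c (fun y => F y a b d e) x
  - 'D_d (fun y => F y a b c e) x + 'D_e (fun y => F y a b c d) x = 0.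
Proof.
move=> Ux.
have [dd ddE] : exists dd : E -> E -> E -> E -> E -> R, forall X Y c d e,
    'D_X ('D_Y (fun y => phi y c d e)) x = dd X Y c d e.
  by exists (fun X Y c d e => 'D_X ('D_Y (fun y => phi y c d e)) x).
have C X Y c1 d1 e1 : dd X Y c1 d1 e1 = dd Y X c1 d1 e1.
  by rewrite -!ddE; exact: (smooth_deriveC oU).
have D2 X b1 c1 d1 e1 : 'D_X (fun y => F y b1 c1 d1 e1) x =
    dd X b1 c1 d1 e1 - dd X c1 b1 d1 e1 + dd X d1 b1 c1 e1 - dd X e1 b1 c1 d1.
  rewrite -(derive_eq_on oU X (fun y Uy => dphi b1 c1 d1 e1 Uy) Ux) -!ddE.
  have sd v1 v2 v3 v4 : smooth U ('D_v1 (fun y => phi y v2 v3 v4)) by exact: smooth_derive.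
  rewrite (sderiveB oU) //; last by apply: smoothD => //; exact: smoothB.
  rewrite (sderiveD oU) //; last exact: smoothB.
  by rewrite (sderiveB oU).
rewrite !D2 (C b a) (C c a) (C d a) (C e a) (C c b) (C d b) (C e b) (C d c) (C e c) (C e d).
ring.
Qed.

Lemma derive_F x X a b c d : U x -> 'D_X (fun y => F y a b c d) x =
  2 * (('D_X (th^~ a) x * phi x b c d + th x a * 'D_X (fun y => phi y b c d) x)
     - ('D_X (th^~ b) x * phi x a c d + th x b * 'D_X (fun y => phi y a c d) x)
     + ('D_X (th^~ c) x * phi x a b d + th x c * 'D_X (fun y => phi y a b d) x)
     - ('D_X (th^~ d) x * phi x a b c + th x d * 'D_X (fun y => phi y a b c) x))
  + 8 * (('D_X (fun y => om y a b) x * om x c d + om x a b * 'D_X (fun y => om y c d) x)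
     - ('D_X (fun y => om y a c) x * om x b d + om x a c * 'D_X (fun y => om y b d) x)
     + ('D_X (fun y => om y a d) x * om x b c + om x a d * 'D_X (fun y => om y b c) x)).
Proof.
move=> Ux; have st := lee_smooth H n2.
have stp a1 b1 c1 d1 : smooth U (fun y => th y a1 * phi y b1 c1 d1) by exact: smoothM.
have soo a1 b1 c1 d1 : smooth U (fun y => om y a1 b1 * om y c1 d1) by exact: smoothM.
have s1 : smooth U (fun y => th y a * phi y b c d - th y b * phi y a c d
    + th y c * phi y a b d - th y d * phi y a b c).
  by apply: smoothB => //; apply: smoothD => //; apply: smoothB.
have s2 : smooth U (fun y => om y a b * om y c d - om y a c * om y b d + om y a d * om y b c).
  by apply: smoothD => //; apply: smoothB.
rewrite (sderiveD oU) //; try exact: smoothZ.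
rewrite !(sderiveZ oU) // (sderiveB oU) //; last by apply: smoothD => //; apply: smoothB.
rewrite !(sderiveD oU) //; try first [exact: smoothB|exact: smoothN].
rewrite !(sderiveN oU) //.
by rewrite !(sderiveM oU _ (st _) (phi_smooth _ _ _) Ux)
  !(sderiveM oU _ (om_smooth _ _) (om_smooth _ _) Ux).
Qed.

(** [d d phi = 0] is evaluated on [(u, J u, v, J v, w)] with [w = eta u v]. Among triples of these
    vectors [phi] is nonzero only on [(u, v, w)] and [(J u, J v, w)], with opposite values, so
    [dtheta /\ phi] compares [dtheta] on the complementary pairs [(J u, J v)] and [(u, v)]. *)
Lemma dtheta_J_pair x u v : U x -> u != 0 -> v != 0 -> g x v u = 0 -> g x v (J x u) = 0 ->
  'D_(J x u) (th^~ (J x v)) x - 'D_(J x v) (th^~ (J x u)) x = 'D_u (th^~ v) x - 'D_v (th^~ u) x.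
Proof.
move=> Ux u0 v0 vu vJu; have W1 := Weta Ux.
have gC a b : g x a b = g x b a := lh_sym H a b Ux.
have gp a : a != 0 -> g x a a != 0 by move=> a0; rewrite gt_eqF // (lh_pos H).
have Juv : g x (J x u) v = 0 by rewrite gC.
have uv : g x u v = 0 by rewrite gC.
pose w := eta x u v.
have ww : g x w w != 0.
  rewrite /w type_constantE // /type_form uv (gC (J x u) u) (dot_self_J H Ux) Juv.
  rewrite !mul0r !subr0 addr0; apply: mulf_neq0; first exact: type_constant_neq0.
  by rewrite mulf_neq0 ?gp.
have wu : g x w u = 0 by exact: (w1_dot_l H Ux W1).
have wv : g x w v = 0 by exact: (w1_dot_r H Ux W1).
have Juw : g x (J x u) w = 0 by rewrite gC; exact: (w1_dot_Jl H Ux W1).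
have Jvw : g x (J x v) w = 0 by rewrite gC; exact: (w1_dot_Jr H Ux W1).
have o12 : om x u (J x u) = g x u u by rewrite /om (lh_herm H).
have o13 : om x u v = 0 by [].
have o14 : om x u (J x v) = 0 by rewrite /om (lh_herm H).
have o15 : om x u w = 0 by [].
have o23 : om x (J x u) v = 0 by rewrite /om (lh_sq H) // dotNl uv oppr0.
have o24 : om x (J x u) (J x v) = 0 by rewrite /om (lh_herm H).
have o25 : om x (J x u) w = 0 by rewrite /om (lh_sq H) // dotNl gC wu oppr0.
have o34 : om x v (J x v) = g x v v by rewrite /om (lh_herm H).
have o35 : om x v w = 0 by [].
have o45 : om x (J x v) w = 0 by rewrite /om (lh_sq H) // dotNl gC wv oppr0.
have f0 a b c : psi x a b c = 0 -> phi x a b c = 0 by move=> e; rewrite /phi e mulr0.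
have f12 c : phi x u (J x u) c = 0 by apply: f0; rewrite /psi (w1_selfJ W1) dot0l.
have f34 c : phi x v (J x v) c = 0 by apply: f0; rewrite /psi (w1_selfJ W1) dot0l.
have f134 : phi x u v (J x v) = 0 by apply: f0; exact: (w1_dot_Jr H Ux W1).
have f234 : phi x (J x u) v (J x v) = 0 by apply: f0; exact: (w1_dot_Jr H Ux W1).
have f145 : phi x u (J x v) w = 0.
  by apply: f0; rewrite /psi (w1_Jr W1) -/w dotNl gC (dot_self_J H Ux) oppr0.
have f235 : phi x (J x u) v w = 0.
  by apply: f0; rewrite /psi (w1_Jl W1) -/w dotNl gC (dot_self_J H Ux) oppr0.
pose P := phi x u v w.
have f245 : phi x (J x u) (J x v) w = - P.
  by rewrite /P /phi /psi (w1_Jl W1) (w1_Jr W1) (linN (Jv_linear S x)) opprK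
    (lh_sq H) // dotNl mulrN.
have P0 : P != 0 by rewrite /P /phi mulf_neq0 // invr_neq0 // type_constant_neq0.
have m1 := dom u (J x u) w Ux; have m2 := dom v (J x v) w Ux.
rewrite (w1_selfJ W1) (lin0 (Jv_linear S x)) dot0l in m1.
rewrite (w1_selfJ W1) (lin0 (Jv_linear S x)) dot0l in m2.
have := congr1 ( *%R (th x u)) (dphi (J x u) v (J x v) w Ux).
have := congr1 ( *%R (th x (J x u))) (dphi u v (J x v) w Ux).
have := congr1 ( *%R (th x v)) (dphi u (J x u) (J x v) w Ux).
have := congr1 ( *%R (th x (J x v))) (dphi u (J x u) v w Ux).
have := congr1 ( *%R (th x w)) (dphi u (J x u) v (J x v) Ux).
have := congr1 ( *%R (g x v v)) m1; have := congr1 ( *%R (g x u u)) m2.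
(* On this tuple every term but those of dtheta /\ phi cancels. *)
have := ddphi u (J x u) v (J x v) w Ux; rewrite !derive_F // -/P.
rewrite !f12 !f34 f134 f234 f145 f235 f245 o12 o13 o14 o15 o23 o24 o25 o34 o35 o45.
move: (g x u u) (g x v v) => gu gv.
move: (th x u) (th x (J x u)) (th x v) (th x (J x v)) (th x w) => t1 t2 t3 t4 t5.
move: P P0 {f245} => P P0.
abstract_derive => h1 h2 h3 h4 h5 h6 h7 h8.
apply: (mulfI P0); lra.
Qed.

End ExteriorDerivative.

Lemma smooth_sub (R : realType) (m : nat) (U U' : set 'rV[R]_m) (f : 'rV[R]_m -> R) :
  U' `<=` U -> smooth U f -> smooth U' f.
Proof.
move=> sU Sf k; move: (Sf k); elim: k f {Sf} => [|k IH] f [cf df].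
  by split => // x /sU; exact: cf.
split => [x /sU|i]; first exact: cf.
by have [d1 d2] := df i; split => [x /sU|]; [exact: d1|exact: IH].
Qed.

Lemma local_hermitian_sub (R : realType) (m : nat) (S : local_structure R m) (U U' : set 'rV[R]_m) :
  open U' -> U' `<=` U -> local_hermitian S U -> local_hermitian S U'.
Proof.
move=> oU' sU [oU sm sa sy po sq he]; split => //.
- by move=> i j; exact: smooth_sub (sm i j).
- by move=> i j; exact: smooth_sub (sa i j).
- by move=> x u v /sU; exact: sy.
- by move=> x u /sU; exact: po.
- by move=> x u /sU; exact: sq.
- by move=> x u v /sU; exact: he.
Qed.

Lemma open_smooth_neq0 (R : realType) (m : nat) (U : set 'rV[R]_m) (f : 'rV[R]_m -> R) :
  open U -> smooth U f -> open (U `&` [set y | f y != 0]).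
Proof.
move=> oU Sf; rewrite openE => x [Ux fx]; apply: filterI; first exact: open_near.
have cf := smooth_continuous Sf Ux.
apply: (cf [set z | z != 0]); apply: open_nbhs_nbhs; split => //; exact: open_neq.
Qed.

Lemma div_tensor0 (R : realType) (n : nat) (S : local_structure R (2 * n))
    (U : set 'rV[R]_(2 * n)) (H : local_hermitian S U)
    (t : 'rV_(2 * n) -> 'rV_(2 * n) -> 'rV_(2 * n) -> 'rV_(2 * n)) x u v :
  (forall y a b, U y -> t y a b = 0) -> U x -> div_tensor S t x u v = 0.
Proof.
move=> t0 Ux; rewrite div_tensor_div_form /div_form mtraceRE big1 // => i _; rewrite big1 // => j _.
by rewrite (eq_cov_tensor H _ _ _ t0 Ux) (cov_tensor0 H) // dot0l mulr0.
Qed.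

(** * Closedness of the Lee form in dimension six *)

Section Dimension6Lee.
Context {R : realType} (S : local_structure R (2 * 3)) (U : set 'rV[R]_(2 * 3)).
Hypothesis H : local_hermitian S U.
Local Notation E := 'rV[R]_(2 * 3).
Local Notation g := (dot S).
Local Notation J := (Jv S).
Local Notation W := (weyl_con S).
Local Notation th := (lee_form S).
Implicit Types (x u v a b : E).
Let oU := lh_open H.
Let n2 : (2 <= 3)%N := isT.

Lemma dleeE x u v : U x -> dlee S x u v = 'D_u (th^~ v) x - 'D_v (th^~ u) x.
Proof.
move=> Ux; rewrite (dlee_dtheta H n2) // /cov_lee !minimal_conE !(scaD (lee_scalar H n2 Ux)).
by rewrite !(scaN (lee_scalar H n2 Ux)) (levi_civitaC H v u Ux); abstract_derive; ring.
Qed.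

Lemma dlee_smooth u v : smooth U (fun x => dlee S x u v).
Proof.
apply: (smooth_eq oU (fun x Ux => esym (dleeE u v Ux))).
by apply: smoothB => //; apply: smooth_derive => //; exact: lee_smooth H n2 _.
Qed.

Lemma dlee_skew x u v : U x -> dlee S x v u = - dlee S x u v.
Proof. by move=> Ux; rewrite !dleeE // opprB. Qed.

Lemma dlee_scalar x u : U x -> scalar (dlee S x u).
Proof.
move=> Ux k v w; rewrite !dleeE // (derive_linear_dir oU (lee_smooth H n2 u) Ux).
rewrite (derive_eq_on oU (g := fun y => k * th y v + th y w)) //; last first.
  by move=> y Uy; exact: (lee_scalar H n2 Uy).
rewrite (sderiveD oU) ?(sderiveZ oU) //; try exact: (lee_smooth H n2).
  by abstract_derive; ring.
by apply: smoothZ => //; exact: (lee_smooth H n2).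
Qed.

Variables (t1 t2 t3 t4 : E -> E -> E -> E).
Hypothesis W1 : forall x, U x -> in_W1 S x (t1 x).
Hypothesis W2 : forall x, U x -> in_W2 S x (t2 x).
Hypothesis W3 : forall x, U x -> in_W3 S x (t3 x).
Hypothesis W4 : forall x, U x -> in_W4 S x (t4 x).
Hypothesis tE : forall x u v, U x ->
  torsion S x u v = t1 x u v + t2 x u v + t3 x u v + t4 x u v.
Hypothesis t20 : forall x u v, U x -> t2 x u v = 0.
Hypothesis t30 : forall x u v, U x -> t3 x u v = 0.

Lemma dlee_J_J x u v : U x -> dlee S x (J x u) (J x v) = - dlee S x u v.
Proof.
move=> Ux; have [_ _] := nonintegrable_identities H n2 W1 W2 W3 W4 tE t30 u v Ux.
by move=> /(_ isT) -> // a b; exact: t20.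
Qed.

Lemma weyl_torsion_t1 x : U x -> minimal_torsion J W x = t1 x.
Proof.
move=> Ux; apply/funext => u; apply/funext => v.
rewrite (weyl_torsion H u v Ux (components_w4_eq H n2 W1 W2 W3 W4 tE Ux)).
by rewrite -torsionE tE // t20 // t30 // !addr0 addrK.
Qed.

Lemma dlee_t1_neq0 x p q u v : U x -> t1 x p q != 0 -> dlee S x u v = 0.
Proof.
move=> Ux tpq; have lJ := Jv_linear S x.
pose N y := g y (t1 y p q) (t1 y p q).
have SN : smooth U N.
  by have [_ _ st] := t1_bilinear H n2 W1 W2 W3 W4 tE t30; apply: (smooth_dot H).
(* With [p] and [q] constant the condition is open, and on [U'] the W1 part is the nowhere vanishing
   minimal torsion of the Weyl connection. *)
pose U' := U `&` [set y | N y != 0].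
have sU' : U' `<=` U by move=> y [].
have H' := local_hermitian_sub (open_smooth_neq0 oU SN) sU' H.
have U'x : U' x by split => //; rewrite /N /= gt_eqF // (lh_pos H).
have Weta y : U' y -> in_W1 S y (minimal_torsion J W y).
  by move=> [Uy _]; rewrite weyl_torsion_t1 //; exact: W1.
have nz y : U' y -> minimal_torsion J W y p q != 0.
  by move=> [Uy Ny]; rewrite weyl_torsion_t1 //; apply: contraNneq Ny;
    rewrite /N /= => ->; rewrite dot0l.
(* On such a pair [dlee] is invariant under [J] by [dtheta_J_pair] and anti-invariant by
   [dlee_J_J]. *)
have pair a b : a != 0 -> b != 0 -> g x b a = 0 -> g x b (J x a) = 0 -> dlee S x a b = 0.
  move=> a0 b0 ba bJa; have := dtheta_J_pair H' Weta nz U'x a0 b0 ba bJa.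
  rewrite -(dleeE _ _ Ux) -(dleeE a b Ux) (dlee_J_J a b Ux) => h; lra.
have self a : dlee S x a (J x a) = 0.
  have := dlee_J_J a (J x a) Ux; rewrite (lh_sq H) // (scaN (dlee_scalar _ Ux)) (dlee_skew a) //.
  by move=> h; lra.
have [->|u0] := eqVneq u 0; first by rewrite dlee_skew // (sca0 (dlee_scalar _ Ux)) oppr0.
have := orth_part_l H Ux v u0; have := orth_part_J H Ux v u0.
rewrite {3}(orth_partE S x u v); move: (orth_part S x u v) => v' vJu vu.
rewrite !(scaD (dlee_scalar _ Ux)) !(scaZ (dlee_scalar _ Ux)) self.
have -> : dlee S x u u = 0 by have := dlee_skew u u Ux => h; lra.
rewrite !mulr0 !addr0.
have [->|v0] := eqVneq v' 0; first exact: sca0 (dlee_scalar _ Ux).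
exact: pair.
Qed.

Lemma dlee_dim6 x u v : U x -> dlee S x u v = 0.
Proof.
move=> Ux; apply/eqP/negPn/negP => d0.
(* Working where [dlee] is nonzero avoids the boundary of the zero set of [t1]: on this open set
   [t1] vanishes by [dlee_t1_neq0], hence so does its divergence, and the divergence identity leaves
   a nonzero multiple of [dlee] equal to 0. *)
pose U' := U `&` [set y | dlee S y u v != 0].
have sU' : U' `<=` U by move=> y [].
have H' := local_hermitian_sub (open_smooth_neq0 oU (dlee_smooth u v)) sU' H.
have U'x : U' x by [].
have t10 y a b : U' y -> t1 y a b = 0.
  move=> [Uy dy]; apply/eqP; apply: contraNT dy => tab.
  by rewrite (dlee_t1_neq0 _ _ Uy tab).
have [_ + _] := nonintegrable_identities H n2 W1 W2 W3 W4 tE t30 u v Ux.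
rewrite (div_tensor0 H' u v t10 U'x).
rewrite t10 // dot0l /proj20 dlee_J_J // => h.
by move/eqP: d0; apply; lra.
Qed.

End Dimension6Lee.

(** * The identities on the manifold, chart by chart *)

Theorem proposition4p3 (R : realType) (n : nat) (M : manifold R (2 * n))
    (H : almost_hermitian M) (xi1 xi2 xi3 xi4 : tensor12 M)
    (hn : (2 <= n)%N) (hxi : torsion_components H xi1 xi2 xi3 xi4) :
  (* (i) *)
  (vanishes xi3 ->
    [/\ (forall c x X Y, crange c x ->
          ric_star20 (H c) x X Y =
            - div_tensor (H c) (xi2 c) x X Y
            + (n%:R + 1) / 6 * proj20 (H c) (dlee (H c)) x X Y
            + n%:R / 2 * dot (H c) x (xi2 c x (lee_sharp (H c) x) X) Y),
        (* (a); when n = 2 the J-invariant part of d theta need not vanish *)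
        (vanishes xi2 ->
          [/\ (forall c x X Y, crange c x ->
                ric_star20 (H c) x X Y =
                  (n%:R + 1) / 6 * proj20 (H c) (dlee (H c)) x X Y),
              ((2 < n)%N -> forall c x X Y, crange c x ->
                ric_star20 (H c) x X Y = (n%:R + 1) / 6 * dlee (H c) x X Y)
            & (n = 3%N -> forall c x X Y, crange c x ->
                ric_star20 (H c) x X Y = 0 /\ dlee (H c) x X Y = 0)])
      & (* (b) *)
        (vanishes xi1 ->
          ((2 < n)%N -> forall c x X Y, crange c x ->
            ric_star20 (H c) x X Y =
              - div_tensor (H c) (xi2 c) x X Y
              + n%:R / 2 * dot (H c) x (xi2 c x (lee_sharp (H c) x) X) Y) /\
          (n = 2%N -> forall c x X Y, crange c x ->
            ric_star20 (H c) x X Y =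
              - div_tensor (H c) (xi2 c) x X Y
              + 2^-1 * proj20 (H c) (dlee (H c)) x X Y
              + dot (H c) x (xi2 c x (lee_sharp (H c) x) X) Y))]) /\
  (* (ii) *)
  (vanishes xi1 -> vanishes xi2 ->
    [/\ (* (a) *)
        (forall c x X Y, crange c x ->
          ric_star20 (H c) x X Y =
            (n%:R - 1) / 2 * proj20 (H c) (dlee (H c)) x X Y),
        ((2 < n)%N -> forall c x X Y, crange c x ->
          ric_star20 (H c) x X Y =
            (n%:R - 1) / (n%:R - 2) *
              (div_tensor (H c) (xi3 c) x X Y
               - (n%:R - 1) / 2 *
                   dot (H c) x (xi3 c x (lee_sharp (H c) x) X) Y))
      & (* (b) *)
        (n = 2%N -> forall c x X Y, crange c x ->
          proj11_0 (H c)
            (fun y u v => ric (H c) y u v - ric_star (H c) y u v) x X Y = 0)]).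
Proof.
have Hl c : local_hermitian (H c) (crange c) := almost_hermitian_local H c.
have W1 c x : crange c x -> in_W1 (H c) x (xi1 c x) by move=> /hxi [].
have W2 c x : crange c x -> in_W2 (H c) x (xi2 c x) by move=> /hxi [].
have W3 c x : crange c x -> in_W3 (H c) x (xi3 c x) by move=> /hxi [].
have W4 c x : crange c x -> in_W4 (H c) x (xi4 c x) by move=> /hxi [].
have tE c x u v : crange c x ->
  torsion (H c) x u v = xi1 c x u v + xi2 c x u v + xi3 c x u v + xi4 c x u v.
  by move=> /hxi [].
have n2 : (2 < n)%N -> n%:R - 2 != 0 :> R.
  by move=> n2; rewrite subr_eq0 (eqr_nat R n 2) gtn_eqF.
split.
- move=> v3.
  have id c x X Y (cx : crange c x) := nonintegrable_identities (Hl c) hn (W1 c) (W2 c) (W3 c)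
    (W4 c) (tE c) (fun x u v => v3 c x u v) X Y cx.
  split.
  + by move=> c x X Y cx; have [-> _ _] := id c x X Y cx.
  + move=> v2.
    have r20 c x X Y : crange c x -> ric_star20 (H c) x X Y =
        (n%:R + 1) / 6 * proj20 (H c) (dlee (H c)) x X Y.
      move=> cx; have [-> _ _] := id c x X Y cx.
      rewrite (div_tensor0 (Hl c) X Y (fun y a b => v2 c y a b) cx) (v2 c x) // dot0l.
      by rewrite mulr0 oppr0 add0r addr0.
    split => // [n3 c x X Y cx|n3 c x X Y cx].
      rewrite r20 //; have [_ _ /(_ n3)] := id c x X Y cx.
      move=> /(_ (fun a b => v2 c x a b cx)) e; rewrite /proj20 e; congr (_ * _).
      by rewrite opprK; move: (dlee _ _ _ _) => k; field.
    subst n; have d0 := dlee_dim6 (Hl c) (W1 c) (W2 c) (W3 c) (W4 c) (tE c)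
      (fun x u v => v2 c x u v) (fun x u v => v3 c x u v).
    by split; [rewrite r20 // /proj20 !d0 // subrr !mulr0|exact: d0].
  (* With [xi1 = 0] the divergence identity reads [0 = - (n - 2) / 6 * proj20 dlee], which removes
     the middle term of (i) when [n > 2]; for [n = 2] its coefficient [(n + 1) / 6] is [1 / 2]. *)
  + move=> v1; split => [n3 c x X Y cx|n2' c x X Y cx]; have [-> e _] := id c x X Y cx.
      move: e; rewrite (div_tensor0 (Hl c) X Y (fun y a b => v1 c y a b) cx) (v1 c x) // dot0l.
      rewrite mulr0 addr0 => /esym/eqP; rewrite mulf_eq0 => /orP[/eqP h|/eqP ->].
        by have := n2 n3; move=> /eqP; case; lra.
      by rewrite mulr0 addr0.
    have -> : n%:R = 2 :> R by rewrite n2'.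
    congr (_ + _ * _ + _); first by field.
    by rewrite divff ?mul1r ?pnatr_eq0.
- move=> v1 v2.
  have id c x X Y (cx : crange c x) := hermitian_ric_star20 (Hl c) hn (W1 c) (W2 c) (W3 c)
    (W4 c) (tE c) (fun x u v => v1 c x u v) (fun x u v => v2 c x u v) X Y cx.
  split => [c x X Y cx|n3 c x X Y cx|n2' c x X Y cx].
  + by have [] := id c x X Y cx.
  + have [e1 e2] := id c x X Y cx; have := n2 n3 => n0.
    move: e1 e2; move: (ric_star20 _ _ _ _) (proj20 _ _ _ _ _) (div_tensor _ _ _ _ _) (dot _ _ _ _).
    move=> r p d q e1 e2.
    (* Equating the two formulas for [ric_star20] expresses this bracket through the differential of
       the Lee form, with the factor [n - 2] that cancels the denominator. *)
    have -> : d - (n%:R - 1) / 2 * q = (n%:R - 2) / 2 * p by lra.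
    by rewrite e1; field.
  + subst n.
    (* W3 is zero in dimension four, so the torsion of a Hermitian structure lies in W4 alone. *)
    have xiE y : crange c y -> minimal_torsion (Jv (H c)) (levi_civita (H c)) y = xi4 c y.
      move=> cy; apply/funext => u; apply/funext => v.
      by rewrite -torsionE tE // (v1 c) // (v2 c) // (in_W3_dim4 (Hl c) cy _ _ (W3 c y cy)) !add0r.
    apply: (proj11_0_dim4 (Hl c)) => // y cy; rewrite xiE //.
      exact: (components_W4 (W4 c)).
    exact: (components_w4_eq (Hl c) hn (W1 c) (W2 c) (W3 c) (W4 c) (tE c)).
Qed.
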